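(* Assume that conditions A1 and A2 (stated in the context) hold and that the chain $Z$ is Harris recurrent. (i) For all $l,s\ge1$, $$\lim_{t\to\infty}\ \sup_{n\ge t}\ \|P(Y_{t:\infty}\in\cdot\mid X_{l:n})-P(Y_{t:\infty}\in\cdot\mid X_{s:n})\|_{\rm TV}=0,\quad\text{a.s.}$$ (ii) If $Z$ is positive Harris, then there exists a constant $\alpha$ with $0<\alpha<1$ such that the following holds: for every $s\ge1$ there exists a $\sigma(X_{s:\infty})$-measurable random variable $C_s<\infty$ such that for all $t\ge s\ge l\ge1$ $$\sup_{n\ge t}\ \|P(Y_{t:\infty}\in\cdot\mid X_{l:n})-P(Y_{t:\infty}\in\cdot\mid X_{s:n})\|_{\rm TV}\le C_s\,\alpha^{t-s},\quad\text{a.s.}$$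
   Context: Setting. $\mathcal X$ is a Polish space with Borel $\sigma$-field $\mathcal B(\mathcal X)$, $\mathcal Y=\{1,\dots,|\mathcal Y|\}$ is a finite set, $\mathcal Z=\mathcal X\times\mathcal Y$ with $\sigma$-field $\mathcal B(\mathcal Z)=\mathcal B(\mathcal X)\otimes 2^{\mathcal Y}$. $\mu$ is a $\sigma$-finite measure on $\mathcal B(\mathcal X)$ and $c$ is the counting measure on $2^{\mathcal Y}$. $q:\mathcal Z^2\to[0,\infty)$, $(z',z)\mapsto q(z'|z)$, is measurable and for each $z$ the function $z'\mapsto q(z'|z)$ is a probability density with respect to $\mu\times c$. $Z=\{Z_k\}_{k\ge1}=\{(X_k,Y_k)\}_{k\ge1}$ is a homogeneous Markov chain on a probability space $(\Omega,\mathcal F,\mathbf P)$ with transition kernel $P(Z_2\in C\mid Z_1=z)=\int_C q(z'|z)\,(\mu\times c)(dz')$; $Z_1$ has a density with respect to $\mu\times c$ and its law is otherwise arbitrary. ''a.s.'' refers to $\mathbf P$. $P_z$ is the law of the chain started at $Z_1=z$. $a_{l:n}$ denotes $(a_l,\dots,a_n)$, $n\le\infty$. $P(Y_{t:\infty}\in\cdot\mid X_{l:n})$ is a regular version of the conditional distribution on the cylindrical $\sigma$-algebra of $\mathcal Y^\infty$, and $\|\cdot\|_{\rm TV}$ is the total variation norm of a signed measure (total mass of its variation, which on a finite set is $\sum_i|\xi(i)|$). Notation. For $n\ge2$, $x_{1:n}\in\mathcal X^n$, $i,j\in\mathcal Y$, $$p_{ij}(x_{1:n})=\sum_{y_{1:n}:\,y_1=i,\,y_n=j}\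 \prod_{k=2}^n q(x_k,y_k|x_{k-1},y_{k-1}),\qquad \mathcal Y^+(x_{1:n})=\{(i,j):p_{ij}(x_{1:n})>0\}.$$ For a set $A$ of vectors of length $r>1$, $A_{(k)}=\{x_k: x_{1:r}\in A\}$ is its $k$-th projection and $A(x_1)=\{x_{2:r}:x_{1:r}\in A\}$ (measures of projections are understood with respect to the completed $\sigma$-field). Chain terminology. $Z$ is $\varphi$-irreducible, for a $\sigma$-finite measure $\varphi$ on $\mathcal B(\mathcal Z)$, if $\varphi(A)>0$ implies $\sum_{k\ge2}P_z(Z_k\in A)>0$ for all $z\in\mathcal Z$; $\psi$ denotes the maximal irreducibility measure (it dominates every irreducibility measure). $Z$ is Harris recurrent if it is $\psi$-irreducible and $\psi(A)>0$ implies $P_z(Z_k\in A\text{ i.o.})=1$ for all $z$; it is positive if its kernel admits an invariant probability measure; positive Harris means positive and Harris recurrent. Conditions (with the same $r$ and $E$). A1: There exist an integer $r>1$ and a measurable set $E\subset\mathcal X^r$ such that $\mathcal Y^+:=\mathcal Y^+(x_{1:r})\ne\emptyset$ is the same for all $x_{1:r}\in E$, and $\mathcal Y^+=\mathcal Y^+_{(1)}\times\mathcal Y^+_{(2)}$. A2: $Z$ is $\psi$-irreducible with $\psi(E_{(1)}\times\mathcal Y^+_{(1)})>0$, and $\mu^{r-1}(E(x_1))>0$ for all $x_1\in E_{(1)}$. *)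

(* Defs.v *)
From HB Require Import structures.
From mathcomp Require Import all_boot all_order all_algebra.
From mathcomp Require Import all_classical all_reals all_analysis.
From mathcomp Require Import measurable_realfun.

(* Time is counted from 0: index k : nat here is the time
   k + 1 of the usual notation Z_1, Z_2, ...  In tuples likewise, the first
   coordinate x_1 of x_{1:r} is nth _ x 0. *)

Set Implicit Arguments.
Unset Strict Implicit.
Unset Printing Implicit Defensive.

Import Order.TTheory GRing.Theory Num.Theory.
Import numFieldNormedType.Exports.

Local Open Scope classical_set_scope.
Local Open Scope ring_scope.
Local Open Scope ereal_scope.

(* The finite set Y = {1, ..., |Y|} is 'I_m.+1, with |Y| = m + 1 and with the
   discrete sigma-algebra; |Y| > 0 because Y carries random variables. *)
HB.instance Definition _ (m : nat) := isPointed.Build 'I_m.+1 ord0.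

HB.instance Definition _ (m : nat) :=
  @isMeasurable.Build default_measure_display 'I_m.+1 discrete_measurable
    discrete_measurable0 discrete_measurableC discrete_measurableU.

Lemma sigma_finite_counting_ord (R : realType) (m : nat) :
  sigma_finite [set: 'I_m.+1] (@counting 'I_m.+1 R).
Proof.
exists (fun=> setT); first by rewrite bigcup_const.
by move=> _; split => //; rewrite /counting/= asboolT ?ltry.
Qed.

HB.instance Definition _ (R : realType) (m : nat) :=
  Measure_isSigmaFinite.Build _ _ _ (@counting 'I_m.+1 R)
    (@sigma_finite_counting_ord R m).

Notation borel T := (g_sigma_algebraType (@open T)).

(* A Hausdorff pseudometric structure is a metric (possibly with infinite
   distances), so this says separable and completely metrizable. *)
Definition polish (R : realType) (T : completePseudoMetricType R) : Prop :=
  hausdorff_space T /\ exists2 D : set T, countable D & dense D.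

Section processes.
Context {dO dS : measure_display} {Omega : measurableType dO}
  {S : measurableType dS}.

(* Generators of sigma(V_k : k in I). *)
Definition process_gen (V : nat -> Omega -> S) (I : set nat) :
    set (set Omega) :=
  \bigcup_(k in I) preimage_set_system setT (V k) measurable.

End processes.

(* S^oo with its cylindrical sigma-algebra. *)
Notation seqspace S := (g_sigma_algebraType
  (\bigcup_(k in [set: nat])
     preimage_set_system setT (fun w : nat -> S => w k) measurable)).

(* Time horizons n <= oo, with None for n = oo. *)
Definition le_horizon (k : nat) (n : option nat) : bool :=
  if n is Some n' then (k <= n')%N else true.

Definition time_window (l : nat) (n : option nat) : set nat :=
  [set k | (l <= k)%N && le_horizon k n].

(* f is a version of the conditional probability P(A | sigma(G)). *)
Definition is_cond_prob {d : measure_display} {Omega : measurableType d}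
    {R : realType} (P : probability Omega R) (G : set (set Omega))
    (A : set Omega) (f : Omega -> \bar R) : Prop :=
  measurable_fun [set: g_sigma_algebraType G] f /\
  forall B, <<s G >> B -> \int[P]_(w in B) f w = P (A `&` B).

Section total_variation.
Context {d : measure_display} {T : measurableType d} {R : realType}.

(* Total mass of the variation; the value does not depend on the Hahn
   decomposition that is picked. *)
Definition tv_norm (nu : {charge set T -> \bar R}) : \bar R :=
  charge_variation
    (projT2 (cid (projT2 (cid (Hahn_decomposition nu))))) setT.

Definition tv_dist (P1 P2 : probability T R) : \bar R :=
  tv_norm (cadd (charge_of_finite_measure P1)
                (copp (charge_of_finite_measure P2))).

End total_variation.

Section chain.
Context {d : measure_display} {X : measurableType d} {m : nat} {R : realType}.
Variable mu : {sigma_finite_measure set X -> \bar R}.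
Local Notation Y := 'I_m.+1.
Local Notation Z := (X * Y)%type.

Local Notation ref_measure := (mu \x (@counting Y R)).

(* q z' z stands for q(z'|z). *)
Definition transition_density (q : Z -> Z -> R) : Prop :=
  [/\ forall z' z, (0 <= q z' z)%R,
      measurable_fun setT (fun u : Z * Z => q u.1 u.2) &
      forall z, \int[ref_measure]_z' (q z' z)%:E = 1].

Definition kernel_of (q : Z -> Z -> R) (z : Z) (C : set Z) : \bar R :=
  \int[ref_measure]_(z' in C) (q z' z)%:E.

Definition markov_chain {dO : measure_display} {Omega : measurableType dO}
    (P : probability Omega R) (q : Z -> Z -> R) (V : nat -> Omega -> Z) :
    Prop :=
  (forall k, measurable_fun setT (V k)) /\
  forall k (C : set Z), measurable C ->
    is_cond_prob P (process_gen V [set j | (j <= k)%N])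
      (V k.+1 @^-1` C) (fun w => kernel_of q (V k w) C).

Definition has_density (nu : set Z -> \bar R) : Prop :=
  exists f : Z -> R,
    [/\ forall z, (0 <= f z)%R, measurable_fun setT f &
        forall C, measurable C -> nu C = \int[ref_measure]_(z in C) (f z)%:E].

(* Q is the law, on the space of trajectories, of the chain started at z. *)
Definition chain_law (q : Z -> Z -> R) (z : Z) (Q : probability (seqspace Z) R)
    : Prop :=
  markov_chain Q q (fun k (w : seqspace Z) => w k) /\
  forall A : set Z, measurable A -> Q [set w | A (w 0%N)] = \d_z A.

Definition irreducible (Pz : Z -> probability (seqspace Z) R)
    (phi : set Z -> \bar R) : Prop :=
  forall A : set Z, measurable A -> 0 < phi A ->
    forall z, 0 < \sum_(1 <= k <oo) Pz z [set w | A (w k)].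

Definition maximal_irreducible (Pz : Z -> probability (seqspace Z) R)
    (psi : {sigma_finite_measure set Z -> \bar R}) : Prop :=
  irreducible Pz psi /\
  forall phi : {sigma_finite_measure set Z -> \bar R},
    irreducible Pz phi -> phi `<< psi.

Definition harris_recurrent (Pz : Z -> probability (seqspace Z) R)
    (psi : {sigma_finite_measure set Z -> \bar R}) : Prop :=
  maximal_irreducible Pz psi /\
  forall A : set Z, measurable A -> 0 < psi A ->
    forall z, Pz z (lim_sup_set (fun k => [set w | A (w k)])) = 1.

Definition positive_chain (q : Z -> Z -> R) : Prop :=
  exists pi : probability Z R,
    forall A : set Z, measurable A -> pi A = \int[pi]_z kernel_of q z A.

Definition p_ (q : Z -> Z -> R) (n : nat) (x : n.-tuple X) (i j : Y) : R :=
  (\sum_(y : n.-tuple Y | (nth ord0 y 0 == i) && (nth ord0 y n.-1 == j))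
     \prod_(1 <= k < n) q (nth point x k, nth ord0 y k)
                          (nth point x k.-1, nth ord0 y k.-1))%R.

Definition Yplus (q : Z -> Z -> R) (n : nat) (x : n.-tuple X) : set (Y * Y) :=
  [set ij | (0 < p_ q x ij.1 ij.2)%R].

(* E_(1) and E(x_1). *)
Definition proj_first (r : nat) (E : set (r.-tuple X)) : set X :=
  (fun x : r.-tuple X => nth point x 0) @` E.

Definition tail_section (r : nat) (E : set (r.-tuple X)) (x1 : X) :
    set (r.-1.-tuple X) :=
  (fun x : r.-tuple X => [tuple of behead x]) @`
    (E `&` [set x | nth point x 0 = x1]).

(* mu^k, by iterated integration. *)
Fixpoint power_measure (k : nat) : set (k.-tuple X) -> \bar R :=
  match k with
  | 0 => fun A => \d_[tuple] A
  | k'.+1 => fun A =>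
      \int[mu]_x power_measure [set u : k'.-tuple X | A [tuple of x :: u]]
  end.

Definition conditionA1 (q : Z -> Z -> R) (r : nat) (E : set (r.-tuple X))
    (Yp : set (Y * Y)) : Prop :=
  [/\ (1 < r)%N, measurable E, Yp !=set0,
      forall x, E x -> Yplus q x = Yp &
      Yp = (fst @` Yp) `*` (snd @` Yp)].

(* E_(1) is a projection, whence the completion of psi (in fact the second
   clause makes E_(1) measurable). *)
Definition conditionA2 (Pz : Z -> probability (seqspace Z) R)
    (psi : {sigma_finite_measure set Z -> \bar R})
    (r : nat) (E : set (r.-tuple X)) (Yp : set (Y * Y)) : Prop :=
  [/\ maximal_irreducible Pz psi,
      0 < @completed_measure_extension _ _ _ psi
            (proj_first E `*` (fst @` Yp)) &
      forall x1, proj_first E x1 -> 0 < power_measure (tail_section E x1)].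

(* K t l n w A is a regular version of P(Y_{t:oo} in A | X_{l:n})(w); for n < l
   the tuple X_{l:n} is empty and generates the trivial sigma-algebra. *)
Definition regular_version {dO : measure_display} {Omega : measurableType dO}
    (P : probability Omega R) (V : nat -> Omega -> Z)
    (K : nat -> nat -> option nat -> Omega -> probability (seqspace Y) R)
    : Prop :=
  forall t l n (A : set (seqspace Y)), measurable A ->
    is_cond_prob P
      (process_gen (fun k w => (V k w).1) (time_window l n))
      [set w | A (fun k => (V (t + k)%N w).2)]
      (fun w => K t l n w A).

End chain.

(* sup_{n >= t} || P(Y_{t:oo} in . | X_{l:n}) - P(Y_{t:oo} in . | X_{s:n}) || *)
Definition smoothing_gap {dY : measure_display} {Omega : Type}
    {T : measurableType dY} {R : realType}
    (K : nat -> nat -> option nat -> Omega -> probability T R)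
    (l s t : nat) (w : Omega) : \bar R :=
  ereal_sup [set tv_dist (K t l n w) (K t s n w) | n in [set n | le_horizon t n]].

(* Main.v *)
Require Import Defs.
From HB Require Import structures.
From mathcomp Require Import all_boot all_order all_algebra.
From mathcomp Require Import all_classical all_reals all_analysis.
From mathcomp Require Import measurable_realfun.
From mathcomp Require Import ring lra zify.

(** Fix a trajectory [x] of the observations. Given [X_{l:n} = x_{l:n}], the
    hidden process is an inhomogeneous Markov chain, and for finite [n]
    Bayes' rule gives [P(Y_{t:oo} in A | X_{l:n})] as a quotient
    [(\sum_j a_j b^A_j) / (\sum_j a_j b^1_j)]. Here [b^A_j] is the density of the
    observations after time [s] and of the event [A] when [Y_s = j]; the weights
    [a_j] collect everything that happens up to time [s], and they alone depend
    on [l]. Conditioning on [X_{s:n}] instead changes the weights only. Two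
    weighted quotients of this kind differ by at most any [c] such that
    [b^A_j b^1_j' - b^A_j' b^1_j <= c b^1_j b^1_j'] for all [j], [j'].
    At time [t] one may take [c = 1], and going back in time through a block
    [x_{k:k+r-1}] multiplies [c] by [1 - 1/N] as soon as
    [p_ij' p_i'j <= N p_ij p_i'j'] on that block: this is [oscillation_mix].
    The form without quotients makes the rows that vanish harmless. Hence the
    conditional laws are within [2 g ^ (number of good blocks in [s, t])], where
    a block is good when it lies in [E] and has cross ratios bounded by [N]
    ([path_oscillation], [mixture_ratio_le], [gap_le_rate]).

    For [n = oo] there are no densities; the bound passes to the limit since the
    conditional probabilities given [X_{l:n}] converge in [L1] to the one given
    [X_{l:oo}] ([cond_prob_L1_cvg], [L1_cvg_dist_le]). The total variation
    distance is controlled by the countable algebra of cylinders of the path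
    space of the hidden process, so that countably many almost sure bounds
    suffice ([tv_dist_le]).

    The zero pattern of [p] is a fixed rectangle on [E], so each block of [E] is
    good for [N] large, and [conditionA2] yields one [N] for which the states that
    start a good block with probability at least [1/(N+1)] have positive [psi]
    measure ([good_block_recurrent]). Harris recurrence brings the chain back to these
    states for ever, and each return is a new chance of success, so there are
    infinitely many good blocks ([never_null]) and the bound tends to [0].
    When there is an invariant law, good blocks even have positive lower
    frequency from every starting point ([sparse_null]): a covering argument of
    Katznelson and Weiss gives it with positive probability for the stationary
    chain, and the zero-one law for shift invariant events of a Harris chain
    ([harris_zero_one]) does the rest. This gives the geometric rate; the
    constant [C_s] is the supremum over [t] of the bound divided by
    [alpha ^ (t - s)], a function of [X_{s:oo}] because goodness of a block is
    read off the observations. *)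

Set Implicit Arguments.
Unset Strict Implicit.
Unset Printing Implicit Defensive.

Import Order.TTheory GRing.Theory Num.Theory.
Import numFieldNormedType.Exports.

Local Open Scope classical_set_scope.
Local Open Scope ring_scope.
Local Open Scope ereal_scope.

(** * Mixtures, densities and approximation by an algebra *)

Section mixtures.
Context d d' (T : measurableType d) (S : measurableType d') (R : realType).

Import HBNNSimple.

(** True for indicators by [nuE], hence for simple functions, hence for monotone
    limits. The integration formulas for densities, image measures and Markov
    chains below are instances of it. *)
Lemma integral_mixture (P : {measure set T -> \bar R}) (B : set T)
    (mB : measurable B) (k : T -> {measure set S -> \bar R})
    (mk : forall C, measurable C -> measurable_fun setT (k ^~ C))
    (nu : {measure set S -> \bar R})
    (nuE : forall C, measurable C -> nu C = \int[P]_(t in B) k t C)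
    (h : S -> \bar R) (h0 : forall x, 0 <= h x) (mh : measurable_fun setT h) :
  \int[nu]_x h x = \int[P]_(t in B) \int[k t]_x h x.
Proof.
pose h_ := nnsfun_approx measurableT mh.
have lim_h (m : {measure set S -> \bar R}) :
    \int[m]_x h x = lim (\int[m]_x (h_ n x)%:E @[n --> \oo]).
  rewrite -monotone_convergence//.
  - by apply: eq_integral => x _; apply/esym/cvg_lim => //; exact: cvg_nnsfun_approx.
  - by move=> n; exact/measurable_EFinP.
  - by move=> n x _; rewrite lee_fin.
  - by move=> x _ a b ab; rewrite lee_fin; exact/lefP/nd_nnsfun_approx.
rewrite lim_h.
under [RHS]eq_integral do rewrite lim_h.
rewrite monotone_convergence//.
- apply: congr_lim; apply/funext => n.
  rewrite integralT_nnsfun sintegralE.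
  under [RHS]eq_integral do rewrite integralT_nnsfun sintegralE.
  rewrite ge0_integral_fsum//.
  + apply: eq_fsbigr => r /[!inE] -[x _ <-].
    rewrite ge0_integralZl//; last 2 first.
      by apply: measurable_funTS; exact: mk.
      by rewrite lee_fin.
    by rewrite nuE.
  + move=> r; apply: measurable_funTS; apply: measurable_funeM.
    exact: mk.
  + by move=> r t _; exact: nnfun_muleindic_ge0 || exact: nnsfun_mulemu_ge0.
- move=> n; apply: measurable_funTS.
  apply: measurable_fun_integral_kernel => //.
  + by move=> x; rewrite lee_fin.
  + exact/measurable_EFinP.
- by move=> n t _; apply: integral_ge0 => x _; rewrite lee_fin.
- move=> t _ a b ab; apply: ge0_le_integral => //.
  + by move=> x _; rewrite lee_fin.
  + exact/measurable_EFinP.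
  + exact/measurable_EFinP.
  + by move=> x _; rewrite lee_fin; exact/lefP/nd_nnsfun_approx.
Qed.

End mixtures.

Section densities.
Context d (S : measurableType d) (R : realType).

Lemma integral_density (P : {measure set S -> \bar R}) (f : S -> R)
    (f0 : forall x, (0 <= f x)%R) (mf : measurable_fun setT f)
    (nu : {measure set S -> \bar R})
    (nuE : forall C, measurable C -> nu C = \int[P]_(x in C) (f x)%:E)
    (h : S -> \bar R) (h0 : forall x, 0 <= h x) (mh : measurable_fun setT h) :
  \int[nu]_x h x = \int[P]_x (h x * (f x)%:E).
Proof.
(* A density is a mixture of the masses [f x] placed at the points [x]. *)
pose k (x : S) : {measure set S -> \bar R} :=
  mscale (NngNum (f0 x)) (dirac x : {measure set S -> \bar R}).
have kE x C : k x C = (f x * \1_C x)%:E.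
  by rewrite /k /= /mscale /= diracE indicE.
rewrite (@integral_mixture _ _ _ _ _ P setT measurableT k)//.
- apply: eq_integral => x _; rewrite ge0_integral_mscale// integral_dirac//.
  by rewrite diracT mul1e muleC.
- move=> C mC; rewrite (_ : k ^~ C = fun x => (f x * \1_C x)%:E); last exact/funext.
  by apply/measurable_EFinP; exact: measurable_funM.
- move=> C mC; rewrite nuE// integral_mkcond.
  apply: eq_integral => x _; rewrite kE patchE indicE.
  by case: ifPn; rewrite (mulr1, mulr0).
Qed.

End densities.

Section algebra_approximation.
Context d (T : measurableType d) (R : realType).

Definition symdiff (A B : set T) := (A `\` B) `|` (B `\` A).

Lemma measurable_symdiff A B :
  measurable A -> measurable B -> measurable (symdiff A B).
Proof. by move=> mA mB; apply: measurableU; apply: measurableD. Qed.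

(** The sets that the algebra [G] approximates form a sigma-algebra: a countable
    union is close to a finite one because [m] is finite. *)
Lemma algebra_approx (m : {measure set T -> \bar R}) (G : set (set T)) :
  fin_num_fun m -> G `<=` measurable -> G setT -> setC_closed G -> setU_closed G ->
  forall A, <<s G >> A -> forall e : R, (0 < e)%R ->
    exists2 B, G B & m (symdiff A B) < e%:E.
Proof.
move=> mfin Gm GT GC GU.
suff H : <<s G >> `<=` [set A | measurable A /\ forall e : R, (0 < e)%R ->
    exists2 B, G B & m (symdiff A B) < e%:E].
  by move=> A /H[].
apply: smallest_sub; last first.
  move=> A GA; split; first exact: Gm.
  move=> e e0; exists A => //.
  by rewrite /symdiff setDv setU0 measure0 lte_fin.
have appU A B e : measurable A -> measurable B ->
    (forall e : R, (0 < e)%R -> exists2 C, G C & m (symdiff A C) < e%:E) ->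
    (forall e : R, (0 < e)%R -> exists2 C, G C & m (symdiff B C) < e%:E) ->
    (0 < e)%R -> exists2 C, G C & m (symdiff (A `|` B) C) < e%:E.
  move=> mA mB hA hB e0; have e20 : (0 < e / 2)%R by rewrite divr_gt0.
  have [C GCC mC] := hA _ e20; have [D GD mD] := hB _ e20.
  exists (C `|` D); first exact: GU.
  apply: (@le_lt_trans _ _ (m (symdiff A C `|` symdiff B D))).
    apply: le_measure; rewrite ?inE.
    - by apply: measurable_symdiff; apply: measurableU => //; exact: Gm.
    - by apply: measurableU; apply: measurable_symdiff => //; exact: Gm.
    - by move=> x; rewrite /symdiff /=; tauto.
  apply: le_lt_trans; first apply: measureU2.
  - by apply: measurable_symdiff => //; exact: Gm.
  - by apply: measurable_symdiff => //; exact: Gm.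
  by rewrite (splitr e) EFinD lteD.
split.
- split=> // e e0; exists set0; last by rewrite /symdiff setDv setU0 measure0 lte_fin.
  by rewrite -setCT; exact: GC.
- move=> A [mA hA]; rewrite setTD; split; first exact: measurableC.
  move=> e /hA[B GB mB]; exists (~` B); first exact: GC.
  rewrite (_ : symdiff (~` A) (~` B) = symdiff A B)//.
  by rewrite /symdiff !setDE !setCK setUC (setIC B) (setIC A).
- move=> F hF; split; first by apply: bigcup_measurable => i _; case: (hF i).
  move=> e e0.
  pose Fn n := \big[setU/set0]_(i < n) F i.
  have mFn n : measurable (Fn n).
    by apply: bigsetU_measurable => i _; case: (hF i).
  have hFn n : forall e : R, (0 < e)%R ->
      exists2 C, G C & m (symdiff (Fn n) C) < e%:E.
    elim: n => [|n IHn] e' e'0.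
      exists set0; last by rewrite /Fn big_ord0 /symdiff setDv setU0 measure0 lte_fin.
      by rewrite -setCT; exact: GC.
    rewrite /Fn big_ord_recr/=; case: (hF n) => mFn1 hFn1.
    exact: (appU _ _ _ (mFn n) mFn1 IHn hFn1).
  have e20 : (0 < e / 2)%R by rewrite divr_gt0.
  pose D n := (\bigcup_i F i) `\` Fn n.
  have mF : measurable (\bigcup_i F i).
    by apply: bigcup_measurable => i _; case: (hF i).
  have : m (D n) @[n --> \oo] --> m (\bigcap_n D n).
    apply: nonincreasing_cvg_mu => //.
    - by rewrite -ge0_fin_numE//; apply: mfin; exact: measurableD.
    - by move=> n; exact: measurableD.
    - by apply: bigcapT_measurable => n; exact: measurableD.
    - move=> a b ab; apply/subsetPset; apply: setDS.
      exact: subset_bigsetU.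
  rewrite (_ : \bigcap_n D n = set0); last first.
    rewrite -subset0 => x Dx; have [[i _ Fix]] := Dx 0%N I.
    have [_ /=] := Dx i.+1 I.
    by move=> + _; apply; rewrite /Fn big_ord_recr/=; right.
  rewrite measure0 => /fine_cvgP[_ /cvgrPdist_lt/(_ _ e20)[N _ /(_ N (leqnn _))]].
  rewrite /= sub0r normrN ger0_norm ?fine_ge0// => mDN.
  have {}mDN : m (D N) < (e / 2)%:E.
    by rewrite -(@fineK _ (m (D N)))//; apply: mfin; exact: measurableD.
  have [B GB mB] := hFn N _ e20; exists B => //.
  apply: (@le_lt_trans _ _ (m (D N `|` symdiff (Fn N) B))).
    apply: le_measure; rewrite ?inE.
    - by apply: measurable_symdiff => //; exact: Gm.
    - apply: measurableU; first exact: measurableD.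
      by apply: measurable_symdiff => //; exact: Gm.
    - move=> x; rewrite /symdiff /D /= => -[[Fx nBx]|[Bx nFx]].
        by case: (pselect (Fn N x)); tauto.
      right; right; split=> //; apply: contra_not nFx.
      by rewrite /Fn -bigcup_mkord => -[i _ Fix]; exists i.
  apply: le_lt_trans; first apply: measureU2.
  - exact: measurableD.
  - by apply: measurable_symdiff => //; exact: Gm.
  by rewrite (splitr e) EFinD lteD.
Qed.

End algebra_approximation.

(** * Conditional probabilities *)

Section sub_sigma_algebras.
Context d (T : measurableType d) (R : realType) (P : probability T R).
Implicit Types (F G : set (set T)) (f g h : T -> R).

Lemma measurable_le_set d' (U : measurableType d') (f g : U -> R) :
  measurable_fun setT f -> measurable_fun setT g ->
  measurable [set x | (f x <= g x)%R].
Proof.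
move=> mf mg; have := measurable_fun_ler mf mg measurableT (_ : measurable [set true]).
by rewrite setTI; apply.
Qed.

Lemma sigma_sub G : G `<=` measurable -> <<s G >> `<=` measurable.
Proof. by apply: smallest_sub; exact: sigma_algebra_measurable. Qed.

Lemma measurable_fun_sub d' (U : measurableType d') G (f : T -> U) :
  G `<=` measurable ->
  measurable_fun [set: g_sigma_algebraType G] f -> measurable_fun setT f.
Proof.
by move=> Gm mf _ A mA; rewrite setTI; apply: (sigma_sub Gm);
  have := mf measurableT _ mA; rewrite setTI.
Qed.

Lemma measurable_fun_mono d' (U : measurableType d') F G (f : T -> U) :
  <<s F >> `<=` <<s G >> ->
  measurable_fun [set: g_sigma_algebraType F] f ->
  measurable_fun [set: g_sigma_algebraType G] f.
Proof.
by move=> FG mf _ A mA; rewrite setTI; apply: FG;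
  have := mf measurableT _ mA; rewrite setTI.
Qed.

Lemma bounded_integrable (D : set T) f (M : R) : measurable D ->
  measurable_fun setT f -> (forall x, `|f x| <= M)%R ->
  P.-integrable D (EFin \o f).
Proof.
move=> mD mf fM.
apply: (le_integrable mD _ _ (@finite_measure_integrable_cst _ _ _ P D M mD)).
- by apply/measurable_EFinP; exact: measurable_funTS.
- move=> x _ /=; rewrite lee_fin (le_trans (fM x))// ler_norm//.
Qed.

Definition unit_valued f := forall x, (0 <= f x <= 1)%R.

Lemma unit_valued_norm f : unit_valued f -> forall x, (`|f x| <= 1)%R.
Proof. by move=> f01 x; have /andP[f0 f1] := f01 x; rewrite ger0_norm. Qed.

Lemma integral_abs_split f (mf : measurable_fun setT f) (B : set T) :
  measurable B ->
  \int[P]_w (`|f w|)%:E = \int[P]_(w in B) (`|f w|)%:E + \int[P]_(w in ~` B) (`|f w|)%:E.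
Proof.
move=> mB; rewrite -ge0_integral_setU//.
- by rewrite setUv.
- exact: measurableC.
- by rewrite setUv; apply/measurable_EFinP; exact: measurableT_comp.
- by rewrite disj_set2E setICr.
Qed.

(** Tested on [[set w | g w <= f w]], which is in [<<s G >>]: there
    the nonnegative function [f - g] has integral [0]. *)
Lemma ae_le_of_integral G f g : G `<=` measurable ->
  measurable_fun [set: g_sigma_algebraType G] f ->
  measurable_fun [set: g_sigma_algebraType G] g ->
  unit_valued f -> unit_valued g ->
  (forall B, <<s G >> B -> \int[P]_(w in B) (f w)%:E = \int[P]_(w in B) (g w)%:E) ->
  {ae P, forall w, (f w <= g w)%R}.
Proof.
move=> Gm mf mg f01 g01 fg.
have mfT := measurable_fun_sub Gm mf; have mgT := measurable_fun_sub Gm mg.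
pose B := [set w | (g w <= f w)%R].
have GB : <<s G >> B by exact: (measurable_le_set mg mf).
have mB : measurable B by exact: sigma_sub GB.
have intf := bounded_integrable mB mfT (unit_valued_norm f01).
have intg := bounded_integrable mB mgT (unit_valued_norm g01).
have : \int[P]_(w in B) `|(f w - g w)%:E| = 0.
  under eq_integral => w wB.
    rewrite gee0_abs; last by rewrite lee_fin subr_ge0; move: wB; rewrite inE.
    rewrite EFinB; over.
  rewrite integralB_EFin// fg// subee//.
  exact: integrable_fin_num.
have mfg : measurable_fun B (fun w => (f w - g w)%:E).
  by apply/measurable_EFinP/measurable_funTS; exact: measurable_funB.
move/(ae_eq_integral_abs P mB mfg).
apply: filterS => w /= Bw.
have [//|gf] := leP (f w) (g w).
have /eqP := Bw (ltW gf); rewrite eqe subr_eq0 => /eqP fgw.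
by move: gf; rewrite fgw ltxx.
Qed.

Lemma cond_prob_ae_eq G A f g : G `<=` measurable ->
  unit_valued f -> unit_valued g ->
  is_cond_prob P G A (EFin \o f) -> is_cond_prob P G A (EFin \o g) ->
  {ae P, forall w, f w = g w}.
Proof.
move=> Gm f01 g01 [/measurable_EFinP mf fA] [/measurable_EFinP mg gA].
have fg B : <<s G >> B ->
    \int[P]_(w in B) (f w)%:E = \int[P]_(w in B) (g w)%:E.
  by move=> GB; rewrite (fA _ GB) (gA _ GB).
have := ae_le_of_integral Gm mg mf g01 f01 (fun B GB => esym (fg B GB)).
have := ae_le_of_integral Gm mf mg f01 g01 fg.
by apply: filterS2 => w fgw gfw; apply/eqP; rewrite eq_le fgw gfw.
Qed.

(** Conditioning on the smaller [F] is a contraction of [L1] that fixes the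
    [F]-measurable [g]. This is read off the two [F]-measurable sets on which
    [f' - g] has constant sign. *)
Lemma cond_prob_contraction F G A f f' g : F `<=` measurable ->
  G `<=` measurable -> <<s F >> `<=` <<s G >> ->
  unit_valued f -> unit_valued f' -> unit_valued g ->
  is_cond_prob P G A (EFin \o f) -> is_cond_prob P F A (EFin \o f') ->
  measurable_fun [set: g_sigma_algebraType F] g ->
  \int[P]_w (`|f' w - g w|)%:E <= \int[P]_w (`|f w - g w|)%:E.
Proof.
move=> Fm Gm FG f01 f'01 g01 [/measurable_EFinP mf fA] [/measurable_EFinP mf' f'A] mg.
have mfT := measurable_fun_sub Gm mf; have mgT := measurable_fun_sub Fm mg.
have mf'T := measurable_fun_sub Fm mf'.
pose B := [set w | (g w <= f' w)%R].
have FB : <<s F >> B by exact: (measurable_le_set mg mf').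
have FCB : <<s F >> (~` B).
  exact: (@measurableC _ (g_sigma_algebraType F) _ FB).
have mB : measurable B by exact: sigma_sub FB.
have mCB : measurable (~` B) by exact: measurableC.
rewrite !(integral_abs_split _ mB); [|exact: measurable_funB..].
have norm1 := unit_valued_norm.
have intB (h : T -> R) D (mD : measurable D) : measurable_fun setT h ->
    unit_valued h -> P.-integrable D (EFin \o h).
  by move=> mh h01; exact: (bounded_integrable mD mh (norm1 _ h01)).
have eqB D : <<s F >> D -> \int[P]_(w in D) (f' w)%:E = \int[P]_(w in D) (f w)%:E.
  by move=> FD; rewrite (f'A _ FD) (fA _ (FG _ FD)).
have bnd D (u : T -> R) : measurable D -> measurable_fun setT u ->
    (forall w, `|u w| <= 2)%R ->
    \int[P]_(w in D) (u w)%:E <= \int[P]_(w in D) (`|u w|)%:E.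
  move=> mD mu u2; apply: le_integral => //.
  - exact: (bounded_integrable mD mu u2).
  - apply: (@bounded_integrable D (fun w => `|u w|%R) 2 mD).
      exact: measurableT_comp.
    by move=> w; rewrite normr_id.
  - by move=> w _; rewrite lee_fin ler_norm.
have le2 (u v : T -> R) : unit_valued u -> unit_valued v ->
    forall w, (`|u w - v w| <= 2)%R.
  move=> u01 v01 w; have := ler_normB (u w) (v w).
  have := norm1 _ u01 w; have := norm1 _ v01 w; lra.
apply: leeD.
- under eq_integral => w wB.
    rewrite ger0_norm; last by rewrite subr_ge0; move: wB; rewrite inE.
    rewrite EFinB; over.
  rewrite integralB_EFin; [|exact: mB|exact: intB..].
  rewrite (eqB _ FB) -integralB_EFin; [|exact: mB|exact: intB..].
  by apply: bnd => //; [exact: measurable_funB|exact: le2].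
- under eq_integral => w wB.
    rewrite distrC ger0_norm; last first.
      by move: wB; rewrite inE subr_ge0 /B /= => /negP; rewrite -ltNge => /ltW.
    rewrite EFinB; over.
  rewrite integralB_EFin; [|exact: mCB|exact: intB..].
  rewrite (eqB _ FCB) -integralB_EFin; [|exact: mCB|exact: intB..].
  under [leRHS]eq_integral do rewrite distrC.
  by apply: bnd => //; [exact: measurable_funB|exact: le2].
Qed.

End sub_sigma_algebras.

(** * Convergence along increasing sigma-algebras *)

Section increasing_sigma_algebras.
Context d (T : measurableType d) (R : realType) (P : probability T R).
Variables (F : nat -> set (set T)) (G : set (set T)).
Hypotheses (Fm : forall n, F n `<=` measurable) (Gm : G `<=` measurable).
Hypothesis (FF : forall n n', (n <= n')%N -> <<s F n >> `<=` <<s F n' >>).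
Hypothesis (GF : <<s G >> `<=` <<s \bigcup_n <<s F n >> >>).

Lemma bigcup_sigma_approx B : <<s G >> B -> forall e : R, (0 < e)%R ->
  exists n, exists2 C, <<s F n >> C & P (symdiff B C) < e%:E.
Proof.
move=> GB e e0; pose H := \bigcup_n <<s F n >>.
have [] := @algebra_approx _ T R P H (fin_num_measure P) _ _ _ _ B (GF GB) e e0.
- by move=> C [n _]; exact: sigma_sub.
- exists 0%N => //; exact: (@measurableT _ (g_sigma_algebraType (F 0%N))).
- move=> C [n _ FC]; exists n => //.
  exact: (@measurableC _ (g_sigma_algebraType (F n))).
- move=> C D [n _ FC] [k _ FD]; exists (maxn n k) => //.
  apply: (@measurableU _ (g_sigma_algebraType (F (maxn n k)))).
    exact: (FF (leq_maxl n k)).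
  exact: (FF (leq_maxr n k)).
by move=> C [n _ FC] PC; exists n, C.
Qed.

(** Binary expansion: with [U = {f >= 1/2}] one has [f = (\1_U + f') / 2], where
    [f'] takes values in the unit interval again. Approximating the digit
    [\1_U] by a set and [f'] by induction halves the error and adds a
    fresh one, which is chosen to turn the factor [1/2] into [3/4]. *)
Lemma unit_valued_approx (k : nat) (f : T -> R) :
  measurable_fun [set: g_sigma_algebraType G] f -> unit_valued f ->
  exists n, exists2 g : T -> R, measurable_fun [set: g_sigma_algebraType (F n)] g /\
    unit_valued g & \int[P]_w (`|f w - g w|)%:E <= ((3 / 4) ^+ k)%:E.
Proof.
elim: k f => [|k IHk] f mf f01.
  exists 0%N, (fun=> 0%R).
    by split; [exact: measurable_cst|move=> x; rewrite lexx ler01].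
  apply: (@le_trans _ _ (\int[P]_w (cst 1 w))); last first.
    by rewrite integral_cst//= mul1e expr0 probability_setT.
  apply: ge0_le_integral => //.
  - apply/measurable_EFinP; apply: measurableT_comp => //.
    by apply: measurable_funB => //; exact: (measurable_fun_sub Gm mf).
  - by move=> w _; rewrite subr0 lee_fin unit_valued_norm.
have mfT := measurable_fun_sub Gm mf.
pose U := [set w | (2^-1 <= f w)%R].
have GU : <<s G >> U by exact: (measurable_le_set (measurable_cst _) mf).
have mU : measurable U by exact: sigma_sub GU.
pose f' w : R := (2 * f w - \1_U w)%R.
have mf' : measurable_fun [set: g_sigma_algebraType G] f'.
  apply: measurable_funB; first exact: measurable_funM.
  exact: (@measurable_indic _ (g_sigma_algebraType G) _ _ _ GU).
have f'01 : unit_valued f'.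
  move=> w; have /andP[? ?] := f01 w; rewrite /f' indicE.
  have [Uw|Uw] := leP 2^-1%R (f w); [rewrite mem_set//|rewrite memNset].
  - by rewrite /=; apply/andP; split; lra.
  - by rewrite /=; apply/andP; split; lra.
  - by rewrite /U /= => Uw'; move: Uw; rewrite ltNge Uw'.
have [n [g [mg g01] fg]] := IHk f' mf' f'01.
pose e : R := (2^-1 * (3 / 4) ^+ k)%R.
have e0 : (0 < e)%R by rewrite mulr_gt0// exprn_gt0.
have [l [C FC UC]] := bigcup_sigma_approx GU e0.
have mC : measurable C by exact: sigma_sub FC.
exists (maxn n l), (fun w => 2^-1 * \1_C w + 2^-1 * g w)%R.
  split.
    apply: measurable_funD; apply: measurable_funM => //.
      apply: (@measurable_indic _ (g_sigma_algebraType _)).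
      exact: (FF (leq_maxr n l)).
    exact: measurable_fun_mono (FF (leq_maxl n l)) mg.
  move=> w; have /andP[? ?] := g01 w; rewrite indicE.
  by case: (w \in C); apply/andP; split => /=; lra.
have mgT : measurable_fun setT g by exact: (measurable_fun_sub (@Fm n) mg).
have mf'T : measurable_fun setT f' by exact: (measurable_fun_sub Gm mf').
apply: (@le_trans _ _ (\int[P]_w (2^-1%:E * (`|f' w - g w|)%:E
    + 2^-1%:E * (\1_(symdiff U C) w)%:E))).
  apply: ge0_le_integral => //.
  - apply/measurable_EFinP; apply: measurableT_comp => //.
    by apply: measurable_funB => //; apply: measurable_funD; apply: measurable_funM => //.
  - apply/measurable_EFinP; apply: measurable_funD; apply: measurable_funM => //.
      by apply: measurableT_comp => //; exact: measurable_funB.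
    by apply: measurable_indic; exact: measurable_symdiff.
  - move=> w _; rewrite -!EFinM -EFinD lee_fin /f' !indicE /symdiff.
    rewrite in_setU !in_setD.
    have -> : (f w - (2^-1 * (w \in C)%:R + 2^-1 * g w) =
      2^-1 * ((2 * f w - (w \in U)%:R - g w) + ((w \in U)%:R - (w \in C)%:R)))%R.
      by lra.
    rewrite normrM (ger0_norm (_ : 0 <= 2^-1))%R// -mulrDr ler_wpM2l//.
    apply: le_trans (ler_normD _ _) _; rewrite lerD2l.
    by case: (w \in U); case: (w \in C); rewrite /= ?subrr ?subr0 ?sub0r ?normrN ?normr0 ?normr1.
rewrite ge0_integralD//; last 2 first.
- apply: measurable_funeM; apply/measurable_EFinP.
  by apply: measurableT_comp => //; exact: measurable_funB.
- apply: measurable_funeM; apply/measurable_EFinP.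
  by apply: measurable_indic; exact: measurable_symdiff.
rewrite !ge0_integralZl//; last 2 first.
- apply/measurable_EFinP.
  by apply: measurable_indic; exact: measurable_symdiff.
- by apply/measurable_EFinP; apply: measurableT_comp => //; exact: measurable_funB.
rewrite integral_indic//; last exact: measurable_symdiff.
rewrite setIT.
apply: (@le_trans _ _ (2^-1%:E * ((3 / 4) ^+ k)%:E + 2^-1%:E * e%:E)).
  by apply: leeD; apply: lee_wpmul2l => //; exact: ltW.
rewrite -!EFinM -EFinD lee_fin /e exprS.
have : (0 <= (3 / 4) ^+ k :> R)%R by rewrite exprn_ge0.
lra.
Qed.

Variables (A : set T) (f : T -> R) (f_ : nat -> T -> R).
Hypotheses (f01 : unit_valued f) (f_01 : forall n, unit_valued (f_ n)).
Hypothesis FG : forall n, <<s F n >> `<=` <<s G >>.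
Hypothesis (cf : is_cond_prob P G A (EFin \o f)).
Hypothesis (cf_ : forall n, is_cond_prob P (F n) A (EFin \o f_ n)).

(** Levy's upward theorem in [L1]: an [F n]-measurable [g] close to [f] is also
    close to each later [f_ n], by [cond_prob_contraction]. *)
Lemma cond_prob_L1_cvg (k : nat) :
  exists N, forall n, (N <= n)%N ->
    \int[P]_w (`|f w - f_ n w|)%:E <= (2 * (3 / 4) ^+ k)%:E.
Proof.
have [/measurable_EFinP mf _] := cf.
have [N [g [mg g01] fg]] := unit_valued_approx k mf f01.
exists N => n Nn.
have {}mg := measurable_fun_mono (FF Nn) mg.
have := cond_prob_contraction (@Fm n) Gm (@FG n) f01 (@f_01 n) g01 cf (cf_ n) mg.
have mfT := measurable_fun_sub Gm mf.
have mgT := measurable_fun_sub (@Fm n) mg.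
have [/measurable_EFinP mfn _] := cf_ n.
have mfnT := measurable_fun_sub (@Fm n) mfn.
move=> fng.
apply: (@le_trans _ _ (\int[P]_w ((`|f w - g w|)%:E + (`|f_ n w - g w|)%:E))).
  apply: ge0_le_integral => //.
  - by apply/measurable_EFinP; apply: measurableT_comp => //; exact: measurable_funB.
  - by apply/measurable_EFinP; apply: measurable_funD; apply: measurableT_comp => //;
      exact: measurable_funB.
  - move=> w _; rewrite -EFinD lee_fin.
    by apply: le_trans (ler_distD (g w) _ _) _; rewrite [X in (_ + X)%R]distrC.
rewrite ge0_integralD//; last 2 first.
- by apply/measurable_EFinP; apply: measurableT_comp => //; exact: measurable_funB.
- by apply/measurable_EFinP; apply: measurableT_comp => //; exact: measurable_funB.
by rewrite mulr2n mulrDl mul1r EFinD; apply: leeD => //; exact: le_trans fng fg.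
Qed.

End increasing_sigma_algebras.

Section L1_limits.
Context d (T : measurableType d) (R : realType) (P : probability T R).

(** The explicit bound on the distance is the one given by [cond_prob_L1_cvg];
    as it tends to [0], this is convergence in [L1]. *)
Definition L1_cvg (f_ : nat -> T -> R) (f : T -> R) := forall k : nat,
  exists N, forall n, (N <= n)%N ->
    \int[P]_w (`|f w - f_ n w|)%:E <= (2 * (3 / 4) ^+ k)%:E.

(** An almost sure bound passes to [L1] limits: the excess of the distance over
    [c] has integral [0]. This avoids extracting subsequences that converge
    almost surely. *)
Lemma L1_cvg_dist_le (f g c : T -> R) (f_ g_ : nat -> T -> R) (t : nat) :
  measurable_fun setT f -> measurable_fun setT g -> measurable_fun setT c ->
  (forall n, measurable_fun setT (f_ n)) -> (forall n, measurable_fun setT (g_ n)) ->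
  L1_cvg f_ f -> L1_cvg g_ g ->
  (forall n, (t <= n)%N -> {ae P, forall w, (`|f_ n w - g_ n w| <= c w)%R}) ->
  {ae P, forall w, (`|f w - g w| <= c w)%R}.
Proof.
move=> mf mg mc mf_ mg_ ff gg fgc.
have mB (u v : T -> R) : measurable_fun setT u -> measurable_fun setT v ->
    measurable_fun setT (fun w => `|u w - v w| : R)%R.
  by move=> mu mv; apply: measurableT_comp => //; exact: measurable_funB.
pose h w : R := Num.max (`|f w - g w| - c w)%R 0%R.
have mh : measurable_fun setT h.
  by apply: measurable_maxr => //; apply: measurable_funB => //; exact: mB.
have h0 w : (0 <= h w)%R by rewrite /h le_max lexx orbT.
(* [4 * (3 / 4) ^+ k] is twice the bound of [L1_cvg], once for [f], once for [g]. *)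
have hk k : \int[P]_w (h w)%:E <= (4 * (3 / 4) ^+ k)%:E.
  have [N1 fN1] := ff k; have [N2 gN2] := gg k.
  pose n := maxn t (maxn N1 N2).
  have tn : (t <= n)%N by rewrite leq_maxl.
  have N1n : (N1 <= n)%N by rewrite !leq_max leqnn orbT.
  have N2n : (N2 <= n)%N by rewrite !leq_max leqnn !orbT.
  apply: (@le_trans _ _ (\int[P]_w ((`|f w - f_ n w|)%:E + (`|g w - g_ n w|)%:E))).
    apply: ae_ge0_le_integral => //.
    - by move=> w _; rewrite lee_fin.
    - exact/measurable_EFinP.
    - by move=> w _; rewrite -EFinD lee_fin addr_ge0.
    - by apply: emeasurable_funD; apply/measurable_EFinP; exact: mB.
    - apply: filterS (fgc _ tn) => w fgcw _; rewrite -EFinD lee_fin /h ge_max.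
      rewrite addr_ge0// andbT lerBlDr.
      have := ler_distD (f_ n w) (f w) (g w).
      have := ler_distD (g_ n w) (f_ n w) (g w).
      rewrite (distrC (g_ n w)); lra.
  rewrite ge0_integralD//; last 2 first.
  - by apply/measurable_EFinP; exact: mB.
  - by apply/measurable_EFinP; exact: mB.
  rewrite (_ : 4 * _ = 2 * (3 / 4) ^+ k + 2 * (3 / 4) ^+ k)%R; last lra.
  by rewrite EFinD; apply: leeD; [exact: fN1|exact: gN2].
have ih0 : \int[P]_w (h w)%:E = 0.
  apply/eqP; rewrite eq_le integral_ge0 ?andbT; last by move=> w _; rewrite lee_fin.
  apply/lee_addgt0Pr => e e0; rewrite add0e.
  have : (4 * (3 / 4) ^+ k : R)%R @[k --> \oo] --> (4 * 0 : R)%R.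
    apply: cvgMr; apply: cvg_expr.
    by rewrite ger0_norm//; lra.
  rewrite mulr0 => /cvgrPdist_lt/(_ _ e0)[k _ /(_ k (leqnn _))] /=.
  rewrite sub0r normrN ger0_norm; last by rewrite mulr_ge0// exprn_ge0.
  by move=> ke; apply: le_trans (hk k) _; rewrite lee_fin ltW.
have : \int[P]_w `|(h w)%:E| = 0.
  by rewrite -ih0; apply: eq_integral => w _; rewrite gee0_abs// lee_fin.
move/(ae_eq_integral_abs P measurableT (_ : measurable_fun setT (EFin \o h))).
move=> /(_ (proj2 (measurable_EFinP _ _) mh)).
apply: filterS => w /(_ I) /= [hw].
by rewrite -subr_le0 -hw /h le_max lexx.
Qed.

End L1_limits.

(** * Total variation from a generating algebra *)

Section total_variation_bound.
Context d (T : measurableType d) (R : realType).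

Lemma tv_dist_ge0 (P1 P2 : probability T R) : 0 <= tv_dist P1 P2.
Proof. by rewrite /tv_dist /tv_norm; exact: measure_ge0. Qed.

Lemma charge_variationT (nu : {charge set T -> \bar R}) (Q N : set T)
    (h : hahn_decomposition nu Q N) :
  charge_variation h setT = nu Q - nu N.
Proof.
rewrite /charge_variation jordan_posE jordan_negE cjordan_posE cjordan_negE.
by rewrite /crestr0 !mem_set// /crestr !setTI.
Qed.

(** A bound on an algebra extends to the sigma-algebra by [algebra_approx] for
    [P1 + P2]; the total variation is the difference of the values at the
    two sets of a Hahn decomposition, hence the factor [2]. *)
Lemma tv_dist_le (P1 P2 : probability T R) (G : set (set T)) (c : R) :
  @measurable _ T = <<s G >> -> G setT -> setC_closed G -> setU_closed G ->
  (forall A, G A -> `|fine (P1 A) - fine (P2 A)| <= c)%R ->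
  tv_dist P1 P2 <= (2 * c)%:E.
Proof.
move=> mG GT GC GU Gc.
have Gm : G `<=` measurable by rewrite mG; exact: sub_sigma_algebra.
have mc A : measurable A -> (`|fine (P1 A) - fine (P2 A)| <= c)%R.
  move=> mA; apply/ler_addgt0Pr => e e0.
  have e20 : (0 < e / 2)%R by rewrite divr_gt0.
  pose m : {measure set T -> \bar R} := measure_add P1 P2.
  have mE C : m C = P1 C + P2 C.
    by rewrite /m /= /measure_add/= /msum !big_ord_recl big_ord0 /= adde0.
  have [B GB mAB] : exists2 B, G B & m (symdiff A B) < (e / 2)%:E.
    have mfin : fin_num_fun m.
      by move=> C mC; rewrite mE fin_numD !fin_num_measure.
    by apply: (algebra_approx mfin Gm) => //; rewrite -mG.
  have mB := Gm _ GB.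
  have Pe (P' : probability T R) : P' (symdiff A B) <= m (symdiff A B) ->
      (`|fine (P' A) - fine (P' B)| <= e / 2)%R.
    move=> P'm.
    have P's : (fine (P' (symdiff A B)) < e / 2)%R.
      rewrite -lte_fin fineK ?fin_num_measure//; last exact: measurable_symdiff.
      exact: le_lt_trans P'm mAB.
    have le1 (C D : set T) : measurable C -> measurable D ->
        symdiff C D = symdiff A B -> (fine (P' C) <= fine (P' D) + fine (P' (symdiff A B)))%R.
      move=> mC mD <-; have mCD := measurable_symdiff mC mD.
      have : P' C <= P' D + P' (symdiff C D).
        apply: (@le_trans _ _ (P' (D `|` symdiff C D))); last exact: measureU2.
        apply: le_measure; rewrite ?inE//; first exact: measurableU.
        by move=> x; rewrite /symdiff /=; case: (pselect (D x)); tauto.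
      rewrite -[P' C]fineK ?fin_num_measure// -[P' D]fineK ?fin_num_measure//.
      by rewrite -[P' (symdiff _ _)]fineK ?fin_num_measure// -EFinD lee_fin.
    have := le1 A B mA mB erefl.
    have := le1 B A mB mA (setUC _ _).
    by rewrite ler_norml => ? ?; apply/andP; split; lra.
  have ? : (`|fine (P1 A) - fine (P1 B)| <= e / 2)%R.
    by apply: Pe; rewrite mE leeDl.
  have ? : (`|fine (P2 A) - fine (P2 B)| <= e / 2)%R.
    by apply: Pe; rewrite mE leeDr.
  have := Gc _ GB.
  have := ler_distD (fine (P1 B)) (fine (P1 A)) (fine (P2 A)).
  have := ler_distD (fine (P2 B)) (fine (P1 B)) (fine (P2 A)).
  rewrite (distrC (fine (P2 B))); lra.
rewrite /tv_dist /tv_norm.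
case: cid => /= Q hQ; case: cid => /= N hN.
have [[mQ _] [mN _] _ _] := hN.
rewrite charge_variationT.
have PE C : measurable C -> cadd (charge_of_finite_measure P1)
    (copp (charge_of_finite_measure P2)) C = (fine (P1 C) - fine (P2 C))%:E.
  move=> mC; rewrite /cadd /copp /= /charge_of_finite_measure EFinB.
  by rewrite !fineK ?fin_num_measure.
apply: (@le_trans _ _ ((fine (P1 Q) - fine (P2 Q))%:E -
    (fine (P1 N) - fine (P2 N))%:E)); first by rewrite -!PE//; exact: lexx.
rewrite -EFinB lee_fin.
have := mc _ mQ; have := mc _ mN.
rewrite !ler_norml => /andP[? ?] /andP[? ?]; lra.
Qed.

End total_variation_bound.

(** * Mixtures of measures and the path space *)

Section mixture_measures.
Context d d' (T : measurableType d) (S : measurableType d') (R : realType).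
Variables (P : {measure set T -> \bar R}) (B : set T) (k : T -> {measure set S -> \bar R}).

(** The proofs [mB] and [mk] are arguments so that the structure of measure can be
    inferred from the function. *)
Definition mixture (mB : measurable B)
    (mk : forall C, measurable C -> measurable_fun setT (k ^~ C)) :
  set S -> \bar R := fun C => \int[P]_(t in B) k t C.

Hypothesis mB : measurable B.
Hypothesis mk : forall C, measurable C -> measurable_fun setT (k ^~ C).

Let mixture0 : mixture mB mk set0 = 0.
Proof. by rewrite /mixture integral0_eq// => t _; rewrite measure0. Qed.

Let mixture_ge0 C : 0 <= mixture mB mk C.
Proof. by apply: integral_ge0 => t _; exact: measure_ge0. Qed.

Let mixture_sigma_additive : semi_sigma_additive (mixture mB mk).
Proof.
move=> F mF tF mUF; rewrite [X in _ --> X](_ : _ =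
    \int[P]_(t in B) (\sum_(n <oo) k t (F n))); last first.
  by apply: eq_integral => t _; rewrite measure_bigcup//; apply: eq_eseriesl => n; rewrite in_setT.
rewrite integral_nneseries//; last first.
  by move=> n; apply: measurable_funTS; exact: mk.
by apply: is_cvg_ereal_nneg_natsum_cond => n _ _; exact: mixture_ge0.
Qed.

HB.instance Definition _ := isMeasure.Build _ _ _ (mixture mB mk)
  mixture0 mixture_ge0 mixture_sigma_additive.

End mixture_measures.

Section image_measures.
Context d d' (T : measurableType d) (S : measurableType d') (R : realType).
Variables (P : {measure set T -> \bar R}) (B : set T) (V : T -> S).
Hypotheses (mB : measurable B) (mV : measurable_fun setT V).

Lemma measurable_preim C : measurable C -> measurable (V @^-1` C).
Proof. by move=> mC; rewrite -(setTI (_ @^-1` _)); exact: mV. Qed.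

Lemma measurable_dirac_comp C : measurable C ->
  measurable_fun setT (fun t => (dirac (V t) : {measure set S -> \bar R}) C).
Proof.
move=> mC; rewrite (_ : (fun t => _) = EFin \o \1_(V @^-1` C)).
  by apply/measurable_EFinP; apply: measurable_indic; exact: measurable_preim.
by apply/funext => t; rewrite /= diracE indicE.
Qed.

Definition image_measure : {measure set S -> \bar R} :=
  mixture P (k := fun t => dirac (V t)) mB measurable_dirac_comp.

Lemma image_measureE C : measurable C -> image_measure C = P (B `&` V @^-1` C).
Proof.
move=> mC; rewrite /image_measure /= /mixture.
rewrite (eq_integral (fun t => (\1_(V @^-1` C) t)%:E)); last first.
  by move=> t _; rewrite /= diracE indicE.
by rewrite integral_indic 1?setIC//; exact: measurable_preim.
Qed.

Lemma integral_image_measure (h : S -> \bar R) :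
  (forall x, 0 <= h x) -> measurable_fun setT h ->
  \int[image_measure]_x h x = \int[P]_(t in B) h (V t).
Proof.
move=> h0 mh; rewrite (@integral_mixture _ _ _ _ _ P B mB _ measurable_dirac_comp image_measure
  (fun C _ => erefl))//.
by apply: eq_integral => t _; rewrite integral_dirac// diracT mul1e.
Qed.

End image_measures.

Section sequences.
Context {S : Type}.

Definition shift (n : nat) (w : nat -> S) : nat -> S := fun k => w (n + k)%N.

Definition scons (x : S) (w : nat -> S) : nat -> S :=
  fun k => if k is k'.+1 then w k' else x.

Lemma shift0 w : shift 0 w = w. Proof. by []. Qed.

Lemma shift_shift m n w : shift m (shift n w) = shift (n + m) w.
Proof. by apply/funext => k; rewrite /shift addnA. Qed.

End sequences.

Section path_space.
Context d (S : measurableType d) .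

Lemma measurable_coord (k : nat) :
  measurable_fun setT (fun w : seqspace S => w k).
Proof.
move=> _ A mA; rewrite setTI; apply: sub_sigma_algebra.
by exists k => //; exists A => //; rewrite setTI.
Qed.

Lemma measurable_fun_seqspace d' (T : measurableType d') (f : T -> seqspace S) :
  (forall k, measurable_fun setT (fun t => f t k)) -> measurable_fun setT f.
Proof.
move=> mf; apply: measurability; first reflexivity.
move=> _ [_ [k _ [A mA <-]] <-]; by have := mf k measurableT A mA; rewrite !setTI.
Qed.

Lemma measurable_shift n :
  measurable_fun setT (shift n : seqspace S -> seqspace S).
Proof. by apply: measurable_fun_seqspace => k; exact: measurable_coord. Qed.

Lemma measurable_scons x :
  measurable_fun setT (scons x : seqspace S -> seqspace S).
Proof.
by apply: measurable_fun_seqspace => -[|k];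
  [exact: measurable_cst|exact: measurable_coord].
Qed.

Definition box (n : nat) (A : nat -> set S) : set (seqspace S) :=
  [set w | forall k, (k < n)%N -> A k (w k)].

Definition boxes : set (set (seqspace S)) :=
  [set D | exists n A, (forall k, measurable (A k)) /\ D = box n A].

Lemma measurable_box n A : (forall k, measurable (A k)) -> measurable (box n A).
Proof.
move=> mA; rewrite (_ : box n A = \bigcap_(k in `I_n) ((fun w => w k) @^-1` A k)).
  apply: bigcap_measurableType => k _.
  exact: (measurable_preim (measurable_coord k)).
by apply/seteqP; split => w /= Aw k; exact: Aw.
Qed.

Lemma boxes_setI : setI_closed boxes.
Proof.
move=> _ _ [n [A [mA ->]]] [n' [A' [mA' ->]]].
exists (maxn n n'), (fun k => (if (k < n)%N then A k else setT) `&`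
  (if (k < n')%N then A' k else setT)); split.
  by move=> k; apply: measurableI; case: ifP.
apply/seteqP; split => w /=.
  by move=> [Aw A'w] k _; split; case: ifP => // kn; [exact: Aw|exact: A'w].
move=> AA'w; split => k kn.
  by have [] := AA'w k; rewrite ?leq_max ?kn.
by have [] := AA'w k; rewrite ?leq_max ?kn ?orbT.
Qed.

Lemma boxesT : boxes setT.
Proof.
by exists 0%N, (fun=> setT); split => //; apply/seteqP; split.
Qed.

Lemma measurable_boxes : @measurable _ (seqspace S) = <<s boxes >>.
Proof.
apply/seteqP; split; last first.
  by apply: sigma_sub => _ [n [A [mA ->]]]; exact: measurable_box.
apply: smallest_sub; first exact: smallest_sigma_algebra.
move=> _ [k _ [A mA <-]]; apply: sub_sigma_algebra.
exists k.+1, (fun j => if j == k then A else setT); split.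
  by move=> j; case: ifP.
rewrite setTI; apply/seteqP; split => w /=.
  by move=> Aw j _; case: eqP => [->|].
by move=> /(_ k (ltnSn k)); rewrite eqxx.
Qed.

(** Boxes are a pi-system generating the cylindrical sigma-algebra. *)
Lemma eq_measure_boxes (R : realType) (m1 m2 : {measure set (seqspace S) -> \bar R}) :
  m1 setT < +oo ->
  (forall n A, (forall k, measurable (A k)) -> m1 (box n A) = m2 (box n A)) ->
  forall D, measurable D -> m1 D = m2 D.
Proof.
move=> m1T m12; apply: (measure_unique boxes (fun=> setT)).
- exact: measurable_boxes.
- exact: boxes_setI.
- by move=> _; exact: boxesT.
- by rewrite bigcup_const.
- by move=> _ [n [A [mA ->]]]; exact: m12.
- by [].
Qed.

End path_space.

(** * The Markov property *)

Section markov_property.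
Context d (S : measurableType d) (R : realType).
Variable k : S -> {measure set S -> \bar R}.
Hypothesis mk : forall C, measurable C -> measurable_fun setT (k ^~ C).
Hypothesis k1 : forall z, k z setT = 1.

Definition past dO (Omega : measurableType dO) (V : nat -> Omega -> S) (n : nat) :=
  process_gen V [set j | (j <= n)%N].

Definition markov dO (Omega : measurableType dO) (P : probability Omega R)
    (V : nat -> Omega -> S) :=
  (forall n, measurable_fun setT (V n)) /\
  forall n (C : set S), measurable C ->
    is_cond_prob P (past V n) (V n.+1 @^-1` C) (fun w => k (V n w) C).

(** The probability of a box for the chain with kernel [k], by iterated
    integration. *)
Fixpoint box_prob (n : nat) (A : nat -> set S) (z : S) : \bar R :=
  if n is n'.+1 then
    (\1_(A 0%N) z)%:E * \int[k z]_y box_prob n' (fun j => A j.+1) y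
  else 1.

Lemma box_prob_ge0 n A z : 0 <= box_prob n A z.
Proof.
elim: n A z => [|n IHn] A z //=.
by rewrite mule_ge0// ?lee_fin ?indicE//; apply: integral_ge0.
Qed.

Lemma measurable_box_prob n A : (forall j, measurable (A j)) ->
  measurable_fun setT (box_prob n A).
Proof.
elim: n A => [|n IHn] A mA /=; first exact: measurable_cst.
apply: emeasurable_funM.
  by apply/measurable_EFinP; exact: measurable_indic.
apply: (measurable_fun_integral_kernel mk).
  by move=> z; exact: box_prob_ge0.
exact: IHn.
Qed.

Section chains.
Context dO (Omega : measurableType dO) (P : probability Omega R).
Variable V : nat -> Omega -> S.

Lemma process_gen_measurable (I : set nat) :
  (forall n, measurable_fun setT (V n)) -> process_gen V I `<=` measurable.
Proof. by move=> mV _ [n _ [A mA <-]]; exact: mV. Qed.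

Lemma process_gen_sub (I J : set nat) : I `<=` J ->
  <<s process_gen V I >> `<=` <<s process_gen V J >>.
Proof.
move=> IJ; apply: smallest_sub; first exact: smallest_sigma_algebra.
by move=> A [n In VA]; apply: sub_sigma_algebra; exists n => //; exact: IJ.
Qed.

Lemma process_gen_mem (I : set nat) (n : nat) (A : set S) : I n -> measurable A ->
  <<s process_gen V I >> (V n @^-1` A).
Proof.
move=> In mA; apply: sub_sigma_algebra; exists n => //.
by exists A => //; rewrite setTI.
Qed.

Lemma past_mono n n' : (n <= n')%N -> <<s past V n >> `<=` <<s past V n' >>.
Proof. by move=> nn'; apply: process_gen_sub => j /= /leq_trans; exact. Qed.

Hypothesis VP : markov P V.
Let mV := VP.1.

Lemma past_measurable n B : <<s past V n >> B -> measurable B.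
Proof. by apply: sigma_sub; exact: process_gen_measurable. Qed.

Lemma markov_step n B (h : S -> \bar R) : <<s past V n >> B ->
  (forall x, 0 <= h x) -> measurable_fun setT h ->
  \int[P]_(w in B) h (V n.+1 w) = \int[P]_(w in B) \int[k (V n w)]_y h y.
Proof.
move=> FB h0 mh; have mB := past_measurable FB.
rewrite -(integral_image_measure P mB (@mV n.+1))//.
apply: (@integral_mixture _ _ _ _ _ P B mB (fun w => k (V n w))) => //.
  by move=> C mC; apply: (measurableT_comp (mk mC)); exact: mV.
move=> C mC; rewrite image_measureE// setIC.
by have [_ ->] := VP.2 n C mC.
Qed.

Definition traj (n : nat) (w : Omega) : nat -> S := fun j => V (n + j) w.

Lemma measurable_traj n : measurable_fun setT (traj n : Omega -> seqspace S).
Proof. by apply: measurable_fun_seqspace => j; exact: mV. Qed.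

Lemma markov_box n A i B : (forall j, measurable (A j)) -> <<s past V i >> B ->
  P (B `&` traj i @^-1` box n A) = \int[P]_(w in B) box_prob n A (V i w).
Proof.
elim: n A i B => [|n IHn] A i B mA FB.
  rewrite (_ : _ @^-1` _ = setT) ?setIT; last by apply/seteqP; split.
  by rewrite /= integral_cst ?mul1e//; exact: past_measurable FB.
pose B' := B `&` V i @^-1` (A 0%N).
have FB' : <<s past V i >> B'.
  apply: (@measurableI _ (g_sigma_algebraType (past V i))) => //.
  exact: (@process_gen_mem [set j | (j <= i)%N] i (A 0%N) (leqnn i) (mA 0%N)).
have -> : B `&` traj i @^-1` box n.+1 A =
    B' `&` traj i.+1 @^-1` box n (fun j => A j.+1).
  apply/seteqP; split => w /=.
    move=> [Bw Aw]; split.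
      by split => //; have := Aw 0%N; rewrite /traj addn0; apply.
    by move=> j jn; have := Aw j.+1; rewrite /traj addnS -addSn; apply.
  move=> [[Bw Aw0] Aw]; split => // -[_|j jn]; first by rewrite /traj addn0.
  by have := Aw j jn; rewrite /traj addnS -addSn.
rewrite IHn//; last by apply: past_mono FB'; exact: leqnSn.
rewrite (markov_step FB' (box_prob_ge0 _ _)); last exact: measurable_box_prob.
rewrite integral_mkcondr; apply: eq_integral => w _ /=.
rewrite patchE indicE.
have -> : (w \in V i @^-1` A 0%N) = (V i w \in A 0%N).
  by apply/idP/idP; rewrite !inE.
by case: (V i w \in A 0%N); rewrite ?mul1e ?mul0e.
Qed.

End chains.

Variable Q : S -> probability (seqspace S) R.
Hypothesis QP : forall z, markov (Q z) (fun n (w : seqspace S) => w n).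
Hypothesis Q0 : forall z A, measurable A ->
  Q z [set w : seqspace S | A (w 0%N)] = \d_z A.

(** In particular the laws [Q z], which are given by the Markov property and the
    initial state only, are determined by the kernel; measurability in [z]
    comes from this. *)
Lemma path_law_box z n A : (forall j, measurable (A j)) ->
  Q z (box n A) = box_prob n A z.
Proof.
move=> mA.
have := @markov_box _ _ _ _ (QP z) n A 0%N setT mA
  (@measurableT _ (g_sigma_algebraType _)).
rewrite setTI => boxE; transitivity (\int[Q z]_w box_prob n A (w 0%N)) => //.
rewrite -(integral_image_measure (Q z) measurableT (measurable_coord 0%N)
  (box_prob_ge0 n A) (measurable_box_prob n mA)).
rewrite (eq_measure_integral (dirac z : {measure set S -> \bar R})); last first.
  by move=> C mC _; rewrite image_measureE//= setTI; exact: Q0.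
rewrite integral_dirac ?diracT ?mul1e//.
exact: measurable_box_prob.
Qed.

Lemma measurable_path_law D : measurable D -> measurable_fun setT (fun z => Q z D).
Proof.
rewrite measurable_boxes.
apply: (@dynkin_induction _ (seqspace S) (@boxes _ S)
  (fun D => measurable_fun setT (fun z => Q z D))).
- exact: measurable_boxes.
- exact: boxes_setI.
- by under eq_fun do rewrite probability_setT; exact: measurable_cst.
- move=> _ [n [A [mA ->]]].
  by under eq_fun do rewrite path_law_box//; exact: measurable_box_prob.
- move=> C mC IHC; under eq_fun do rewrite probability_setC//.
  by apply: emeasurable_funB => //; exact: measurable_cst.
- move=> F mF tF IHF.
  rewrite (_ : (fun z => _) = (fun z => \sum_(n <oo) Q z (F n))).
    by apply: ge0_emeasurable_sum => //= n z _ _; exact: measure_ge0.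
  apply/funext => z; rewrite measure_bigcup//.
  by apply: eq_eseriesl => n; rewrite in_setT.
Qed.

Lemma markov_path dO (Omega : measurableType dO) (P : probability Omega R)
    (V : nat -> Omega -> S) (VP : markov P V) (i : nat) (B : set Omega)
    (D : set (seqspace S)) :
  <<s past V i >> B -> measurable D ->
  P (B `&` traj V i @^-1` D) = \int[P]_(w in B) Q (V i w) D.
Proof.
move=> FB mD; have mB := past_measurable VP FB.
rewrite -(image_measureE P mB (measurable_traj VP i) mD).
have mQV C : measurable C -> measurable_fun setT (fun w => Q (V i w) C).
  by move=> mC; apply: (measurableT_comp (measurable_path_law mC)); exact: VP.1.
apply: (@eq_measure_boxes _ S R _ (mixture P (k := fun w => Q (V i w)) mB mQV)) => //.
  rewrite image_measureE// preimage_setT setIT.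
  by rewrite -ge0_fin_numE// fin_num_measure.
move=> n A mA; rewrite image_measureE//; last exact: measurable_box.
apply: etrans (markov_box VP n mA FB) _; rewrite /mixture /=.
by apply: eq_integral => w _; apply/esym; exact: path_law_box.
Qed.

Lemma path_law_shift z (i : nat) (B D : set (seqspace S)) :
  <<s past (fun n (w : seqspace S) => w n) i >> B ->
  measurable D ->
  Q z (B `&` (shift i : seqspace S -> seqspace S) @^-1` D) = \int[Q z]_(w in B) Q (w i) D.
Proof. exact: (markov_path (QP z)). Qed.

(** Both sides are laws of the chain started at [z], so it suffices to compare
    them on boxes. *)
Lemma path_law_first_step z (D : set (seqspace S)) : measurable D ->
  Q z D = \int[k z]_y Q y ((scons z : seqspace S -> seqspace S) @^-1` D).
Proof.
move=> mD; have mz := measurable_scons z.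
have mQz C : measurable C -> measurable_fun setT
    (fun y => (image_measure (Q y) measurableT mz) C).
  move=> mC; under eq_fun do rewrite image_measureE// setTI.
  by apply: measurable_path_law; exact: measurable_preim.
transitivity (mixture (k z) measurableT mQz D); last first.
  by apply: eq_integral => y _; rewrite image_measureE// setTI.
apply: eq_measure_boxes => //; first by rewrite -ge0_fin_numE// fin_num_measure.
move=> n A mA; apply: etrans (path_law_box z n mA) _; rewrite /mixture /=.
transitivity (\int[k z]_y Q y ((scons z : seqspace S -> seqspace S) @^-1` box n A));
  last first.
  by apply: eq_integral => y _; rewrite image_measureE ?setTI//; exact: measurable_box.
case: n => [|n] /=.
  transitivity (\int[k z]_y (cst 1 y)); first by rewrite integral_cst// k1 mul1e.
  apply: eq_integral => y _; apply/esym.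
  rewrite (_ : _ @^-1` _ = setT); first exact: probability_setT.
  by apply/seteqP; split.
rewrite indicE; have [zA|zA] := pselect (A 0%N z).
  rewrite mem_set// mul1e; apply: eq_integral => y _.
  rewrite -path_law_box//; congr (Q y _); apply/seteqP; split => w /= Aw.
    by move=> [_|j jn] //=; exact: Aw.
  by move=> j jn; exact: (Aw j.+1).
rewrite memNset// mul0e integral0_eq// => y _.
rewrite (_ : _ @^-1` _ = set0) ?measure0//.
by apply/seteqP; split => w //= Aw; apply: zA; exact: (Aw 0%N).
Qed.

End markov_property.

(** * The zero-one law for Harris chains *)

Lemma probability_setI_full d (T : measurableType d) (R : realType)
    (P : probability T R) (A V : set T) :
  measurable A -> measurable V -> P V = 1 -> P A = P (A `&` V).
Proof.
move=> mA mV PV; rewrite (measureDI P mA mV) [X in X + _](_ : _ = 0) ?add0e//.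
have mCV : measurable (~` V) by exact: measurableC.
have mAV : measurable (A `\` V) by exact: measurableD.
apply: (subset_measure0 mAV mCV); first by move=> x [].
by apply: etrans (probability_setC P mV) _; rewrite PV subee.
Qed.

Section recurrence.
Context d (S : measurableType d) (R : realType).
Variable k : S -> {measure set S -> \bar R}.
Hypothesis mk : forall C, measurable C -> measurable_fun setT (k ^~ C).
Variable Q : S -> probability (seqspace S) R.
Hypothesis QP : forall z, markov k (Q z) (fun n (w : seqspace S) => w n).
Hypothesis Q0 : forall z A, measurable A ->
  Q z [set w : seqspace S | A (w 0%N)] = \d_z A.
Implicit Types D F : set (seqspace S).

Let sh (n : nat) : seqspace S -> seqspace S := shift n.
Let coord (n : nat) (w : seqspace S) : S := w n.

Lemma measurable_shift_preim n D : measurable D -> measurable (sh n @^-1` D).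
Proof. exact: (measurable_preim (measurable_shift n)). Qed.

Definition visits (A : set S) : set (seqspace S) :=
  lim_sup_set (fun n => [set w | A (w n)]).

Lemma sub_shift D n : D `<=` sh 1 @^-1` D -> D `<=` sh n @^-1` D.
Proof.
move=> DD; elim: n => [|n IHn] w Dw; first by rewrite /= /sh shift0.
have := DD _ (IHn _ Dw); rewrite /= /sh shift_shift addn1.
exact.
Qed.

Lemma path_sigma_algebra :
  @measurable _ (seqspace S) `<=` <<s \bigcup_n <<s past coord n >> >>.
Proof.
apply: smallest_sub; first exact: smallest_sigma_algebra.
move=> _ [n _ [A mA <-]]; apply: sub_sigma_algebra; exists n => //.
by rewrite setTI; exact: (@process_gen_mem _ _ _ _ coord [set j | (j <= n)%N] n A (leqnn _) mA).
Qed.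

Lemma past_approx (m : probability (seqspace S) R) D (e : R) :
  measurable D -> (0 < e)%R ->
  exists2 B, (exists n, <<s past coord n >> B) & m (symdiff D B) < e%:E.
Proof.
move=> mD e0.
have [] := @algebra_approx _ _ _ m (\bigcup_n <<s past coord n >>)
  (fin_num_measure m) _ _ _ _ D (path_sigma_algebra mD) e e0.
- move=> C [n _]; apply: sigma_sub; apply: process_gen_measurable.
  by move=> j; exact: measurable_coord.
- by exists 0%N => //; exact: (@measurableT _ (g_sigma_algebraType (past coord 0))).
- move=> C [n _ FC]; exists n => //.
  exact: (@measurableC _ (g_sigma_algebraType (past coord n))).
- move=> C C' [n _ FC] [n' _ FC']; exists (maxn n n') => //.
  apply: (@measurableU _ (g_sigma_algebraType (past coord (maxn n n')))).
    exact: (past_mono (leq_maxl n n')).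
  exact: (past_mono (leq_maxr n n')).
by move=> B [n _ FB] mB; exists B => //; exists n.
Qed.

(** Decomposing according to the first visit to [A] after time [n]: at that time
    the future is still in [D], as [D] is stable under the shift, and this has
    conditional probability at most [a]. *)
Lemma first_visit_bound z (A : set S) D (a : R) : measurable A ->
  measurable D -> D `<=` sh 1 @^-1` D -> (0 <= a)%R ->
  (forall y, A y -> Q y D <= a%:E) -> Q z (visits A) = 1 ->
  forall n B, <<s past coord n >> B -> Q z (D `&` B) <= a%:E * Q z B.
Proof.
move=> mA mD DD a0 QA QzA n B FB.
have mB := past_measurable (QP z) FB.
(* The first visit to [A] from time [n] on takes place at time [n + j]. *)
pose T j : set (seqspace S) :=
  [set w | A (w (n + j)%N) /\ forall i, (i < j)%N -> ~ A (w (n + i)%N)].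
have FT j : <<s past coord (n + j) >> (T j).
  have -> : T j = coord (n + j) @^-1` A `&`
      \bigcap_(i in `I_j) (coord (n + i) @^-1` (~` A)).
    by apply/seteqP; split => w [].
  apply: (@measurableI _ (g_sigma_algebraType (past coord (n + j)))).
    exact: (@process_gen_mem _ _ _ _ coord [set i | (i <= n + j)%N] (n + j)
      A (leqnn _) mA).
  apply: (@bigcap_measurableType _ (g_sigma_algebraType (past coord (n + j)))).
  move=> i /= ij.
  apply: (@process_gen_mem _ _ _ _ coord [set i | (i <= n + j)%N] (n + i)).
    by rewrite /= leq_add2l ltnW.
  exact: measurableC.
have FBT j : <<s past coord (n + j) >> (B `&` T j).
  apply: (@measurableI _ (g_sigma_algebraType (past coord (n + j)))).
    by apply: past_mono FB; exact: leq_addr.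
  exact: FT.
have mBT i : measurable (B `&` T i) by exact: (past_measurable (QP z) (FBT i)).
have tT : trivIset setT T.
  apply/trivIsetP => i j _ _ ij; rewrite -subset0 => w [[Ai nAi] [Aj nAj]].
  have [lij|lji|/eqP] := ltngtP i j; last by rewrite (negbTE ij).
    exact: (nAj i).
  exact: (nAi j).
have tBT : trivIset setT (fun j => B `&` T j) by exact: trivIset_setIl.
have visT : visits A `<=` \bigcup_j T j.
  move=> w /(_ n I) [i /= ni Ai].
  have ex : exists j, `[< A (w (n + j)%N) >].
    by exists (i - n)%N; apply/asboolP; rewrite subnKC.
  case: (ex_minnP ex) => j /asboolP Aj minj; exists j => //; split => // l lj Al.
  by have := minj l (asboolT Al); rewrite leqNgt lj.
have mvis : measurable (visits A).
  apply: bigcap_measurableType => i _; apply: bigcup_measurable => j _.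
  exact: (measurable_preim (measurable_coord j)).
have mDB : measurable (D `&` B) by exact: measurableI.
have mDBT j : measurable (D `&` (B `&` T j)) by exact: measurableI.
apply: (@le_trans _ _ (Q z (\bigcup_j (D `&` (B `&` T j))))).
  rewrite (probability_setI_full mDB mvis QzA).
  apply: le_measure; rewrite ?inE.
  - exact: measurableI.
  - exact: bigcup_measurable.
  - by move=> w [[Dw Bw] /visT [j _ Tj]]; exists j.
rewrite measure_bigcup//; last exact: trivIset_setIl.
apply: (@le_trans _ _ (\sum_(0 <= j <oo | j \in [set: nat]) (a%:E * Q z (B `&` T j)))).
  apply: lee_nneseries; first by move=> j _ _; exact: measure_ge0.
  move=> j _.
  apply: (@le_trans _ _ (Q z ((B `&` T j) `&` sh (n + j) @^-1` D))).
    apply: le_measure; rewrite ?inE//.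
      by apply: measurableI => //; exact: measurable_shift_preim.
    by move=> w [Dw BTw]; split => //; exact: sub_shift.
  rewrite (path_law_shift mk QP Q0)//.
  apply: (@le_trans _ _ (\int[Q z]_(w in B `&` T j) a%:E)).
    apply: ge0_le_integral => //.
    - apply: measurable_funTS.
      apply: (measurableT_comp (measurable_path_law mk QP Q0 mD)).
      exact: measurable_coord.
    - by move=> w [_ [Aw _]]; exact: QA.
  by rewrite integral_cst.
rewrite nneseriesZl//.
rewrite -measure_bigcup//.
apply: lee_wpmul2l; first by rewrite lee_fin.
apply: le_measure; rewrite ?inE//; first exact: bigcup_measurable.
by move=> w [j _ [Bw _]].
Qed.

Lemma path_law_fin z D : measurable D -> Q z D = (fine (Q z D))%:E.
Proof. by move=> mD; rewrite fineK// fin_num_measure. Qed.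

(** Taking for [B] in [first_visit_bound] an approximation of [D] itself gives
    [Q z D <= a * Q z D]. *)
Lemma visited_null z (A : set S) D (a : R) : measurable A ->
  measurable D -> D `<=` sh 1 @^-1` D -> (0 <= a)%R -> (a < 1)%R ->
  (forall y, A y -> Q y D <= a%:E) -> Q z (visits A) = 1 -> Q z D = 0.
Proof.
move=> mA mD DD a0 a1 QA QzA.
suff : (fine (Q z D) <= 0)%R.
  rewrite path_law_fin// => p0; congr EFin; apply/eqP; rewrite eq_le p0/=.
  exact: fine_ge0.
rewrite -(@pmulr_rle0 _ (1 - a)%R) ?subr_gt0//.
apply/ler_addgt0Pr => e e0; rewrite add0r.
have e20 : (0 < e / 2)%R by rewrite divr_gt0.
have [B [n FB] DB] := past_approx (Q z) mD e20.
have mB := past_measurable (QP z) FB.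
have := first_visit_bound mA mD DD a0 QA QzA FB.
have mDB : measurable (D `&` B) by exact: measurableI.
have mDnB : measurable (D `\` B) by exact: measurableD.
have mBnD : measurable (B `\` D) by exact: measurableD.
have h1 : Q z D = Q z (D `\` B) + Q z (D `&` B) by exact: measureDI.
have h2 : Q z B = Q z (B `\` D) + Q z (D `&` B) by rewrite setIC; exact: measureDI.
have h3 : Q z (symdiff D B) = Q z (D `\` B) + Q z (B `\` D).
  rewrite /symdiff measureU//; apply/seteqP; split => // w [[? ?] [? ?]]; done.
move: h1 h2 h3 DB; rewrite (path_law_fin z mD) (path_law_fin z mB).
rewrite (path_law_fin z mDB) (path_law_fin z mDnB) (path_law_fin z mBnD).
rewrite -!EFinD -EFinM => -[->] [->] ->; rewrite lte_fin lee_fin.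
have u0 : (0 <= fine (Q z (D `\` B)))%R by exact: fine_ge0.
have v0 : (0 <= fine (Q z (B `\` D)))%R by exact: fine_ge0.
move: u0 v0; move: (fine (Q z (D `\` B))) (fine (Q z (B `\` D))) => u v u0 v0.
move: (fine (Q z (D `&` B))) => x uv xv.
have av : (a * v <= v)%R by rewrite ler_piMl// ltW.
have au : (0 <= a * u)%R by rewrite mulr_ge0.
move: xv; rewrite /= mulrBl mul1r !mulrDr => xv; lra.
Qed.

Section harris.
Variable psi : {measure set S -> \bar R}.
Hypothesis psiT : 0 < psi setT.
Hypothesis HR : forall A, measurable A -> 0 < psi A ->
  forall z, Q z (visits A) = 1.

Lemma harris_null D (a : R) : measurable D -> D `<=` sh 1 @^-1` D ->
  (0 <= a)%R -> (a < 1)%R -> 0 < psi [set y | Q y D <= a%:E] ->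
  forall z, Q z D = 0.
Proof.
move=> mD DD a0 a1 psiD z.
have mA : measurable [set y | Q y D <= a%:E].
  rewrite -(setTI [set _ | _]); apply: emeasurable_fun_infty_c => //.
  exact: (measurable_path_law mk QP Q0).
by apply: (visited_null mA mD DD a0 a1) => //; exact: HR.
Qed.

(** Either [D] or its complement has probability at most [1/2] from a set of
    starting points of positive [psi] measure, and [harris_null] applies to
    that event. *)
Lemma harris_zero_one D : measurable D -> D = sh 1 @^-1` D ->
  (forall z, Q z D = 0) \/ (forall z, Q z D = 1).
Proof.
move=> mD DD; have mCD : measurable (~` D) by exact: measurableC.
have QC y : Q y (~` D) = 1 - Q y D by exact: probability_setC.
have h01 : (0 <= 2^-1 :> R)%R by lra.
have h1 : (2^-1 < 1 :> R)%R by lra.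
have mA (D' : set (seqspace S)) : measurable D' ->
    measurable [set y | Q y D' <= (2^-1)%:E].
  move=> mD'; rewrite -(setTI [set _ | _]); apply: emeasurable_fun_infty_c => //.
  exact: (measurable_path_law mk QP Q0).
have [psi0|/negP psi0] := pselect (0 < psi [set y | Q y D <= (2^-1)%:E]).
  by left; apply: (harris_null mD _ h01 h1 psi0); rewrite [X in _ `<=` X](esym DD).
right => z; suff : Q z (~` D) = 0.
  rewrite QC (path_law_fin z mD) -EFinB => -[] /eqP; rewrite subr_eq0 => /eqP <-//.
apply: (harris_null mCD _ h01 h1); first by move=> w nDw Dw; apply: nDw; rewrite DD.
rewrite lt_neqAle measure_ge0 andbT eq_sym; apply/negP => /eqP psi0'.
move: psiT; apply/negP; rewrite -leNgt.
apply: (@le_trans _ _ (psi ([set y | Q y D <= (2^-1)%:E] `|`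
                            [set y | Q y (~` D) <= (2^-1)%:E]))).
  apply: le_measure; rewrite ?inE//; first by apply: measurableU; exact: mA.
  move=> y _ /=; rewrite QC (path_law_fin y mD) -EFinB !lee_fin.
  by have [|] := leP (fine (Q y D)) 2^-1%R; [left|right; lra].
apply: le_trans (measureU2 psi (mA _ mD) (mA _ mCD)) _.
by rewrite [X in _ + X](_ : _ = 0)// adde0 leNgt.
Qed.

Variable F : set (seqspace S).
Hypothesis mF : measurable F.
Variable c : R.
Hypothesis c0 : (0 < c)%R.
Hypothesis psiF : 0 < psi [set y | c%:E <= Q y F].

Definition never : set (seqspace S) := [set w | forall n, ~ F (shift n w)].

Lemma measurable_never : measurable never.
Proof.
rewrite (_ : never = \bigcap_n sh n @^-1` (~` F)).
  by apply: bigcapT_measurable => n; apply: measurable_shift_preim; exact: measurableC.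
by apply/seteqP; split => w h n; [move=> _|]; exact: (h n).
Qed.

(** From a non null set of states, [never F] has probability at most
    [1 - c], and it is stable under the shift. *)
Lemma never_null z : Q z never = 0.
Proof.
have mN := measurable_never.
pose a : R := (Num.max 0 (1 - c))%R.
apply: (@harris_null never a) => //.
- by move=> w /= wF n; rewrite /sh shift_shift; exact: wF.
- by rewrite /a le_max lexx.
- by rewrite /a gt_max ltr01 ltrBlDr ltrDl.
apply: (lt_le_trans psiF); apply: le_measure; rewrite ?inE.
- rewrite -(setTI [set _ | _]); apply: emeasurable_fun_c_infty => //.
  exact: (measurable_path_law mk QP Q0).
- rewrite -(setTI [set _ | _]); apply: emeasurable_fun_infty_c => //.
  exact: (measurable_path_law mk QP Q0).
move=> y /= cF; apply: (@le_trans _ _ (Q y (~` F))).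
  apply: le_measure; rewrite ?inE//; first exact: measurableC.
  by move=> w /(_ 0%N); rewrite shift0.
rewrite (probability_setC (Q y) mF); move: cF.
rewrite (path_law_fin y mF) -EFinB !lee_fin /a le_max => ?; apply/orP; right; lra.
Qed.

End harris.
End recurrence.

(** * Frequency of visits *)

Section counting_visits.
Context {S : Type}.
Implicit Types (F : set (nat -> S)) (w : nat -> S).
Local Open Scope nat_scope.

Definition visit_count F (n : nat) w : nat :=
  \sum_(0 <= j < n) (shift j w \in F : nat).

Lemma visit_countD F m n w :
  visit_count F (m + n) w = visit_count F m w + visit_count F n (shift m w).
Proof.
rewrite /visit_count (@big_cat_nat _ _ _ m)//= ?leq_addr//; congr (_ + _).
rewrite -{1}(add0n m) big_addn addKn; apply: eq_bigr => j _.
by rewrite shift_shift addnC.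
Qed.

Lemma visit_count1 F w : visit_count F 1 w = (w \in F).
Proof. by rewrite /visit_count big_nat1 shift0. Qed.

Lemma visit_countS F n w :
  visit_count F n.+1 w = (w \in F) + visit_count F n (shift 1 w).
Proof. by rewrite -addn1 addnC visit_countD visit_count1. Qed.

Lemma visit_count_le F n w : visit_count F n w <= n.
Proof.
rewrite /visit_count -[leqRHS]subn0 -[leqRHS]muln1 -sum_nat_const_nat.
by apply: leq_sum => j _; exact: leq_b1.
Qed.

Lemma sub_visit_count F F' n w : F' `<=` F -> visit_count F' n w <= visit_count F n w.
Proof.
move=> FF; apply: leq_sum => j _.
have [jF'|//] := boolP (shift j w \in F').
by rewrite mem_set//; apply: FF; exact: set_mem.
Qed.

(** The covering argument of Katznelson and Weiss. Read the trajectory from left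
    to right: at a time in [F'], skip a stretch of length at most [L] on
    which [F] has frequency at most [1/b]; at another time, which does not count
    for [F'], skip one step. Only the last stretch may stick out, which costs
    [b * L]. *)
Lemma visit_count_cover F F' (b L : nat) : F' `<=` F ->
  (forall w, F' w -> exists m, 0 < m <= L /\ b * visit_count F m w <= m) ->
  forall n w, b * visit_count F' n w <= n + b * L.
Proof.
move=> FF cover n; elim/ltn_ind: n => n IHn w.
have [nL|Ln] := leqP n L.
  by rewrite (leq_trans _ (leq_addl _ _))// leq_mul2l (leq_trans (visit_count_le _ _ _)) ?orbT.
have [wF'|wF'] := boolP (w \in F').
  have [m [/andP[m0 mL] bm]] := cover w (set_mem wF').
  have mn : m <= n by rewrite (leq_trans mL)// ltnW.
  have := IHn (n - m) _ (shift m w).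
  rewrite ltn_subrL m0 (leq_trans m0 mn) => /(_ isT) IH.
  rewrite -[in leqLHS](subnKC mn) visit_countD mulnDr.
  apply: (@leq_trans (m + ((n - m) + b * L))); last by rewrite addnA subnKC.
  apply: leq_add => //; apply: leq_trans bm.
  by rewrite leq_mul2l sub_visit_count ?orbT.
case: n Ln IHn => // n _ /(_ n (ltnSn n) (shift 1 w)) IH.
by rewrite visit_countS (negbTE wF') add0n (leq_trans IH)// leq_add2r.
Qed.

(** Trajectories along which [n - b * visit_count F n w] is unbounded above: a
    substitute for lower frequency less than [1/b] that is exactly invariant under
    the shift and needs no limits. *)
Definition sparse F (b : nat) : set (nat -> S) :=
  [set w | forall M, exists n, b * (visit_count F n w + M) <= n].

Lemma sparse_shift F b : 0 < b -> sparse F b = shift 1 @^-1` sparse F b.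
Proof.
move=> b0; apply/seteqP; split => w /= wF M.
  have [[|n]] := wF M.+1; first by rewrite leqn0 muln_eq0 addnS /= orbF eqn0Ngt b0.
  rewrite visit_countS addnS mulnS => bn; exists n.
  have bM : b * (visit_count F n (shift 1 w) + M) <=
      b * ((w \in F) + visit_count F n (shift 1 w) + M).
    by rewrite leq_mul2l -addnA leq_addl orbT.
  have := leq_add b0 bM; move=> /leq_trans/(_ bn).
  by rewrite add1n ltnS.
have [n bn] := wF M.+1; exists n.+1.
rewrite visit_countS (leq_trans _ (leqnSn n))// (leq_trans _ bn)//.
by rewrite leq_mul2l addnS -addnA -[leqRHS]add1n leq_add2r leq_b1 orbT.
Qed.

End counting_visits.

Section visit_frequency.
Context d (S : measurableType d) (R : realType).
Variable k : S -> {measure set S -> \bar R}.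
Hypothesis mk : forall C, measurable C -> measurable_fun setT (k ^~ C).
Hypothesis k1 : forall z, k z setT = 1.
Variable Q : S -> probability (seqspace S) R.
Hypothesis QP : forall z, markov k (Q z) (fun n (w : seqspace S) => w n).
Hypothesis Q0 : forall z A, measurable A ->
  Q z [set w : seqspace S | A (w 0%N)] = \d_z A.
Implicit Types D F : set (seqspace S).

Let sh (n : nat) : seqspace S -> seqspace S := shift n.

Lemma visit_countE F n (w : seqspace S) :
  (visit_count F n w)%:R = (\sum_(j < n) \1_(sh j @^-1` F) w)%R :> R.
Proof.
rewrite /visit_count big_mkord natr_sum; apply: eq_bigr => j _.
by rewrite indicE; congr ((nat_of_bool _)%:R).
Qed.

Lemma measurable_visit_count F n : measurable F ->
  measurable_fun setT (fun w : seqspace S => (visit_count F n w)%:R : R).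
Proof.
move=> mF; rewrite [X in measurable_fun _ X](_ : _ = fun w : seqspace S =>
    \sum_(j < n) \1_(sh j @^-1` F) w)%R; last by apply/funext => w; exact: visit_countE.
by apply: measurable_sum => j; apply: measurable_indic; exact: measurable_shift_preim.
Qed.

Lemma measurable_count_set F (b n M : nat) : measurable F ->
  measurable [set w : seqspace S | (b * (visit_count F n w + M) <= n)%N].
Proof.
move=> mF.
rewrite (_ : [set _ | _] = [set w | (b%:R * ((visit_count F n w)%:R + M%:R) <= n%:R :> R)%R]).
  apply: (@measurable_le_set R _ (seqspace S) (fun w => b%:R *
    ((visit_count F n w)%:R + M%:R))%R (cst n%:R)) => //.
  apply: measurable_funM => //; apply: measurable_funD => //.
  exact: measurable_visit_count.
by apply/seteqP; split => w /=; rewrite -natrD -natrM ler_nat.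
Qed.

Lemma measurable_sparse F b : measurable F -> measurable (sparse F b : set (seqspace S)).
Proof.
move=> mF; rewrite (_ : sparse F b = \bigcap_M \bigcup_n
    [set w | (b * (visit_count F n w + M) <= n)%N]).
  by apply: bigcapT_measurable => M; apply: bigcupT_measurable => n; exact: measurable_count_set.
apply/seteqP; split => w /=.
  by move=> h M _; have [n hn] := h M; exists n.
by move=> h M; have [n _ hn] := h M I; exists n.
Qed.

Variable pi : probability S R.
Hypothesis pi_inv : forall A, measurable A -> pi A = \int[pi]_z k z A.

Let Ppi : {measure set (seqspace S) -> \bar R} :=
  mixture pi measurableT (@measurable_path_law _ _ _ _ mk Q QP Q0).

Let PpiE D : Ppi D = \int[pi]_z Q z D. Proof. by []. Qed.

Let Ppi_le1 D : measurable D -> Ppi D <= 1.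
Proof.
move=> mD; rewrite PpiE; apply: (@le_trans _ _ (\int[pi]_z (cst 1 z))).
  apply: ge0_le_integral => //; first exact: (measurable_path_law mk QP Q0).
  by move=> z _; exact: probability_le1.
by rewrite integral_cst// mul1e; exact: probability_le1.
Qed.

Let Ppi_fin D : measurable D -> Ppi D \is a fin_num.
Proof.
move=> mD; rewrite ge0_fin_numE//.
by rewrite (le_lt_trans (Ppi_le1 mD))// ltry.
Qed.

Let Ppi_shift1 D : measurable D -> Ppi (sh 1 @^-1` D) = Ppi D.
Proof.
move=> mD; rewrite !PpiE.
rewrite [RHS](@integral_mixture _ _ _ _ _ pi setT measurableT k mk pi pi_inv)//; last first.
  exact: (measurable_path_law mk QP Q0).
apply: eq_integral => z _.
rewrite (path_law_first_step mk k1 QP Q0)//.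
exact: measurable_shift_preim.
Qed.

Let Ppi_shift D n : measurable D -> Ppi (sh n @^-1` D) = Ppi D.
Proof.
move=> mD; elim: n => [//|n IHn].
rewrite -[RHS]IHn -[RHS]Ppi_shift1; last exact: measurable_shift_preim.
congr (Ppi _); apply/seteqP; split => w /=; by rewrite /sh shift_shift.
Qed.

Let Ppi_count F n : measurable F ->
  \int[Ppi]_w ((visit_count F n w)%:R%:E) = n%:R%:E * Ppi F.
Proof.
move=> mF; under eq_integral do rewrite visit_countE -sumEFin.
rewrite ge0_integral_sum//; last first.
  move=> j; apply/measurable_EFinP; apply: measurable_indic.
  exact: measurable_shift_preim.
under eq_bigr => j _.
  rewrite integral_indic//; last exact: measurable_shift_preim.
  rewrite setIT Ppi_shift//; over.
by rewrite sumr_const card_ord mule_natl.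
Qed.

Variable F : set (seqspace S).
Hypothesis mF : measurable F.

(** If almost every stationary trajectory is sparse, then from almost every visit
    to [F] there starts a finite stretch on which the frequency of [F] is at most
    [1/b]. Up to a small part of [F] the length of the stretch is bounded,
    and [visit_count_cover] bounds the mean number of visits. *)
Lemma sparse_stationary_bound (b : nat) : (0 < b)%N ->
  Ppi (~` sparse F b) = 0 -> b%:R%:E * Ppi F <= 1.
Proof.
move=> b0 Psparse.
pose C L := [set w : seqspace S | exists m, (0 < m <= L)%N /\
  (b * visit_count F m w <= m)%N].
have mC L : measurable (C L).
  rewrite (_ : C L = \bigcup_(m in [set m | (0 < m <= L)%N])
      [set w | (b * (visit_count F m w + 0) <= m)%N]).
    by apply: bigcup_measurable => m _; exact: measurable_count_set.
  apply/seteqP; split => w.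
    by move=> [m [mL bm]]; exists m => //; rewrite /= addn0.
  by move=> [m mL]; rewrite /= addn0 => bm; exists m.
have mFC L : measurable (F `&` C L) by exact: measurableI.
have PC L : b%:R%:E * Ppi (F `&` C L) <= 1.
  rewrite -[Ppi (F `&` C L)]fineK ?Ppi_fin// -EFinM lee_fin.
  set p := fine _; have p0 : (0 <= p)%R by exact: fine_ge0.
  (* By stationarity the mean number of visits to [F `&` C L] up to time [n]
     is [n * p]. *)
  have bnd n : (n%:R * (b%:R * p) <= n%:R + (b * L)%:R :> R)%R.
    have -> : (n%:R * (b%:R * p) = b%:R * (n%:R * p) :> R)%R by rewrite mulrCA.
    rewrite -lee_fin EFinM EFinM /p fineK ?Ppi_fin// -Ppi_count//.
    rewrite -ge0_integralZl//; last first.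
      by apply/measurable_EFinP; exact: measurable_visit_count.
    apply: (@le_trans _ _ (\int[Ppi]_w (cst (n%:R + (b * L)%:R)%:E w))).
      apply: ge0_le_integral => //.
      - by apply: measurable_funeM; apply/measurable_EFinP; exact: measurable_visit_count.
      - move=> w _; rewrite /= -EFinM lee_fin -natrM -natrD ler_nat.
        by apply: (@visit_count_cover _ F) => [w' []|w' [_ h]].
    rewrite integral_cst//.
    rewrite -[leRHS]mule1; apply: lee_wpmul2l; first by rewrite lee_fin.
    exact: Ppi_le1.
  rewrite leNgt; apply/negP => bp.
  have e0 : (0 < b%:R * p - 1)%R by rewrite subr_gt0.
  have [n] : exists n : nat, ((b * L)%:R / (b%:R * p - 1) < n%:R)%R.
    by exists (Num.truncn ((b * L)%:R / (b%:R * p - 1))).+1; exact: Num.Theory.truncnS_gt.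
  rewrite ltr_pdivrMr// mulrBr mulr1; have := bnd n; lra.
have ndC : nondecreasing_seq (fun L => F `&` C L).
  move=> i j ij; apply/subsetPset => w [Fw [m [/andP[m0 mi] bm]]]; split => //.
  by exists m; rewrite m0 (leq_trans mi).
have mU : measurable (\bigcup_L (F `&` C L)) by exact: bigcupT_measurable.
have cvC := nondecreasing_cvg_mu mFC mU ndC : (Ppi \o (fun L => F `&` C L)) @ \oo --> _.
have FU : Ppi F <= Ppi (\bigcup_L (F `&` C L)).
  have mnS : measurable (~` sparse F b : set (seqspace S)).
    by apply: measurableC; exact: measurable_sparse.
  rewrite -[leRHS]adde0 -[X in _ + X]Psparse.
  apply: le_trans (measureU2 Ppi mU mnS).
  apply: le_measure; rewrite ?inE//; first exact: measurableU.
  move=> w Fw; have [sw|nsw] := pselect (sparse F b w); last by right.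
  left; have [n bn] := sw 1%N; exists n => //; split => //; exists n; split.
    rewrite leqnn andbT; move: bn; rewrite addn1 mulnS.
    by move/(leq_trans (leq_addr _ _)); exact: leq_trans.
  by apply: leq_trans bn; rewrite leq_mul2l leq_addr orbT.
apply: (@le_trans _ _ (b%:R%:E * Ppi (\bigcup_L (F `&` C L)))).
  by apply: lee_wpmul2l => //; rewrite lee_fin.
have cvb : (b%:R%:E * Ppi (F `&` C L))%E @[L --> \oo] -->
    b%:R%:E * Ppi (\bigcup_L (F `&` C L)).
  by apply: cvgeZl => //.
rewrite -(cvg_lim _ cvb)//; apply: lime_le; first by apply/cvg_ex; eexists; exact: cvb.
by apply: nearW => L; exact: PC.
Qed.

Section harris.
Variable psi : {measure set S -> \bar R}.
Hypothesis psiT : 0 < psi setT.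
Hypothesis HR : forall A, measurable A -> 0 < psi A ->
  forall z, Q z (visits A) = 1.
Variable c : R.
Hypothesis c0 : (0 < c)%R.
Hypothesis psiF : 0 < psi [set y | c%:E <= Q y F].

(** The stationary chain visits [F] with positive probability, since otherwise
    it would almost surely never do so, against [never_null]; with [1/b]
    below that probability, [sparse_stationary_bound] fails, so that [sparse F b] is not almost
    sure, and by the zero-one law it is null from every starting point. *)
Lemma sparse_null : exists2 b : nat, (0 < b)%N & forall z, Q z (sparse F b) = 0.
Proof.
have PF : 0 < Ppi F.
  rewrite lt_neqAle measure_ge0 andbT eq_sym; apply/negP => /eqP PF0.
  have : Ppi setT = 0.
    have mU : measurable (\bigcup_n (sh n @^-1` F)).
      by apply: bigcupT_measurable => n; exact: measurable_shift_preim.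
    have mN := measurable_never mF.
    apply/eqP; rewrite -measure_le0.
    apply: (@le_trans _ _ (Ppi (never F `|` \bigcup_n (sh n @^-1` F)))).
      apply: le_measure; rewrite ?inE//; first exact: measurableU.
      move=> w _; have [nw|nnw] := pselect (never F w); first by left.
      right; apply: contrapT => h; apply: nnw => n Fn; apply: h; by exists n.
    have Pn0 : Ppi (never F) = 0.
      rewrite PpiE integral0_eq// => z _.
      exact: (never_null mk QP Q0 HR mF c0 psiF).
    have PU0 : Ppi (\bigcup_n (sh n @^-1` F)) = 0.
      apply/eqP; rewrite -measure_le0.
      apply: le_trans (measure_sigma_subadditive _ _ mU (@subset_refl _ _)) _.
        by move=> n; exact: measurable_shift_preim.
      by rewrite eseries0// => n _ _; exact: etrans (Ppi_shift n mF) PF0.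
    apply: le_trans (measureU2 Ppi mN mU) _.
    by rewrite [X in X + _](_ : _ = 0)// add0e [leLHS](_ : _ = 0).
  have -> : Ppi setT = 1.
    rewrite PpiE; transitivity (\int[pi]_z (cst 1 z)).
      by apply: eq_integral => z _; exact: probability_setT.
    by rewrite integral_cst// mul1e; exact: probability_setT.
  by move=> /eqP; rewrite onee_eq0.
have PF' : (0 < fine (Ppi F))%R by rewrite fine_gt0// PF/= (le_lt_trans (Ppi_le1 mF)) ?ltry.
pose b := (Num.truncn (fine (Ppi F))^-1).+1.
have bP : ((fine (Ppi F))^-1 < b%:R)%R by exact: Num.Theory.truncnS_gt.
exists b => //.
have mS : measurable (sparse F b : set (seqspace S)) by exact: measurable_sparse.
have [//|Q1] := harris_zero_one mk QP Q0 psiT HR mS (@sparse_shift S F b (ltn0Sn _)).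
have := @sparse_stationary_bound b (ltn0Sn _).
rewrite PpiE integral0_eq => [/(_ erefl)|z _]; last first.
  by apply: etrans (probability_setC (Q z) mS) _; rewrite Q1 subee.
rewrite -[Ppi F]fineK ?Ppi_fin// -EFinM lee_fin => bF.
by move: bP; rewrite -[X in (X < _)%R]mul1r ltr_pdivrMr// ltNge bF.
Qed.

End harris.
End visit_frequency.

(** * Loss of memory of products of nonnegative matrices *)

Section oscillation.
Context {R : realType} {Y : finType}.
Local Open Scope ring_scope.

(** The left-hand side is the sum of [a j * a' j' * D] over pairs, where [D] is the
    bracket in the hypothesis on [bA], antisymmetric in [(j, j')]. Subtracting
    [e] times the flipped weights [a j' * a' j] leaves nonnegative weights and
    multiplies the sum by [1 + e], while the bound is multiplied by
    [1 - e]. For [e = 0] the hypothesis on the ratios holds trivially. *)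
Lemma oscillation_mix (a a' bA b1 : Y -> R) (c e : R) :
  (forall j, 0 <= a j) -> (forall j, 0 <= a' j) -> (forall j, 0 <= b1 j) ->
  0 <= c -> 0 <= e <= 1 ->
  (forall j j', bA j * b1 j' - bA j' * b1 j <= c * (b1 j * b1 j')) ->
  (forall j j', e * (a j' * a' j) <= a j * a' j') ->
  (\sum_j a j * bA j) * (\sum_j a' j * b1 j) -
  (\sum_j a' j * bA j) * (\sum_j a j * b1 j) <=
  (1 - e) * c * ((\sum_j a j * b1 j) * (\sum_j a' j * b1 j)).
Proof.
move=> a0 a'0 b0 c0 /andP[e0 e1] osc ratio.
pose D (p : Y * Y) := bA p.1 * b1 p.2 - bA p.2 * b1 p.1.
pose w (p : Y * Y) := a p.1 * a' p.2.
pose flip (p : Y * Y) := (p.2, p.1).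
have flipK : involutive flip by case.
pose T := \sum_p w p * D p.
pose M := \sum_p w p * (b1 p.1 * b1 p.2).
have sumM (f g : Y -> R) : (\sum_j f j) * (\sum_j g j) = \sum_p f p.1 * g p.2.
  by rewrite big_distrlr pair_big.
have -> : (\sum_j a j * bA j) * (\sum_j a' j * b1 j) -
    (\sum_j a' j * bA j) * (\sum_j a j * b1 j) = T.
  rewrite [X in _ - X]mulrC !sumM -sumrB; apply: eq_bigr => p _.
  by rewrite /w /D; ring.
have -> : (\sum_j a j * b1 j) * (\sum_j a' j * b1 j) = M.
  by rewrite sumM; apply: eq_bigr => p _; rewrite /w; ring.
have flipT : \sum_p w (flip p) * D p = - T.
  rewrite /T -sumrN (reindex_inj (inv_inj flipK)); apply: eq_bigr => p _.
  by rewrite flipK /D /=; ring.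
have flipM : \sum_p w (flip p) * (b1 p.1 * b1 p.2) = M.
  rewrite /M (reindex_inj (inv_inj flipK)); apply: eq_bigr => p _.
  by rewrite flipK /=; ring.
have : \sum_p (w p - e * w (flip p)) * D p <=
    \sum_p (w p - e * w (flip p)) * (c * (b1 p.1 * b1 p.2)).
  apply: ler_sum => p _; apply: ler_wpM2l; last exact: osc.
  by rewrite subr_ge0; exact: ratio.
have -> : \sum_p (w p - e * w (flip p)) * D p = (1 + e) * T.
  transitivity (\sum_p (w p * D p - e * (w (flip p) * D p))).
    by apply: eq_bigr => p _; ring.
  by rewrite sumrB -mulr_sumr flipT -/T; ring.
have -> : \sum_p (w p - e * w (flip p)) * (c * (b1 p.1 * b1 p.2)) = (1 - e) * c * M.
  transitivity (\sum_p c * (w p * (b1 p.1 * b1 p.2) -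
      e * (w (flip p) * (b1 p.1 * b1 p.2)))).
    by apply: eq_bigr => p _; ring.
  by rewrite -mulr_sumr sumrB -mulr_sumr flipM -/M; ring.
have M0 : 0 <= M.
  by apply: sumr_ge0 => p _; rewrite !mulr_ge0.
have N0 : 0 <= (1 - e) * c * M by rewrite !mulr_ge0// subr_ge0.
move: N0; move: (_ * M) => N N0 TN.
have [T0|T0] := lerP T 0; first exact: le_trans T0 N0.
by apply: le_trans TN; rewrite mulrDl mul1r lerDl mulr_ge0// ltW.
Qed.

End oscillation.

Section transition_products.
Context {d : measure_display} {X : measurableType d} {m : nat} {R : realType}.
Local Notation Y := 'I_m.+1.
Local Open Scope ring_scope.
Variable q : X * Y -> X * Y -> R.
Hypothesis q0 : forall z' z, 0 <= q z' z.

(** [p_] by recursion on the observations that follow the first one. *)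
Fixpoint tprod (xs : seq X) (x : X) (i j : Y) : R :=
  if xs is x' :: xs' then \sum_l q (x', l) (x, i) * tprod xs' x' l j
  else (i == j)%:R.

Lemma tprod_ge0 xs x i j : 0 <= tprod xs x i j.
Proof.
elim: xs x i => [|x' xs IHxs] x i /=; first by rewrite ler0n.
by apply: sumr_ge0 => l _; rewrite mulr_ge0.
Qed.

Lemma tprod_cat xs ys x i j : tprod (xs ++ ys) x i j =
  \sum_l tprod xs x i l * tprod ys (last x xs) l j.
Proof.
elim: xs x i => [|x' xs IHxs] x i /=.
  rewrite (bigD1 i)//= eqxx mul1r big1 ?addr0// => l li.
  by rewrite eq_sym (negbTE li) mul0r.
under eq_bigr do rewrite IHxs mulr_sumr.
rewrite exchange_big/=; apply: eq_bigr => l _.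
by rewrite mulr_suml; apply: eq_bigr => l' _; rewrite mulrA.
Qed.

Lemma big_tuple_cons n (F : n.+1.-tuple Y -> R) :
  \sum_(y : n.+1.-tuple Y) F y = \sum_i \sum_(y : n.-tuple Y) F [tuple of i :: y].
Proof.
rewrite pair_big/=.
rewrite (reindex (fun p : Y * n.-tuple Y => [tuple of p.1 :: p.2])) //=.
exists (fun y : n.+1.-tuple Y => (thead y, [tuple of behead y])) => [[i y] _|y _].
  by congr pair; apply: val_inj.
by rewrite /= -tuple_eta.
Qed.

Lemma p_tprod n x (xs : n.-tuple X) i j :
  p_ q [tuple of x :: xs] i j = tprod xs x i j.
Proof.
rewrite /p_ big_mkcond big_tuple_cons (bigD1 i)//= [X in _ + X]big1 ?addr0; last first.
  by move=> l li; apply: big1 => y _ /=; rewrite (negbTE li).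
elim: n x xs i => [|n IHn] x xs i.
  rewrite (tuple0 xs) /= (big_pred1 [tuple]); last by move=> y; apply/esym/eqP; exact: tuple0.
  rewrite /= eqxx /= big_geq//.
  by rewrite [in RHS]/=; case: eqP.
rewrite big_tuple_cons; case/tupleP: xs => x' xs /=; apply: eq_bigr => l _.
rewrite -IHn mulr_sumr; apply: eq_bigr => y _ /=.
rewrite !eqxx /=; case: ifPn => [_|_]; last by rewrite mulr0.
rewrite big_ltn//= big_add1/=; congr (_ * _).
by rewrite !big_nat; apply: eq_bigr => -[|k].
Qed.

End transition_products.

Lemma bernoulli_ge (R : realType) (a : R) (n : nat) :
  (0 <= a <= 1)%R -> (1 - n%:R * a <= (1 - a) ^+ n)%R.
Proof.
move=> /andP[a0 a1]; elim: n => [|n IHn]; first by rewrite mul0r subr0 expr0.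
rewrite exprS; apply: (@le_trans _ _ ((1 - a) * (1 - n%:R * a))%R); last first.
  by rewrite ler_wpM2l// subr_ge0.
have : (0 <= n%:R * a * a)%R by rewrite !mulr_ge0.
rewrite -natr1; lra.
Qed.

Section path_oscillation.
Context {d : measure_display} {X : measurableType d} {m : nat} {R : realType}.
Local Notation Y := 'I_m.+1.
Local Open Scope ring_scope.
Variable q : X * Y -> X * Y -> R.
Hypothesis q0 : forall z' z, 0 <= q z' z.
Variable x : nat -> X.

Definition trans (s t : nat) (i j : Y) : R :=
  tprod q [seq x k | k <- iota s.+1 (t - s)] (x s) i j.

Lemma trans_ge0 s t i j : 0 <= trans s t i j.
Proof. exact: tprod_ge0. Qed.

Lemma trans0 s i j : trans s s i j = (i == j)%:R.
Proof. by rewrite /trans subnn. Qed.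

Lemma last_path s n : last (x s) [seq x k | k <- iota s.+1 n] = x (s + n)%N.
Proof. by elim: n s => [|n IHn] s /=; rewrite ?addn0// IHn addSnnS. Qed.

Lemma iota_path s u t : (s <= u <= t)%N ->
  iota s.+1 (t - s) = iota s.+1 (u - s) ++ iota u.+1 (t - u).
Proof.
move=> /andP[su ut].
have -> : (t - s = (u - s) + (t - u))%N by rewrite addnC addnBA// subnK.
by rewrite iotaD addSn subnKC.
Qed.

Lemma transM s u t i j : (s <= u <= t)%N ->
  trans s t i j = \sum_l trans s u i l * trans u t l j.
Proof.
move=> sut; rewrite /trans (iota_path sut) map_cat tprod_cat last_path.
by case/andP: sut => su _; rewrite subnKC.
Qed.

Definition apply_trans s t (b : Y -> R) (i : Y) : R := \sum_j trans s t i j * b j.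

Lemma apply_trans0 t b i : apply_trans t t b i = b i.
Proof.
rewrite /apply_trans (bigD1 i)//= trans0 eqxx mul1r big1 ?addr0// => j ji.
by rewrite trans0 eq_sym (negbTE ji) mul0r.
Qed.

Lemma apply_transM s u t b i : (s <= u <= t)%N ->
  apply_trans s t b i = \sum_l trans s u i l * apply_trans u t b l.
Proof.
move=> sut; rewrite /apply_trans.
under eq_bigr do rewrite (transM _ _ sut) mulr_suml.
rewrite exchange_big/=; apply: eq_bigr => l _.
by rewrite mulr_sumr; apply: eq_bigr => j _; rewrite mulrA.
Qed.

Lemma apply_trans_ge0 s t b : (forall j, 0 <= b j) -> forall i, 0 <= apply_trans s t b i.
Proof. by move=> b0 i; apply: sumr_ge0 => j _; rewrite mulr_ge0// trans_ge0. Qed.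

Variables (r N : nat) (G : nat -> bool) (g : R).
Hypotheses (r1 : (1 < r)%N) (N0 : (0 < N)%N) (g01 : 0 <= g <= 1).
Hypothesis gN : 1 - N%:R^-1 <= g ^+ r.-1.
Hypothesis good : forall k, G k -> forall i i' j j',
  trans k (k + r.-1) i j' * trans k (k + r.-1) i' j <=
  N%:R * (trans k (k + r.-1) i j * trans k (k + r.-1) i' j').

(** The good blocks contained in the interval from [s] to [t]; the truncated
    subtraction makes it [0] when no block fits. *)
Definition good_count s t : nat := \sum_(0 <= j < t.+2 - r - s) (G (s + j) : nat).

Lemma good_countD s t n : (good_count s t <= n + good_count (s + n) t)%N.
Proof.
rewrite /good_count subnDA.
have [Lj|jL] := leqP (t.+2 - r - s)%N n.
  apply: leq_trans (leq_addr _ _).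
  apply: (@leq_trans (\sum_(0 <= j < t.+2 - r - s) 1)%N); first by apply: leq_sum => j _; case: (G _).
  by rewrite sum_nat_const_nat muln1 subn0.
rewrite (@big_cat_nat _ _ _ n)//=; last exact: ltnW.
apply: leq_add.
  apply: (@leq_trans (\sum_(0 <= j < n) 1)%N); first by apply: leq_sum => j _; case: (G _).
  by rewrite sum_nat_const_nat muln1 subn0.
rewrite -{1}(add0n n) big_addn; apply: leq_sum => j _.
by rewrite -addnA (addnC n).
Qed.

(** Backward induction on [s]. Good blocks may overlap, whereas only disjoint ones
    contract: after a good block, which contracts by [1 - 1/N], the induction
    jumps over the [r - 1] starting points from [s] on. With
    [1 - 1/N <= g ^ (r - 1)] each of these may still be counted with a
    factor [g]. *)
Lemma path_oscillation (bA b1 : Y -> R) (t : nat) :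
  (forall j, 0 <= bA j <= b1 j) -> forall s, (s <= t)%N -> forall i i',
  apply_trans s t bA i * apply_trans s t b1 i' -
  apply_trans s t bA i' * apply_trans s t b1 i <=
  g ^+ good_count s t * (apply_trans s t b1 i * apply_trans s t b1 i').
Proof.
move=> bAb1.
have b10 j : 0 <= b1 j by have /andP[h1 h2] := bAb1 j; exact: le_trans h1 h2.
have /andP[g0 g1] := g01.
move=> s st; have [n] := ubnP (t - s)%N; elim: n s st => // n IHn s st tsn i i'.
have [->|snet] := eqVneq s t.
  rewrite !apply_trans0 (_ : good_count t t = 0%N); last first.
    by rewrite /good_count big_geq// leqn0 subn_eq0 leq_subLR -addn2 addnC leq_add2r.
  have /andP[h1 h2] := bAb1 i; have /andP[h1' h2'] := bAb1 i'.
  rewrite expr0 mul1r lerBlDr.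
  apply: (@le_trans _ _ (b1 i * b1 i')); first by rewrite ler_wpM2r.
  by rewrite lerDl mulr_ge0.
have slt : (s < t)%N by rewrite ltn_neqAle snet.
have step u e : (s < u <= t)%N -> 0 <= e <= 1 ->
    (forall i i' j j', e * (trans s u i j' * trans s u i' j) <=
       trans s u i j * trans s u i' j') ->
    (1 - e) * g ^+ good_count u t <= g ^+ good_count s t ->
    apply_trans s t bA i * apply_trans s t b1 i' -
    apply_trans s t bA i' * apply_trans s t b1 i <=
    g ^+ good_count s t * (apply_trans s t b1 i * apply_trans s t b1 i').
  move=> /andP[su ut] e01 eu gsu.
  have sut : (s <= u <= t)%N by rewrite ltnW.
  rewrite !(apply_transM _ _ sut).
  have H : forall j j' : Y, apply_trans u t bA j * apply_trans u t b1 j' -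
      apply_trans u t bA j' * apply_trans u t b1 j <=
      g ^+ good_count u t * (apply_trans u t b1 j * apply_trans u t b1 j').
    by apply: IHn => //; rewrite (leq_trans _ (tsn : (t - s <= n)%N))// ltn_sub2l.
  apply: le_trans (oscillation_mix (trans_ge0 s u i) (trans_ge0 s u i')
    (apply_trans_ge0 u t b10) (exprn_ge0 _ g0) e01 H (eu i i')) _.
  apply: ler_wpM2r => //.
  by apply: mulr_ge0; apply: sumr_ge0 => j _; rewrite mulr_ge0 ?trans_ge0 ?apply_trans_ge0.
have r10 : (0 < r.-1)%N by rewrite -ltnS prednK// ltnW.
have [/andP[Gs sr]|nGs] := boolP (G s && (s + r.-1 <= t)%N).
  apply: (step (s + r.-1)%N N%:R^-1).
  - by rewrite sr andbT -[X in (X < _)%N]addn0 ltn_add2l.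
  - by rewrite invr_ge0 ler0n invf_le1 ?ltr0n// ler1n N0.
  - move=> a a' j j'; rewrite ler_pdivrMl ?ltr0n//; exact: good.
  - apply: (@le_trans _ _ (g ^+ (r.-1 + good_count (s + r.-1) t))).
      by rewrite exprD ler_wpM2r// exprn_ge0.
    apply: ler_wiXn2l => //; exact: good_countD.
apply: (step s.+1 0).
- by rewrite slt ltnSn.
- by rewrite lexx ler01.
- by move=> a a' j j'; rewrite mul0r mulr_ge0// trans_ge0.
rewrite subr0 mul1r; apply: ler_wiXn2l => //.
rewrite /good_count.
case E : (t.+2 - r - s)%N => [|L]; first by rewrite big_geq.
have tr : (s + r.-1 <= t)%N.
  have : (0 < t.+2 - r - s)%N by rewrite E.
  rewrite subn_gt0 ltn_subRL -[X in (X + _)%N](prednK (ltnW r1)).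
  by rewrite addSn !ltnS addnC.
move: nGs; rewrite tr andbT => nGs.
rewrite big_ltn// addn0 (negbTE nGs) add0n.
rewrite subnS E /= big_add1 /=; apply: leq_sum => j _.
by rewrite addSnnS.
Qed.

(** [oscillation_mix] with [e = 0], divided by the product of the two
    denominators. *)
Lemma mixture_ratio_le (a a' bA b1 : Y -> R) (c : R) :
  (forall j, 0 <= a j) -> (forall j, 0 <= a' j) -> (forall j, 0 <= b1 j) -> 0 <= c ->
  (forall j j', bA j * b1 j' - bA j' * b1 j <= c * (b1 j * b1 j')) ->
  0 < \sum_j a j * b1 j -> 0 < \sum_j a' j * b1 j ->
  `|(\sum_j a j * bA j) / (\sum_j a j * b1 j) -
    (\sum_j a' j * bA j) / (\sum_j a' j * b1 j)| <= c.
Proof.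
move=> a0 a'0 b0 c0 osc S0 S'0.
have e01 : 0 <= (0 : R) <= 1 by rewrite lexx ler01.
have half (f f' : Y -> R) : (forall j, 0 <= f j) -> (forall j, 0 <= f' j) ->
    0 < \sum_j f j * b1 j -> 0 < \sum_j f' j * b1 j ->
    (\sum_j f j * bA j) / (\sum_j f j * b1 j) -
    (\sum_j f' j * bA j) / (\sum_j f' j * b1 j) <= c.
  move=> f0 f'0 F0 F'0.
  have := oscillation_mix f0 f'0 b0 c0 e01 osc _.
  rewrite subr0 mul1r => /(_ _)/wrap[].
    by move=> j j'; rewrite mul0r mulr_ge0.
  move=> h; rewrite -(ler_pM2r (mulr_gt0 F0 F'0)); apply: le_trans h.
  rewrite le_eqVlt; apply/orP; left; apply/eqP.
  by field; rewrite !gt_eqF.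
by rewrite ler_norml lerNl opprB !half.
Qed.

End path_oscillation.

(** * Powers of the reference measure *)

(** Aliases that carry a proof of finiteness, so that the corresponding structure
    can be attached to a given measure inside a proof or a recursion. *)
Section packed_measures.
Context d (T : measurableType d) (R : realType) (m : {measure set T -> \bar R}).

Definition sigma_finite_pack (h : sigma_finite setT m) : set T -> \bar R := m.

Definition finite_pack (h : fin_num_fun m) : set T -> \bar R := m.

HB.instance Definition _ h := Measure.on (sigma_finite_pack h).

HB.instance Definition _ (h : sigma_finite setT m) :=
  Measure_isSigmaFinite.Build _ _ _ (sigma_finite_pack h) h.

HB.instance Definition _ h := Measure.on (finite_pack h).

HB.instance Definition _ (h : fin_num_fun m) :=
  Measure_isFinite.Build _ _ _ (finite_pack h) h.

End packed_measures.

Lemma product_sigma_finite d1 d2 (T1 : measurableType d1) (T2 : measurableType d2)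
    (R : realType) (m1 : {sigma_finite_measure set T1 -> \bar R})
    (m2 : {sigma_finite_measure set T2 -> \bar R}) :
  sigma_finite setT (m1 \x m2).
Proof.
have /sigma_finiteP[F [TF ndF Foo]] := sigma_finiteT m1.
have /sigma_finiteP[G [TG ndG Goo]] := sigma_finiteT m2.
exists (fun n => F n `*` G n).
  rewrite -setXTT TF TG predeqE => -[x y]; split.
    move=> [/= [n _ Fnx] [k _ Gky]]; exists (maxn n k) => //; split.
    - by move: x Fnx; exact/subsetPset/ndF/leq_maxl.
    - by move: y Gky; exact/subsetPset/ndG/leq_maxr.
  by move=> [n _ []/= ? ?]; split; exists n.
move=> k; have [? ?] := Foo k; have [? ?] := Goo k.
split; first exact: measurableX.
by rewrite product_measure1E// lte_mul_pinfty// ge0_fin_numE.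
Qed.

Section finite_counting.
Context (R : realType) (m : nat).
Local Notation Y := 'I_m.+1.

Lemma integral_counting_ord (f : Y -> \bar R) : (forall i, 0 <= f i) ->
  \int[@counting Y R]_i f i = \sum_i f i.
Proof.
move=> f0.
have UT : \big[setU/set0]_(i <- enum Y) [set i] = [set: Y].
  rewrite -subTset => i _; rewrite -bigcup_seq/=.
  by exists i => //=; rewrite mem_enum.
rewrite -UT ge0_integral_bigsetU//.
- rewrite big_enum/=; apply: eq_bigr => i _.
  rewrite (eq_integral (fun=> f i)); last by move=> j /[!inE] ->.
  rewrite integral_cst// [X in _ * X](_ : _ = 1) ?mule1//.
  by rewrite /= /counting asboolT// fset_set1 finmap.cardfs1.
- exact: enum_uniq.
- by apply/trivIsetP => i j _ _ ij; rewrite -subset0 => l [-> /= /eqP]; rewrite (negbTE ij).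
Qed.

End finite_counting.

Section power_measures.
Context d (X : measurableType d) (R : realType).
Variable mu : {sigma_finite_measure set X -> \bar R}.

Definition pcons n (p : X * n.-tuple X) : n.+1.-tuple X := [tuple of p.1 :: p.2].

Lemma measurable_pcons n : measurable_fun setT (@pcons n).
Proof. exact: measurable_cons. Qed.

Lemma measurable_thead n : measurable_fun setT (fun u : n.+1.-tuple X => thead u).
Proof. exact: measurable_tnth. Qed.

Section cons_measure.
Context n (nu : {sigma_finite_measure set (n.-tuple X) -> \bar R}).

Definition cons_measure : {measure set (n.+1.-tuple X) -> \bar R} :=
  image_measure (mu \x nu) measurableT (@measurable_pcons n).

Lemma cons_measure_sigma_finite : sigma_finite setT cons_measure.
Proof.
have [F FT mF] := product_sigma_finite mu nu.
pose uncons (u : n.+1.-tuple X) := (thead u, [tuple of behead u]).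
have mu_ : measurable_fun setT uncons.
  apply/measurable_fun_pairP; split; first exact: measurable_thead.
  exact: measurable_behead.
exists (fun i => uncons @^-1` F i).
  by rewrite -preimage_bigcup -FT preimage_setT.
move=> i; have [mFi Fi] := mF i; have mUF := measurable_preim mu_ mFi.
split => //; rewrite /cons_measure image_measureE// setTI.
rewrite [X in _ X < _](_ : _ = F i)//; apply/seteqP; split => -[x u] /=.
  by rewrite /uncons /pcons /= theadE; congr (F i (_, _)); apply: val_inj.
by rewrite /uncons /pcons /= theadE; congr (F i (_, _)); apply: val_inj.
Qed.

End cons_measure.

(** [power_measure] as an iterated product: this gives access to Tonelli's
    theorem. *)
Fixpoint mpow (n : nat) : {sigma_finite_measure set (n.-tuple X) -> \bar R} :=
  match n with
  | 0 => dirac [tuple]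
  | n'.+1 => sigma_finite_pack (cons_measure_sigma_finite (mpow n'))
  end.

Lemma integral_mpow0 (h : 0.-tuple X -> \bar R) : (forall u, 0 <= h u) ->
  measurable_fun setT h -> \int[mpow 0]_u h u = h [tuple].
Proof. by move=> h0 mh; rewrite integral_dirac// diracT mul1e. Qed.

Lemma integral_mpowS n (h : n.+1.-tuple X -> \bar R) : (forall u, 0 <= h u) ->
  measurable_fun setT h ->
  \int[mpow n.+1]_u h u = \int[mu]_x \int[mpow n]_u h [tuple of x :: u].
Proof.
move=> h0 mh; rewrite [LHS]integral_image_measure//.
by rewrite fubini_tonelli1//; apply: measurableT_comp => //; exact: measurable_pcons.
Qed.

Lemma measurable_integral_mpow n (h : X * n.-tuple X -> \bar R) :
  (forall p, 0 <= h p) -> measurable_fun setT h ->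
  measurable_fun setT (fun x => \int[mpow n]_u h (x, u)).
Proof. by move=> h0 mh; exact: (measurable_fun_fubini_tonelli_F (m2 := mpow n) h mh h0). Qed.

Lemma power_measureE n (A : set (n.-tuple X)) : measurable A ->
  power_measure mu A = mpow n A.
Proof.
elim: n A => [//|n IHn] A mA.
transitivity (\int[mpow n.+1]_u (\1_A u)%:E); last by rewrite integral_indic// setIT.
rewrite integral_mpowS//; last by apply/measurable_EFinP; exact: measurable_indic.
rewrite /=; apply: eq_integral => x _.
have mAx : measurable [set u : n.-tuple X | A [tuple of x :: u]].
  have mp : measurable_fun setT (fun u : n.-tuple X => pcons (x, u)).
    by apply: measurableT_comp (@measurable_pcons n) _; exact: measurable_pair1.
  exact: (measurable_preim mp mA).
by rewrite IHn// -[X in mpow n X]setIT -integral_indic.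
Qed.

End power_measures.

(** * The density of the observations *)

Section observation_density.
Context {d : measure_display} {X : measurableType d} {m : nat} {R : realType}.
Variable mu : {sigma_finite_measure set X -> \bar R}.
Local Notation Y := 'I_m.+1.
Local Notation Z := (X * Y)%type.
Local Notation ref := (mu \x (@counting Y R)).
Variable q : Z -> Z -> R.

Definition ref_pack : {sigma_finite_measure set Z -> \bar R} :=
  sigma_finite_pack (product_sigma_finite mu (@counting Y R)).

Lemma integral_ref (h : Z -> \bar R) : (forall z, 0 <= h z) ->
  measurable_fun setT h ->
  \int[ref]_z h z = \int[mu]_x \sum_i h (x, i).
Proof.
move=> h0 mh; rewrite fubini_tonelli1//; apply: eq_integral => x _.
by rewrite /fubini_F integral_counting_ord.
Qed.

(** The proof [hq] is an argument so that the structure of measure can be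
    inferred from the function. *)
Definition kern (hq : transition_density mu q) (z : Z) : set Z -> \bar R :=
  kernel_of mu q z.

Hypothesis hq : transition_density mu q.

Lemma density_ge0 z' z : (0 <= q z' z)%R.
Proof. by case: hq. Qed.

Lemma measurable_density2 dT (T : measurableType dT) (f g : T -> Z) :
  measurable_fun setT f -> measurable_fun setT g ->
  measurable_fun setT (fun t => q (f t) (g t)).
Proof.
move=> mf mg; have [_ mq _] := hq.
have := measurableT_comp mq (_ : measurable_fun setT (fun t => (f t, g t))).
by apply; apply/measurable_fun_pairP; split.
Qed.

Let mqE z : measurable_fun setT (fun z' => (q z' z)%:E).
Proof. by apply/measurable_EFinP; apply: measurable_density2. Qed.

Let kern0 z : kern hq z set0 = 0.
Proof. by rewrite /kern /kernel_of integral_set0. Qed.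

Let kern_ge0 z C : 0 <= kern hq z C.
Proof. by apply: integral_ge0 => z' _; rewrite lee_fin density_ge0. Qed.

Let kern_sigma_additive z : semi_sigma_additive (kern hq z).
Proof.
apply: semi_sigma_additive_nng_induced; first exact: mqE.
by move=> z'; rewrite lee_fin density_ge0.
Qed.

HB.instance Definition _ z := isMeasure.Build _ _ _ (kern hq z)
  (kern0 z) (kern_ge0 z) (@kern_sigma_additive z).

Definition kmeas (z : Z) : {measure set Z -> \bar R} := kern hq z.

Lemma measurable_kmeas C : measurable C -> measurable_fun setT (kmeas ^~ C).
Proof.
move=> mC.
pose h (p : Z * Z) : \bar R := (q p.2 p.1 * \1_C p.2)%:E.
have h0 p : 0 <= h p by rewrite lee_fin mulr_ge0 ?density_ge0// indicE.
have mh : measurable_fun setT h.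
  apply/measurable_EFinP; apply: measurable_funM; first exact: measurable_density2.
  exact: (measurableT_comp (measurable_indic mC) measurable_snd).
have := measurable_fun_fubini_tonelli_F (m2 := ref_pack) h mh h0.
rewrite [X in measurable_fun _ X -> _](_ : _ = kmeas ^~ C)//.
apply/funext => z; rewrite /fubini_F /kmeas /= /kern /kernel_of [RHS]integral_mkcond.
transitivity (\int[ref]_z' h (z, z')) => //.
apply: eq_integral => z' _; rewrite /h /= patchE indicE.
by case: ifPn => _; rewrite ?mulr1 ?mulr0.
Qed.

Lemma kmeas1 z : kmeas z setT = 1.
Proof. by have [_ _ h] := hq; exact: h. Qed.

Lemma integral_kmeas z (h : Z -> \bar R) : (forall z, 0 <= h z) ->
  measurable_fun setT h ->
  \int[kmeas z]_y h y = \int[ref]_y (h y * (q y z)%:E).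
Proof.
move=> h0 mh; apply: integral_density => //.
  by move=> z'; exact: density_ge0.
by apply: measurable_density2.
Qed.

Variable Q : Z -> probability (seqspace Z) R.
Hypothesis QP : forall z, chain_law mu q z (Q z).

Lemma chain_law_markov z : markov kmeas (Q z) (fun n (w : seqspace Z) => w n).
Proof. by have [] := QP z. Qed.

Lemma chain_law_init z A : measurable A ->
  Q z [set w : seqspace Z | A (w 0%N)] = \d_z A.
Proof. by have [_] := QP z; apply. Qed.

Lemma first_step z (D : set (seqspace Z)) : measurable D ->
  Q z D = \int[kmeas z]_y Q y ((scons z : seqspace Z -> seqspace Z) @^-1` D).
Proof.
exact: (path_law_first_step measurable_kmeas kmeas1 chain_law_markov chain_law_init).
Qed.

Lemma measurable_law (D : set (seqspace Z)) : measurable D ->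
  measurable_fun setT (fun z => Q z D).
Proof.
exact: (measurable_path_law measurable_kmeas chain_law_markov chain_law_init).
Qed.

Definition ypath (w : nat -> Z) : nat -> Y := fun k => (w k).2.

Lemma measurable_ypath :
  measurable_fun setT (ypath : seqspace Z -> seqspace Y).
Proof.
apply: measurable_fun_seqspace => k.
exact: (measurableT_comp measurable_snd (measurable_coord k)).
Qed.

Definition yevent (A : set (seqspace Y)) : set (seqspace Z) := ypath @^-1` A.

Lemma measurable_yevent A : measurable A -> measurable (yevent A).
Proof. exact: (measurable_preim measurable_ypath). Qed.

Lemma ypath_scons z w : ypath (scons z w) = scons z.2 (ypath w).
Proof. by apply/funext => -[]. Qed.

Definition xtuple n (w : nat -> Z) : n.-tuple X :=
  [tuple of [seq (w k).1 | k <- iota 0 n]].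

Lemma measurable_xtuple n : measurable_fun setT (xtuple n : seqspace Z -> n.-tuple X).
Proof.
apply/measurable_fun_tnthP => i.
rewrite (_ : _ \o _ = fun w : seqspace Z => (w i).1).
  exact: (measurableT_comp measurable_fst (measurable_coord i)).
apply/funext => w /=.
by rewrite tnth_map (tnth_nth 0%N) /= nth_iota.
Qed.

Lemma xtuple_scons n z w : xtuple n.+1 (scons z w) = pcons (z.1, xtuple n w).
Proof.
by apply: val_inj => /=; rewrite -[1%N]addn0 iotaDl -map_comp.
Qed.

Lemma measurable_ycons i (A : set (seqspace Y)) : measurable A ->
  measurable ((scons i : seqspace Y -> seqspace Y) @^-1` A).
Proof. exact: (measurable_preim (measurable_scons i)). Qed.

(** The density, with respect to a power of [mu], of the next observations
    [xs] together with the event that the hidden path from now on is in [A],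
    when the present state is [(x, i)]. *)
Fixpoint bwd (xs : seq X) (x : X) (i : Y) (A : set (seqspace Y)) : R :=
  if xs is x' :: xs' then
    (\sum_j q (x', j) (x, i) * bwd xs' x' j (scons i @^-1` A))%R
  else fine (Q (x, i) (yevent A)).

Lemma bwd_ge0 xs x i A : (0 <= bwd xs x i A)%R.
Proof.
elim: xs x i A => [|x' xs IHxs] x i A /=; first exact: fine_ge0.
by apply: sumr_ge0 => j _; rewrite mulr_ge0// density_ge0.
Qed.

Lemma bwd_le xs x i A : measurable A -> (bwd xs x i A <= bwd xs x i setT)%R.
Proof.
elim: xs x i A => [|x' xs IHxs] x i A mA /=.
  have mE := measurable_yevent mA; have mT := measurable_yevent measurableT.
  apply: fine_le; [exact: fin_num_measure|exact: fin_num_measure|].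
  by apply: le_measure; rewrite ?inE//.
apply: ler_sum => j _; rewrite ler_wpM2l ?density_ge0//.
by rewrite preimage_setT; apply: IHxs; exact: measurable_ycons.
Qed.

(** The Markov property at the density level: the dependence on the first
    observations is through [tprod] only. *)
Lemma bwd_cat xs ys x i A :
  bwd (xs ++ ys) x i (shift (size xs) @^-1` A) =
  (\sum_l tprod q xs x i l * bwd ys (last x xs) l A)%R.
Proof.
elim: xs x i => [|x' xs IHxs] x i /=.
  rewrite (bigD1 i)//= eqxx mul1r big1 ?addr0// => l li.
  by rewrite eq_sym (negbTE li) mul0r.
under [RHS]eq_bigr do rewrite mulr_suml.
rewrite [RHS]exchange_big/=; apply: eq_bigr => l _.
rewrite [X in bwd _ _ _ X](_ : _ = shift (size xs) @^-1` A); last by apply/seteqP; split.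
rewrite IHxs mulr_sumr; apply: eq_bigr => l' _.
by rewrite mulrA.
Qed.

Lemma measurable_bwd n i A : measurable A ->
  measurable_fun setT (fun p : X * n.-tuple X => bwd p.2 p.1 i A).
Proof.
elim: n i A => [|n IHn] i A mA.
  rewrite (_ : (fun p => _) = fun p : X * 0.-tuple X => fine (Q (p.1, i) (yevent A))).
    apply: measurableT_comp => //.
    apply: (measurableT_comp (measurable_law (measurable_yevent mA))).
    by apply/measurable_fun_pairP; split; [exact: measurable_fst|exact: measurable_cst].
  by apply/funext => p; rewrite (tuple0 p.2).
rewrite (_ : (fun p => _) = fun p : X * n.+1.-tuple X => (\sum_j
    q (thead p.2, j) (p.1, i) *
    bwd [tuple of behead p.2] (thead p.2) j (scons i @^-1` A))%R); last first.
  by apply/funext => -[x u]; case/tupleP: u => x' u /=; rewrite theadE.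
have mth : measurable_fun setT (fun p : X * n.+1.-tuple X => thead p.2).
  exact: (measurableT_comp (@measurable_thead _ _ _) measurable_snd).
apply: measurable_sum => j; apply: measurable_funM.
  apply: measurable_density2; apply/measurable_fun_pairP; split.
  - exact: mth.
  - exact: measurable_cst.
  - exact: measurable_fst.
  - exact: measurable_cst.
apply: (measurableT_comp (IHn j _ (measurable_ycons i mA))
  (_ : measurable_fun setT (fun p : X * n.+1.-tuple X => (thead p.2, [tuple of behead p.2])))).
apply/measurable_fun_pairP; split => //.
exact: (measurableT_comp (@measurable_behead _ _ _) measurable_snd).
Qed.

End observation_density.

Section path_density.
Context {d : measure_display} {X : measurableType d} {m : nat} {R : realType}.
Variable mu : {sigma_finite_measure set X -> \bar R}.
Local Notation Y := 'I_m.+1.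
Local Notation Z := (X * Y)%type.
Local Notation ref := (mu \x (@counting Y R)).
Variable q : Z -> Z -> R.
Hypothesis hq : transition_density mu q.
Variable Q : Z -> probability (seqspace Z) R.
Hypothesis QP : forall z, chain_law mu q z (Q z).
Local Notation bwd := (bwd q Q).

(** The density of the observations [s] and of the event that the hidden path
    is in [A], when the first state has density [f]. *)
Definition obs_density (f : Z -> R) (s : seq X) (A : set (seqspace Y)) : R :=
  if s is x :: xs then (\sum_i f (x, i) * bwd xs x i A)%R else 0.

Lemma obs_density_ge0 f s A : (forall z, (0 <= f z)%R) -> (0 <= obs_density f s A)%R.
Proof.
move=> f0; case: s => [//|x xs] /=; apply: sumr_ge0 => i _.
by rewrite mulr_ge0// (bwd_ge0 hq).
Qed.

Lemma obs_density_le f s A : (forall z, (0 <= f z)%R) -> measurable A ->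
  (obs_density f s A <= obs_density f s setT)%R.
Proof.
move=> f0 mA; case: s => [//|x xs] /=; apply: ler_sum => i _.
by rewrite ler_wpM2l// (bwd_le hq).
Qed.

Lemma measurable_obs_density (f : Z -> R) n (A : set (seqspace Y)) :
  measurable_fun setT f -> measurable A ->
  measurable_fun setT (fun u : n.+1.-tuple X => obs_density f u A).
Proof.
move=> mf mA.
rewrite (_ : (fun u => _) = fun u : n.+1.-tuple X => (\sum_i f (thead u, i) *
    bwd [tuple of behead u] (thead u) i A)%R); last first.
  by apply/funext => u; case/tupleP: u => x u /=; rewrite theadE.
have mth : measurable_fun setT (fun u : n.+1.-tuple X => thead u).
  exact: measurable_thead.
apply: measurable_sum => i; apply: measurable_funM.
  by apply: (measurableT_comp mf); apply/measurable_fun_pairP; split;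
    [exact: mth|exact: measurable_cst].
have mg : measurable_fun setT (fun u : n.+1.-tuple X =>
    (thead u, [tuple of behead u]) : X * n.-tuple X).
  by apply/measurable_fun_pairP; split => //; exact: measurable_behead.
exact: (measurableT_comp (measurable_bwd hq QP i mA) mg).
Qed.

Lemma measurable_pcons_pre n x (C : set (n.+1.-tuple X)) : measurable C ->
  measurable ((fun u : n.-tuple X => pcons (x, u)) @^-1` C).
Proof.
move=> mC; apply: measurable_preim mC.
by apply: measurableT_comp (@measurable_pcons _ _ n) _; exact: measurable_pair1.
Qed.

Lemma measurable_bwd_fix n x i A : measurable A ->
  measurable_fun setT (fun u : n.-tuple X => bwd u x i A).
Proof.
move=> mA; have mp : measurable_fun setT (fun u : n.-tuple X => (x, u)).
  exact: measurable_pair1.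
exact: (measurableT_comp (measurable_bwd hq QP i mA) mp).
Qed.

Definition obs_event n (C : set (n.-tuple X)) (A : set (seqspace Y)) :
  set (seqspace Z) := xtuple n @^-1` C `&` yevent A.

Lemma measurable_obs_event n (C : set (n.-tuple X)) A :
  measurable C -> measurable A -> measurable (obs_event C A).
Proof.
move=> mC mA; apply: measurableI; last exact: measurable_yevent.
have h := measurable_preim (@measurable_xtuple d X m n) mC.
refine h.
Qed.

Lemma obs_event_scons n (C : set (n.+1.-tuple X)) (A : set (seqspace Y)) (z : Z) :
  (scons z : seqspace Z -> seqspace Z) @^-1` obs_event C A =
  obs_event ((fun u : n.-tuple X => pcons (z.1, u)) @^-1` C)
    ((scons z.2 : seqspace Y -> seqspace Y) @^-1` A).
Proof.
by apply/seteqP; split => w; rewrite /obs_event /yevent /= xtuple_scons ypath_scons.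
Qed.

(** The step from a fixed initial state to one with density [f]; the hypothesis
    on [Q] is the conclusion of [path_density], whose induction step is an
    instance with [f] a transition density. *)
Lemma path_density_first n (f : Z -> R) (C : set (n.+1.-tuple X)) (A : set (seqspace Y)) :
  (forall z, (0 <= f z)%R) -> measurable_fun setT f -> measurable C -> measurable A ->
  (forall z, Q z (obs_event C A) =
    \int[mpow mu n]_u (\1_C (pcons (z.1, u)) * bwd u z.1 z.2 A)%:E) ->
  \int[ref]_z ((f z)%:E * Q z (obs_event C A)) =
  \int[mpow mu n.+1]_u (\1_C u * obs_density f u A)%:E.
Proof.
move=> f0 mf mC mA H.
have mE := measurable_obs_event mC mA.
rewrite integral_ref; last 2 first.
- by move=> z; rewrite mule_ge0// lee_fin.
- apply: emeasurable_funM; first exact/measurable_EFinP.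
  exact: (measurable_law hq QP).
rewrite integral_mpowS; last 2 first.
- by move=> u; rewrite lee_fin mulr_ge0 ?obs_density_ge0// indicE.
- apply/measurable_EFinP; apply: measurable_funM; first exact: measurable_indic.
  exact: measurable_obs_density.
apply: eq_integral => x _.
have b0 u i : (0 <= \1_C (pcons (x, u)) * bwd u x i A)%R.
  by rewrite mulr_ge0 ?(bwd_ge0 hq)// indicE.
have mb i : measurable_fun setT (fun u : n.-tuple X =>
    (\1_C (pcons (x, u)) * bwd u x i A)%R).
  apply: measurable_funM; last exact: measurable_bwd_fix.
  exact: (measurable_indic (measurable_pcons_pre x mC)).
rewrite [RHS](eq_integral (fun u => \sum_i (f (x, i))%:E *
    (\1_C (pcons (x, u)) * bwd u x i A)%:E)); last first.
  move=> u _; rewrite /= sumEFin mulr_sumr; congr EFin; apply: eq_bigr => i _.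
  by rewrite mulrCA.
rewrite ge0_integral_sum//; last 2 first.
- by move=> i; apply: measurable_funeM; exact/measurable_EFinP.
- by move=> i u _; rewrite mule_ge0// lee_fin.
apply: eq_bigr => i _; rewrite ge0_integralZl//; last 3 first.
- exact/measurable_EFinP.
- by move=> u _; rewrite lee_fin.
- by rewrite lee_fin.
by rewrite H.
Qed.

(** Induction on the number of observations, by conditioning on the first
    step: the transition density from the present state is the density of the
    next state, to which [path_density_first] applies. *)
Lemma path_density n (C : set (n.+1.-tuple X)) (A : set (seqspace Y)) (z : Z) :
  measurable C -> measurable A ->
  Q z (obs_event C A) =
  \int[mpow mu n]_u (\1_C (pcons (z.1, u)) * bwd u z.1 z.2 A)%:E.
Proof.
elim: n C A z => [|n IHn] C A z mC mA.
  rewrite integral_mpow0; last 2 first.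
  - by move=> u; rewrite lee_fin mulr_ge0 ?(bwd_ge0 hq)// indicE.
  - apply/measurable_EFinP; apply: measurable_funM; last exact: measurable_bwd_fix.
    exact: (measurable_indic (measurable_pcons_pre z.1 mC)).
  have mE := measurable_obs_event mC mA.
  rewrite (first_step hq QP)// obs_event_scons.
  have Ez : Q z (yevent A) = \int[kmeas hq z]_y
      Q y (yevent ((scons z.2 : seqspace Y -> seqspace Y) @^-1` A)).
    rewrite (first_step hq QP); last exact: measurable_yevent.
    apply: eq_integral => y _; congr (Q y _).
    by apply/seteqP; split => w; rewrite /yevent /= ypath_scons.
  rewrite indicE /=; have [zC|zC] := pselect (C (pcons (z.1, [tuple]))).
    rewrite mem_set// mul1r -surjective_pairing fineK; last first.
      by apply: fin_num_measure; exact: measurable_yevent.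
    rewrite Ez; apply: eq_integral => y _; congr (Q y _).
    apply/seteqP; split => w; first by case.
    by move=> Aw; split => //=; rewrite [xtuple 0 w]tuple0.
  rewrite memNset// mul0r integral0_eq// => y _.
  rewrite (_ : obs_event _ _ = set0) ?measure0//.
  by apply/seteqP; split => w //= -[/=]; rewrite [xtuple 0 w]tuple0.
have mE := measurable_obs_event mC mA.
rewrite (first_step hq QP)// obs_event_scons.
have mC' := measurable_pcons_pre z.1 mC.
have mA' := measurable_ycons z.2 mA.
rewrite integral_kmeas//; last first.
  by apply: (measurable_law hq QP); exact: measurable_obs_event.
under eq_integral do rewrite muleC.
rewrite (path_density_first (f := q ^~ z)) //.
- apply: eq_integral => u _; congr EFin; rewrite indicE; congr (_ * _)%R.
  by case: z {mE mC' mA'} => x i; case/tupleP: u.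
- by move=> z'; exact: (density_ge0 hq).
- exact: (measurable_density2 hq).
- by move=> y; exact: IHn.
Qed.

End path_density.

(** * Conditional laws of the hidden process as quotients *)

Section observed_chain.
Context {d : measure_display} {X : measurableType d} {m : nat} {R : realType}.
Variable mu : {sigma_finite_measure set X -> \bar R}.
Local Notation Y := 'I_m.+1.
Local Notation Z := (X * Y)%type.
Local Notation ref := (mu \x (@counting Y R)).
Variable q : Z -> Z -> R.
Hypothesis hq : transition_density mu q.
Variable Q : Z -> probability (seqspace Z) R.
Hypothesis QP : forall z, chain_law mu q z (Q z).
Context {dO : measure_display} {Omega : measurableType dO} (P : probability Omega R).
Variable V : nat -> Omega -> Z.
Hypothesis VP : markov_chain mu P q V.
Hypothesis V0 : has_density mu (fun C : set Z => P (V 0%N @^-1` C)).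

Let mV n : measurable_fun setT (V n). Proof. by have [] := VP. Qed.

Lemma chain_markov : markov (kmeas hq) P V. Proof. exact: VP. Qed.

Lemma markov_law l (D : set (seqspace Z)) : measurable D ->
  P ((traj V l : Omega -> seqspace Z) @^-1` D) = \int[P]_w Q (V l w) D.
Proof.
move=> mD.
have := markov_path (measurable_kmeas hq) (chain_law_markov hq QP)
  (chain_law_init QP) chain_markov (i := l)
  (@measurableT _ (g_sigma_algebraType (past V l))) mD.
by rewrite setTI.
Qed.

Lemma null_trajectories l (D : set (seqspace Z)) : measurable D ->
  (forall z, Q z D = 0) -> P ((traj V l : Omega -> seqspace Z) @^-1` D) = 0.
Proof. by move=> mD QD; rewrite markov_law// integral0_eq. Qed.

(** The kernel is absolutely continuous, hence so are the laws of all later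
    states. *)
Lemma state_density l : exists f : Z -> R,
  [/\ forall z, (0 <= f z)%R, measurable_fun setT f &
      forall C, measurable C -> P (V l @^-1` C) = \int[ref]_(z in C) (f z)%:E].
Proof.
case: l => [//|l].
pose law0 := image_measure P measurableT (@mV l.+1).
have law0E C : measurable C -> law0 C = P (V l.+1 @^-1` C).
  by move=> mC; rewrite image_measureE// setTI.
have law0fin : fin_num_fun law0.
  by move=> C mC; rewrite law0E// fin_num_measure//; exact: measurable_preim.
pose law : {finite_measure set Z -> \bar R} := finite_pack law0fin.
have dom : law `<< ref_pack mu.
  move=> N refN C mC CN; rewrite [LHS]law0E//.
  have [_ /(_ l C mC)[_ /(_ setT)]] := VP.
  rewrite setIT => <-; last exact: (@measurableT _ (g_sigma_algebraType _)).
  rewrite integral0_eq// => w _.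
  have refC : ref C = 0 by exact: (refN C mC CN).
  rewrite /kernel_of null_set_integral//.
  apply/measurable_EFinP; apply: measurable_funTS; exact: (measurable_density2 hq).
pose f0 := Radon_Nikodym_SigmaFinite.f law (ref_pack mu).
have f0fin z : f0 z \is a fin_num by exact: Radon_Nikodym_SigmaFinite.f_fin_num.
exists (fine \o f0); split.
- by move=> z; apply: fine_ge0; exact: Radon_Nikodym_SigmaFinite.f_ge0.
- apply: measurableT_comp => //.
  exact: measurable_int (Radon_Nikodym_SigmaFinite.f_integrable dom).
- move=> C mC; rewrite -law0E//.
  transitivity (\int[ref]_(z in C) f0 z).
    exact: (Radon_Nikodym_SigmaFinite.f_integral dom).
  by apply: eq_integral => z _; rewrite /= fineK.
Qed.

Definition is_state_density (l : nat) (f : Z -> R) :=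
  [/\ forall z, (0 <= f z)%R, measurable_fun setT f &
      forall C, measurable C -> P (V l @^-1` C) = \int[ref]_(z in C) (f z)%:E].

Lemma integral_state l f (h : Z -> \bar R) : is_state_density l f ->
  (forall z, 0 <= h z) -> measurable_fun setT h ->
  \int[P]_w h (V l w) = \int[ref]_z ((f z)%:E * h z).
Proof.
move=> [f0 mf fE] h0 mh.
rewrite -(integral_image_measure P measurableT (@mV l))//.
under [RHS]eq_integral do rewrite muleC.
apply: integral_density => // C mC.
by rewrite image_measureE// setTI; exact: fE.
Qed.

Section observations.
Variables (l n : nat) (f : Z -> R).
Hypothesis fP : is_state_density l f.
Local Notation dens := (obs_density q Q f).

Definition obs (w : Omega) : n.+1.-tuple X := xtuple n.+1 (traj V l w).

Lemma measurable_obs : measurable_fun setT obs.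
Proof.
have mx := @measurable_xtuple _ X m n.+1.
have mt := measurable_traj chain_markov l.
exact: (measurableT_comp mx mt).
Qed.

Lemma obs_law (C : set (n.+1.-tuple X)) (A : set (seqspace Y)) :
  measurable C -> measurable A ->
  P (obs @^-1` C `&` (traj V l : Omega -> seqspace Z) @^-1` yevent A) =
  \int[mpow mu n.+1]_u (\1_C u * dens u A)%:E.
Proof.
move=> mC mA; have [f0 mf _] := fP.
have mE := measurable_obs_event mC mA.
transitivity (P ((traj V l : Omega -> seqspace Z) @^-1` obs_event C A)) => //.
rewrite markov_law//.
rewrite (integral_state fP (h := fun z => Q z (obs_event C A)))//; last first.
  exact: (measurable_law hq QP).
apply: (path_density_first hq QP) => // z.
exact: (path_density hq QP).
Qed.

Lemma obs_lawT (C : set (n.+1.-tuple X)) : measurable C ->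
  P (obs @^-1` C) = \int[mpow mu n.+1]_u (\1_C u * dens u setT)%:E.
Proof.
move=> mC; rewrite -obs_law//; congr (P _).
by apply/seteqP; split => w //= -[].
Qed.

Lemma obs_law_density (h : n.+1.-tuple X -> \bar R) : (forall u, 0 <= h u) ->
  measurable_fun setT h ->
  \int[P]_w h (obs w) = \int[mpow mu n.+1]_u (h u * (dens u setT)%:E).
Proof.
move=> h0 mh; have [f0 mf _] := fP.
rewrite -(integral_image_measure P measurableT measurable_obs)//.
apply: integral_density => //.
- by move=> u; exact: (obs_density_ge0 hq).
- exact: (measurable_obs_density hq QP).
- move=> C mC; rewrite image_measureE// setTI; apply: etrans (obs_lawT mC) _.
  rewrite [RHS]integral_mkcond; apply: eq_integral => u _.
  by rewrite patchE indicE; case: ifPn => _; rewrite ?mul1r ?mul0r.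
Qed.

Lemma obs_density_gt0 : {ae P, forall w, (0 < dens (obs w) setT)%R}.
Proof.
have [f0 mf _] := fP.
have md := measurable_obs_density hq QP (n := n) mf (@measurableT _ (seqspace Y)).
pose N := [set u : n.+1.-tuple X | (dens u setT <= 0)%R].
have mN : measurable N by exact: (measurable_le_set md (measurable_cst _)).
exists (obs @^-1` N); split.
- exact: (measurable_preim measurable_obs).
- apply: etrans (obs_lawT mN) _; rewrite integral0_eq// => u _; rewrite indicE.
  have [uN|uN] := pselect (N u); last by rewrite memNset// mul0r.
  rewrite mem_set// mul1r; congr EFin; apply/eqP.
  by rewrite eq_le (obs_density_ge0 hq) // andbT.
- by move=> w /=; rewrite /N /= => /negP; rewrite -leNgt.
Qed.

Definition ratio (A : set (seqspace Y)) (w : Omega) : R :=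
  (dens (obs w) A / dens (obs w) setT)%R.

Lemma ratio01 A : measurable A -> unit_valued (ratio A).
Proof.
move=> mA w; have [f0 mf _] := fP; rewrite /ratio.
have d0 : (0 <= dens (obs w) A)%R by exact: (obs_density_ge0 hq).
have d1 : (dens (obs w) A <= dens (obs w) setT)%R by exact: (obs_density_le hq).
have [dT|dT] := leP (dens (obs w) setT) 0%R.
  have -> : dens (obs w) A = 0%R by apply/eqP; rewrite eq_le d0 (le_trans d1 dT).
  by rewrite mul0r lexx ler01.
by rewrite divr_ge0 ?(ltW dT)// ler_pdivrMr// mul1r d1.
Qed.

Definition obs_gen := process_gen (fun k w => (V k w).1) (time_window l (Some (l + n)%N)).

Lemma measurable_obs_gen :
  measurable_fun [set: g_sigma_algebraType obs_gen] (obs : Omega -> _).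
Proof.
apply/measurable_fun_tnthP => i.
rewrite (_ : _ \o _ = fun w => (V (l + i)%N w).1); last first.
  apply/funext => w /=; rewrite /obs /xtuple.
  by rewrite tnth_map (tnth_nth 0%N) /= (nth_iota 0 0 (ltn_ord i)).
move=> _ A mA; apply: sub_sigma_algebra; exists (l + i)%N; last by exists A.
by rewrite /time_window /= leq_addr leq_add2l -ltnS ltn_ord.
Qed.

(** Measurability with respect to finitely many observations is
    factorisation through their tuple. *)
Lemma obs_gen_preim B : <<s obs_gen >> B ->
  exists2 C, measurable C & B = obs @^-1` C.
Proof.
suff H : <<s obs_gen >> `<=` [set B | exists2 C, measurable C & B = obs @^-1` C].
  by move=> /H.
apply: smallest_sub; last first.
  move=> _ [k /andP[lk kn] [A mA <-]].
  have kl : (k - l < n.+1)%N by rewrite ltnS leq_subLR.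
  exists [set u | A (tnth u (Ordinal kl))].
    exact: (measurable_preim (@measurable_tnth _ X _ (Ordinal kl))).
  rewrite setTI; apply/seteqP; split => w /=;
    by rewrite /obs /xtuple tnth_map (tnth_nth 0%N) /= (nth_iota 0 0 kl) add0n /traj subnKC.
split.
- by exists set0 => //; rewrite preimage_set0.
- move=> _ [C mC ->]; exists (~` C); first exact: measurableC.
  by rewrite setTD preimage_setC.
- move=> F hF.
  have [C mC] := choice (fun i => let: ex_intro2 C mC FC := hF i in
    ex_intro (fun C => measurable C /\ F i = obs @^-1` C) C (conj mC FC)).
  exists (\bigcup_i C i); first by apply: bigcupT_measurable => i; case: (mC i).
  by rewrite preimage_bigcup; apply: eq_bigcupr => i _; case: (mC i).
Qed.

(** Bayes' rule. The denominator may vanish, but where it does so does the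
    numerator. *)
Lemma ratio_cond_prob A : measurable A ->
  is_cond_prob P obs_gen ((traj V l : Omega -> seqspace Z) @^-1` yevent A)
    (EFin \o ratio A).
Proof.
move=> mA; have [f0 mf _] := fP.
have md A' := measurable_obs_density hq QP (n := n) mf (A := A').
(* The inverse is written as a real power, whose measurability is known; on
   nonnegative reals, and at [0] too, they agree. *)
pose rho (u : n.+1.-tuple X) : R := (dens u A * dens u setT `^ (-1))%R.
have rhoE w : ratio A w = rho (obs w).
  by rewrite /ratio /rho powR_inv1// (obs_density_ge0 hq).
have mrho : measurable_fun setT rho.
  apply: measurable_funM; first exact: md.
  have mp := measurable_powR (- 1 : R)%R.
  exact: (measurableT_comp mp (md _ measurableT)).
have rho0 u : (0 <= rho u)%R.
  by rewrite mulr_ge0 ?powR_ge0// (obs_density_ge0 hq).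
split.
  apply/measurable_EFinP; rewrite (_ : ratio A = rho \o obs); last exact/funext.
  exact: (measurableT_comp mrho measurable_obs_gen).
move=> _ /obs_gen_preim[C mC ->].
have mCB : measurable (obs @^-1` C) by exact: (measurable_preim measurable_obs).
rewrite setIC obs_law//.
transitivity (\int[P]_w (\1_C (obs w) * rho (obs w))%:E).
  rewrite integral_mkcond; apply: eq_integral => w _.
  rewrite patchE indicE /= rhoE.
  have -> : (w \in obs @^-1` C) = (obs w \in C) by [].
  by case: ifPn => _; rewrite ?mul1r ?mul0r.
rewrite (obs_law_density (h := fun u => (\1_C u * rho u)%:E)); last 2 first.
- by move=> u; rewrite lee_fin mulr_ge0// indicE.
- by apply/measurable_EFinP; apply: measurable_funM => //; exact: measurable_indic.
apply: eq_integral => u _; rewrite -EFinM -mulrA; congr (_ * _)%:E.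
rewrite /rho powR_inv1 ?(obs_density_ge0 hq)//.
have [dT|dT] := eqVneq (dens u setT) 0%R; last by rewrite divfK.
rewrite dT mulr0; apply/esym/eqP; rewrite eq_le (obs_density_ge0 hq) // andbT.
by rewrite -dT; exact: (obs_density_le hq).
Qed.

End observations.
End observed_chain.

(** * Bound on the gap by the number of good blocks *)

Section finite_cylinders.
Context {m : nat}.
Local Notation Y := 'I_m.+1.

Definition cylinder (N : nat) (L : seq (seq Y)) : set (seqspace Y) :=
  [set v | mkseq v N \in L].

(** A countable algebra, which is why finite words are used and not general
    boxes. *)
Definition cylinders : set (set (seqspace Y)) :=
  [set D | exists NL : nat * seq (seq Y), D = cylinder NL.1 NL.2].

Lemma cylinder_pred N (p : pred (seq Y)) : cylinders [set v | p (mkseq v N)].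
Proof.
exists (N, [seq val u | u <- enum {: N.-tuple Y} & p (val u)]).
apply/seteqP; split => v /=.
  move=> pv; apply/mapP; exists [tuple of mkseq v N] => //.
  by rewrite mem_filter mem_enum andbT.
by move=> /mapP[u]; rewrite mem_filter => /andP[pu _] ->.
Qed.

Lemma take_mkseq (v : nat -> Y) n N : (n <= N)%N -> take n (mkseq v N) = mkseq v n.
Proof. by move=> nN; rewrite /mkseq -map_take take_iota (minn_idPl nN). Qed.

Lemma cylindersT : cylinders setT.
Proof.
have := cylinder_pred 0 xpredT.
by rewrite (_ : [set _ | _] = setT)//; apply/seteqP; split.
Qed.

Lemma cylindersC : setC_closed cylinders.
Proof.
move=> _ [[N L] ->].
have := cylinder_pred N (fun u => u \notin L).
by rewrite (_ : [set _ | _] = ~` cylinder N L)//; apply/seteqP; split => v /= /negP.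
Qed.

Lemma cylindersU : setU_closed cylinders.
Proof.
move=> _ _ [[N L] ->] [[N' L'] ->].
have := cylinder_pred (maxn N N') (fun u => (take N u \in L) || (take N' u \in L')).
rewrite (_ : [set _ | _] = cylinder N L `|` cylinder N' L')//.
apply/seteqP; split => v /=; rewrite !take_mkseq ?leq_maxl ?leq_maxr//.
  by move/orP.
by move=> h; apply/orP.
Qed.

Lemma measurable_cylinders : @measurable _ (seqspace Y) = <<s cylinders >>.
Proof.
apply/seteqP; split.
  apply: smallest_sub; first exact: smallest_sigma_algebra.
  move=> _ [k _ [A mA <-]]; apply: sub_sigma_algebra.
  have := cylinder_pred k.+1 (fun u => nth ord0 u k \in A).
  rewrite (_ : [set _ | _] = setT `&` (fun w : seqspace Y => w k) @^-1` A)//.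
  by rewrite setTI; apply/seteqP; split => v /=; rewrite nth_mkseq// inE.
apply: sigma_sub => _ [[N L] ->].
rewrite (_ : cylinder N L = \big[setU/set0]_(u <- L) [set v | mkseq v N = u]); last first.
  rewrite -bigcup_seq; apply/seteqP; split => v /=.
    by move=> vL; exists (mkseq v N).
  by move=> [u /= uL vu]; rewrite /cylinder /= vu.
apply: bigsetU_measurable => u _.
have [uN|uN] := eqVneq (size u) N; last first.
  rewrite (_ : [set _ | _] = set0) ?measurable0//; apply/seteqP; split => v //= vu.
  by move: uN; rewrite -vu size_mkseq eqxx.
rewrite (_ : [set _ | _] = box N (fun k => [set nth ord0 u k])).
  by apply: measurable_box.
apply/seteqP; split => v /=.
  by move=> <- k kN /=; rewrite nth_mkseq.
move=> h; apply: (@eq_from_nth _ ord0); rewrite size_mkseq ?uN// => k kN.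
by rewrite nth_mkseq//; exact: h.
Qed.

End finite_cylinders.

Section countable_ae.
Context d (T : measurableType d) (R : realType) (mu : {measure set T -> \bar R}).

Lemma ae_forall_countable (I : countType) (p : I -> T -> Prop) :
  (forall i, {ae mu, forall x, p i x}) -> {ae mu, forall x, forall i, p i x}.
Proof.
move=> h.
have : {ae mu, forall x, forall n : nat, if unpickle n is Some i then p i x else True}.
  apply: ae_foralln => n; case: unpickle => [i|]; first exact: h.
  by apply: aeW.
by apply: filterS => x hx i; have := hx (pickle i); rewrite pickleK.
Qed.

End countable_ae.

(** Each block contributes the factor [1 - (1 - g) * [good]]. *)
Lemma measurable_rate dT (T : measurableType dT) (R : realType) (g : R)
    (G : T -> nat -> bool) (r s t : nat) :
  (forall j, measurable_fun setT (fun w => (G w (s + j)%N : nat)%:R : R)) ->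
  measurable_fun setT (fun w => (g ^+ good_count r (G w) s t)%R).
Proof.
move=> mG.
rewrite (_ : (fun w => _) = fun w => (\prod_(j <- index_iota 0 (t.+2 - r - s))
    (1 - (1 - g) * (G w (s + j)%N : nat)%:R))%R).
  apply: measurable_prod => j _; apply: measurable_funB => //.
  exact: measurable_funM.
apply/funext => w; rewrite /good_count expr_sum; apply: eq_bigr => j _.
by case: (G w _) => /=; rewrite ?expr1 ?expr0; lra.
Qed.

Section smoothing.
Context {d : measure_display} {X : measurableType d} {m : nat} {R : realType}.
Variable mu : {sigma_finite_measure set X -> \bar R}.
Local Notation Y := 'I_m.+1.
Local Notation Z := (X * Y)%type.
Variable q : Z -> Z -> R.
Hypothesis hq : transition_density mu q.
Variable Q : Z -> probability (seqspace Z) R.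
Hypothesis QP : forall z, chain_law mu q z (Q z).
Context {dO : measure_display} {Omega : measurableType dO} (P : probability Omega R).
Variable V : nat -> Omega -> Z.
Hypothesis VP : markov_chain mu P q V.
Hypothesis V0 : has_density mu (fun C : set Z => P (V 0%N @^-1` C)).
Variable K : nat -> nat -> option nat -> Omega -> probability (seqspace Y) R.
Hypothesis hK : regular_version P V K.

Local Notation x := (fun w k => (V k w).1).
Local Notation bwd := (bwd q Q).

Variables (r N : nat) (G : Omega -> nat -> bool) (g : R).
Hypotheses (r1 : (1 < r)%N) (N0 : (0 < N)%N) (g01 : (0 <= g <= 1)%R).
Hypothesis gN : (1 - N%:R^-1 <= g ^+ r.-1)%R.
Hypothesis good : forall w k, G w k -> forall i i' j j',
  (trans q (x w) k (k + r.-1) i j' * trans q (x w) k (k + r.-1) i' j <=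
  N%:R * (trans q (x w) k (k + r.-1) i j * trans q (x w) k (k + r.-1) i' j'))%R.

Let rate s t w : R := (g ^+ good_count r (G w) s t)%R.

Hypothesis mrate : forall s t, measurable_fun setT (rate s t).

Let mV n : measurable_fun setT (V n). Proof. by have [] := VP. Qed.

Let rate0 s t w : (0 <= rate s t w)%R.
Proof. by apply: exprn_ge0; have /andP[] := g01. Qed.

(** Splits the observations at [s] and at [t]. The inner sum, over the states at
    time [l], is the weight of the state [j] at time [s], and the other factor
    does not depend on [l]. *)
Lemma obs_density_path f l s t n (A : set (seqspace Y)) w :
  (l <= s)%N -> (s <= t)%N -> (t <= n)%N ->
  obs_density q Q f (obs V l (n - l) w) (shift (t - l) @^-1` A) =
  (\sum_j (\sum_i f (x w l, i) * trans q (x w) l s i j) *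
    apply_trans q (x w) s t
      (fun j => bwd [seq x w k | k <- iota t.+1 (n - t)] (x w t) j A) j)%R.
Proof.
move=> ls st tn; have lt := leq_trans ls st.
have -> : obs V l (n - l) w = x w l :: [seq x w k | k <- iota l.+1 (n - l)] :> seq X.
  rewrite /obs /xtuple /= /traj addn0; congr cons.
  have -> : iota l.+1 (n - l) = [seq (l + k)%N | k <- iota 1 (n - l)].
    by rewrite -iotaDl addn1.
  by rewrite -map_comp.
rewrite /= (@iota_path l t n) ?lt// map_cat.
set ys := [seq x w k | k <- iota t.+1 (n - t)].
have bc i : bwd ([seq x w k | k <- iota l.+1 (t - l)] ++ ys) (x w l) i
    (shift (t - l) @^-1` A) =
    (\sum_j trans q (x w) l s i j *
      apply_trans q (x w) s t (fun j => bwd ys (x w t) j A) j)%R.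
  rewrite -(@apply_transM _ _ _ _ q (x w) l s t) ?ls//.
  have := bwd_cat q Q [seq x w k | k <- iota l.+1 (t - l)] ys (x w l) i A.
  by rewrite size_map size_iota (last_path (x w)) subnKC.
under eq_bigr do rewrite bc mulr_sumr.
rewrite exchange_big/=; apply: eq_bigr => j _.
by rewrite mulr_suml; apply: eq_bigr => i _; rewrite mulrA.
Qed.

(** The quotients for [l] and for [s] have, by [obs_density_path], the same
    backward factors and different weights. *)
Lemma ratio_close l s t n f f' (A : set (seqspace Y)) w :
  measurable A -> (l <= s)%N -> (s <= t)%N -> (t <= n)%N ->
  (forall z, (0 <= f z)%R) -> (forall z, (0 <= f' z)%R) ->
  (0 < obs_density q Q f (obs V l (n - l) w) setT)%R ->
  (0 < obs_density q Q f' (obs V s (n - s) w) setT)%R ->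
  (`|ratio q Q V l (n - l) f (shift (t - l) @^-1` A) w -
     ratio q Q V s (n - s) f' (shift (t - s) @^-1` A) w| <= rate s t w)%R.
Proof.
move=> mA ls st tn f0 f'0; rewrite /ratio.
have dT k h u : obs_density q Q h u setT =
    obs_density q Q h u (shift k @^-1` [set: nat -> Y]) by [].
rewrite !(dT (t - l)%N f) !(dT (t - s)%N f').
rewrite !(obs_density_path _ _ _ ls st tn) !(obs_density_path _ _ _ (leqnn s) st tn).
have q0 := density_ge0 hq.
set ys := [seq x w k | k <- iota t.+1 (n - t)].
have bb j : (0 <= bwd ys (x w t) j A <= bwd ys (x w t) j setT)%R.
  by rewrite (bwd_ge0 hq) (bwd_le hq).
have b10 j : (0 <= bwd ys (x w t) j setT)%R by exact: (bwd_ge0 hq).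
apply: mixture_ratio_le.
- by move=> j; apply: sumr_ge0 => i _; rewrite mulr_ge0// trans_ge0.
- by move=> j; apply: sumr_ge0 => i _; rewrite mulr_ge0// trans_ge0.
- exact: apply_trans_ge0.
- exact: rate0.
- exact: (path_oscillation q0 r1 N0 g01 gN (@good w)).
Qed.

Local Notation Xgen l n := (process_gen (fun k w => (V k w).1) (time_window l n)).

Let Xgen_measurable l n : Xgen l n `<=` measurable.
Proof.
apply: process_gen_measurable => k.
exact: (measurableT_comp measurable_fst (@mV k)).
Qed.

Definition version (t l : nat) (n : option nat) (A : set (seqspace Y)) (w : Omega) : R :=
  fine (K t l n w A).

Lemma version01 t l n (A : set (seqspace Y)) : measurable A -> unit_valued (version t l n A).
Proof.
move=> mA w; rewrite /version fine_ge0//= -lee_fin fineK ?fin_num_measure//.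
exact: probability_le1.
Qed.

Lemma version_cond_prob t l n (A : set (seqspace Y)) : measurable A ->
  is_cond_prob P (Xgen l n) [set w | A (fun k => (V (t + k)%N w).2)]
    (EFin \o version t l n A).
Proof.
move=> mA; rewrite (_ : _ \o _ = fun w => K t l n w A); first exact: hK.
by apply/funext => w; rewrite /version /= fineK// fin_num_measure.
Qed.

Lemma version_measurable t l n (A : set (seqspace Y)) : measurable A ->
  measurable_fun setT (version t l n A).
Proof.
move=> mA; have [/measurable_EFinP mv _] := version_cond_prob t l n mA.
exact: (measurable_fun_sub (@Xgen_measurable l n) mv).
Qed.

Lemma version_ratio t l n (A : set (seqspace Y)) : measurable A -> (l <= t)%N -> (t <= n)%N ->
  exists2 f : Z -> R, forall z, (0 <= f z)%R &
  {ae P, forall w, (0 < obs_density q Q f (obs V l (n - l) w) setT)%R /\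
    version t l (Some n) A w = ratio q Q V l (n - l) f (shift (t - l) @^-1` A) w}.
Proof.
move=> mA lt tn; have [f fP] := state_density hq VP V0 l.
have [f0 mf _] := fP; exists f => //.
have mA' : measurable (shift (t - l) @^-1` A : set (seqspace Y)).
  exact: (measurable_preim (measurable_shift (t - l)) mA).
have h1 := obs_density_gt0 hq QP VP (n - l) fP.
have h2 := ratio_cond_prob hq QP VP (n - l) fP mA'.
have h3 := version_cond_prob t l (Some n) mA.
have E : obs_gen V l (n - l) = Xgen l (Some n).
  by rewrite /obs_gen subnKC// (leq_trans lt).
have EA : (traj V l : Omega -> seqspace Z) @^-1` yevent (shift (t - l) @^-1` A) =
    [set w | A (fun k => (V (t + k)%N w).2)].
  have E' w : shift (t - l) (ypath (traj V l w)) = fun k => (V (t + k)%N w).2.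
    by apply/funext => k; rewrite /shift /ypath /traj addnA subnKC.
  by apply/seteqP; split => w; rewrite /yevent /= E'.
rewrite E EA in h2.
have r01 := ratio01 hq Q (n - l) fP mA'.
have h4 := cond_prob_ae_eq (@Xgen_measurable l (Some n)) (version01 t l (Some n) mA) r01 h3 h2.
by apply: filterS2 h1 h4 => w.
Qed.

Lemma version_close_finite l s t n (A : set (seqspace Y)) : measurable A ->
  (l <= s)%N -> (s <= t)%N -> (t <= n)%N ->
  {ae P, forall w, (`|version t l (Some n) A w - version t s (Some n) A w| <= rate s t w)%R}.
Proof.
move=> mA ls st tn.
have [f f0 h] := version_ratio mA (leq_trans ls st) tn.
have [f' f'0 h'] := version_ratio mA st tn.
apply: filterS2 h h' => w [d0 ->] [d'0 ->].
exact: ratio_close.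
Qed.

Lemma version_L1_cvg t l (A : set (seqspace Y)) : measurable A ->
  L1_cvg P (fun n => version t l (Some n) A) (version t l None A).
Proof.
move=> mA k.
apply: (@cond_prob_L1_cvg _ Omega R P (fun n => Xgen l (Some n)) (Xgen l None)
  _ _ _ _ [set w | A (fun k => (V (t + k)%N w).2)]).
- by move=> n; exact: Xgen_measurable.
- exact: Xgen_measurable.
- move=> n n' nn'; apply: process_gen_sub => j; rewrite /time_window /=.
  by move=> /andP[-> jn]; exact: leq_trans jn nn'.
- apply: smallest_sub; first exact: smallest_sigma_algebra.
  move=> B [j /andP[lj _] VB]; apply: sub_sigma_algebra; exists j => //.
  apply: sub_sigma_algebra; exists j => //.
  by rewrite /time_window /= lj leqnn.
- exact: version01.
- by move=> n; exact: version01.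
- move=> n; apply: process_gen_sub => j; rewrite /time_window /=.
  by move=> /andP[-> _].
- exact: version_cond_prob.
- by move=> n; exact: version_cond_prob.
Qed.

(** The finite horizons give the infinite one in the limit. *)
Lemma version_close l s t n (A : set (seqspace Y)) : measurable A ->
  (l <= s)%N -> (s <= t)%N -> le_horizon t n ->
  {ae P, forall w, (`|version t l n A w - version t s n A w| <= rate s t w)%R}.
Proof.
move=> mA ls st; case: n => [n|_] /=; first exact: version_close_finite.
apply: (L1_cvg_dist_le (t := t) (f_ := fun n => version t l (Some n) A)
  (g_ := fun n => version t s (Some n) A)).
- exact: version_measurable.
- exact: version_measurable.
- exact: mrate.
- by move=> n; exact: version_measurable.
- by move=> n; exact: version_measurable.
- exact: version_L1_cvg.
- exact: version_L1_cvg.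
- by move=> n tn; exact: version_close_finite.
Qed.

(** The bound on the algebra of cylinders is symmetric in [l] and [s], so both
    orders come at once. *)
Lemma gap_le_rate l s t : (l <= s)%N -> (s <= t)%N ->
  {ae P, forall w, smoothing_gap K l s t w <= (2 * rate s t w)%:E /\
                   smoothing_gap K s l t w <= (2 * rate s t w)%:E}.
Proof.
move=> ls st.
have : {ae P, forall w, forall i : option nat * (nat * seq (seq Y)),
    le_horizon t i.1 ->
    (`|version t l i.1 (cylinder i.2.1 i.2.2) w -
       version t s i.1 (cylinder i.2.1 i.2.2) w| <= rate s t w)%R}.
  apply: ae_forall_countable => -[n NL] /=.
  have [tn|ntn] := boolP (le_horizon t n); last by apply: aeW.
  have mC : measurable (cylinder NL.1 NL.2 : set (seqspace Y)).
    by rewrite measurable_cylinders; apply: sub_sigma_algebra; exists NL.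
  by have := version_close mC ls st tn; apply: filterS.
apply: filterS => w h.
have bound n A : le_horizon t n -> cylinders A ->
    (`|fine (K t l n w A) - fine (K t s n w A)| <= rate s t w)%R.
  by move=> tn [NL ->]; exact: (h (n, NL)).
split; apply: ge_ereal_sup => _ [n tn <-].
- apply: (tv_dist_le measurable_cylinders cylindersT cylindersC cylindersU) => A.
  exact: bound.
- apply: (tv_dist_le measurable_cylinders cylindersT cylindersC cylindersU) => A cA.
  by rewrite distrC; exact: bound.
Qed.

End smoothing.

(** * Good blocks *)

Section blocks.
Context {d : measure_display} {X : measurableType d} {m : nat} {R : realType}.
Variable mu : {sigma_finite_measure set X -> \bar R}.
Local Notation Y := 'I_m.+1.
Local Notation Z := (X * Y)%type.
Variable q : Z -> Z -> R.
Hypothesis hq : transition_density mu q.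
Variables (r : nat) (E : set (r.-tuple X)) (Yp : set (Y * Y)).
Hypothesis hA1 : conditionA1 q E Yp.

Lemma measurable_tuple_nth k :
  measurable_fun setT (fun x : r.-tuple X => nth point x k).
Proof.
have [kr|rk] := ltnP k r.
  rewrite (_ : (fun x => _) = fun x : r.-tuple X => tnth x (Ordinal kr)).
    exact: measurable_tnth.
  by apply/funext => x; rewrite (tnth_nth point).
rewrite (_ : (fun x => _) = fun=> point); first exact: measurable_cst.
by apply/funext => x; rewrite nth_default// size_tuple.
Qed.

Lemma measurable_p i j : measurable_fun setT (fun x : r.-tuple X => p_ q x i j).
Proof.
rewrite (_ : (fun x => _) = fun x : r.-tuple X => (\sum_(y : r.-tuple Y)
    if (nth ord0 y 0 == i) && (nth ord0 y r.-1 == j) then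
      \prod_(1 <= k < r) q (nth point x k, nth ord0 y k)
                           (nth point x k.-1, nth ord0 y k.-1)
    else 0)%R); last by apply/funext => x; rewrite /p_ big_mkcond.
apply: measurable_sum => y.
case: ((nth ord0 y 0 == i) && (nth ord0 y r.-1 == j)); last exact: measurable_cst.
apply: measurable_prod => k _; apply: (measurable_density2 hq);
  apply/measurable_fun_pairP; split;
  by [exact: measurable_tuple_nth|exact: measurable_cst].
Qed.

(** On [E] the support of [p_] is a rectangle, so that a product
    [p_ij * p_i'j'] is positive when [p_ij' * p_i'j] is; the bound by [N] makes
    this quantitative. *)
Definition good_blocks (N : nat) : set (r.-tuple X) :=
  E `&` [set x | forall i i' j j',
    (p_ q x i j' * p_ q x i' j <= N%:R * (p_ q x i j * p_ q x i' j'))%R].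

Lemma measurable_good_blocks N : measurable (good_blocks N).
Proof.
have [_ mE _ _ _] := hA1.
apply: measurableI => //.
rewrite (_ : [set x | _] = \bigcap_(i in [set: Y]) \bigcap_(i' in [set: Y])
   \bigcap_(j in [set: Y]) \bigcap_(j' in [set: Y])
   [set x : r.-tuple X | (p_ q x i j' * p_ q x i' j <=
       N%:R * (p_ q x i j * p_ q x i' j'))%R]); last first.
  by apply/seteqP; split => x h i; [move=> _ i' _ j _ j' _|move=> i' j j'];
    [exact: h|exact: (h i I i' I j I j' I)].
do 4! (apply: fin_bigcap_measurable => [|? _]; first exact: finite_finset).
apply: measurable_le_set; [|apply: measurable_funM => //];
  by apply: measurable_funM; exact: measurable_p.
Qed.

(** There are finitely many quadruples of states. *)
Lemma good_blocks_cover x : E x -> exists N, good_blocks N x.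
Proof.
have [r1 mE Yp0 hE rect] := hA1.
move=> Ex.
have pE i j : (0 < p_ q x i j)%R <-> Yp (i, j) by rewrite -(hE _ Ex).
have p0 i j : (0 <= p_ q x i j)%R.
  by apply: sumr_ge0 => y _; apply: prodr_ge0 => k _; exact: (density_ge0 hq).
have ex (t : Y * Y * Y * Y) : exists N : nat, (p_ q x t.1.1.1 t.2 * p_ q x t.1.1.2 t.1.2 <=
    N%:R * (p_ q x t.1.1.1 t.1.2 * p_ q x t.1.1.2 t.2))%R.
  case: t => -[[i i'] j] j' /=.
  have [h|] := ltP 0%R (p_ q x i j' * p_ q x i' j)%R; last first.
    by exists 0%N; rewrite mul0r.
  have [h1 h2] : Yp (i, j') /\ Yp (i', j).
    rewrite -!pE !lt_neqAle !p0 !andbT ![0%R == _]eq_sym; apply/andP.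
    by rewrite -negb_or -mulf_eq0 gt_eqF.
  have h3 : (0 < p_ q x i j)%R.
    by apply/pE; rewrite rect; split; [exists (i, j')|exists (i', j)].
  have h4 : (0 < p_ q x i' j')%R.
    by apply/pE; rewrite rect; split; [exists (i', j)|exists (i, j')].
  have h5 := mulr_gt0 h3 h4.
  exists (Num.truncn (p_ q x i j' * p_ q x i' j / (p_ q x i j * p_ q x i' j'))).+1.
  by rewrite -ler_pdivrMr// ltW// Num.Theory.truncnS_gt.
have [f hf] := choice ex.
exists (\max_t f t)%N; split => // i i' j j'.
apply: le_trans (hf (i, i', j, j')) _ => /=.
rewrite ler_wpM2r ?mulr_ge0// ler_nat.
exact: (leq_bigmax (i, i', j, j')).
Qed.

Lemma good_blocks_mono N N' : (N <= N')%N -> good_blocks N `<=` good_blocks N'.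
Proof.
move=> NN' x [Ex h]; split => // i i' j j'; apply: le_trans (h i i' j j') _.
have p0 a b : (0 <= p_ q x a b)%R.
  by apply: sumr_ge0 => y _; apply: prodr_ge0 => k _; exact: (density_ge0 hq).
by rewrite ler_wpM2r ?mulr_ge0// ler_nat.
Qed.

Definition block_event (B : set (r.-tuple X)) : set (seqspace Z) := xtuple r @^-1` B.

Lemma measurable_block_event B : measurable B -> measurable (block_event B).
Proof.
move=> mB; have h := measurable_preim (@measurable_xtuple d X m r) mB.
exact: h.
Qed.

Lemma block_trans (w : nat -> Z) k i j :
  p_ q (xtuple r (shift k w)) i j = trans q (fun n => (w n).1) k (k + r.-1) i j.
Proof.
have [r1 _ _ _ _] := hA1.
case: r r1 => // r' _.
rewrite [xtuple _ _]tuple_eta p_tprod /trans /=.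
rewrite (_ : (k + r'.+1.-1 - k)%N = r'); last by rewrite addKn.
congr (tprod q _ _ _ _); last by rewrite /thead (tnth_nth point) /= /shift addn0.
have -> : iota k.+1 r' = [seq (k + n)%N | n <- iota 1 r'] by rewrite -iotaDl addn1.
by rewrite -map_comp.
Qed.

Variable Q : Z -> probability (seqspace Z) R.
Hypothesis QP : forall z, chain_law mu q z (Q z).
Variable psi : {sigma_finite_measure set Z -> \bar R}.
Hypothesis hA2 : conditionA2 mu Q psi E Yp.

Let tail_sectionE r' (E' : set (r'.+1.-tuple X)) x : tail_section E' x =
  (fun u : r'.-tuple X => pcons (x, u)) @^-1` E'.
Proof.
apply/seteqP; split => u /=.
  move=> [v [Ev vx] <-]; rewrite (_ : pcons _ = v)//.
  by apply: val_inj => /=; case/tupleP: v vx {Ev} => a v /= ->.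
move=> Eu; exists (pcons (x, u)); first by split.
by apply: val_inj.
Qed.

(** The density of the observations in [E'] after [(x, i)] dominates the entry
    [p_ij] and so is positive on [E']. *)
Let block_prob_gt0_succ r' (E' : set (r'.+1.-tuple X)) (Yp' : set (Y * Y)) x i j :
  measurable E' -> (forall u, E' u -> Yplus q u = Yp') -> Yp' (i, j) ->
  0 < power_measure mu (tail_section E' x) ->
  0 < Q (x, i) (xtuple r'.+1 @^-1` E').
Proof.
move=> mE hE Yij; rewrite tail_sectionE.
have mEx := measurable_pcons_pre x mE.
rewrite power_measureE// => muE.
have -> : xtuple r'.+1 @^-1` E' = obs_event E' setT :> set (seqspace Z).
  by rewrite /obs_event /yevent preimage_setT setIT.
rewrite (path_density hq QP)//= lt_neqAle integral_ge0 ?andbT; last first.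
  by move=> u _; rewrite lee_fin mulr_ge0 ?(bwd_ge0 hq)// indicE.
apply/eqP => /esym int0.
have mf : measurable_fun setT (fun u : r'.-tuple X =>
    (\1_E' (pcons (x, u)) * bwd q Q u x i setT)%:E).
  apply/measurable_EFinP; apply: measurable_funM; last first.
    exact: (measurable_bwd_fix hq QP).
  exact: (measurable_indic mEx).
have : \int[mpow mu r']_u `|(\1_E' (pcons (x, u)) * bwd q Q u x i setT)%:E| = 0.
  rewrite -[RHS]int0; apply: eq_integral => u _.
  by rewrite gee0_abs// lee_fin mulr_ge0 ?(bwd_ge0 hq)// indicE.
move/(ae_eq_integral_abs _ measurableT mf) => [M [mM M0 hM]].
move: muE; apply/negP; rewrite -leNgt.
rewrite -M0; apply: le_measure; rewrite ?inE//.
move=> u Eu; apply: hM => /= /(_ I).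
rewrite indicE mem_set// mul1r => -[] b0.
have pij : (0 < p_ q (pcons (x, u)) i j)%R.
  by have := hE _ Eu; rewrite predeqE => /(_ (i, j)) [_]; apply.
move: pij; rewrite /pcons p_tprod; apply/negP; rewrite -leNgt.
have : bwd q Q (u ++ [::]) x i (shift (size u) @^-1` setT) = 0%R by rewrite cats0.
rewrite bwd_cat => s0.
have := psumr_eq0P _ s0 => /(_ _ j isT).
rewrite /= (_ : fine _ = 1%R) ?mulr1; last by rewrite probability_setT.
move=> ->// l _.
by rewrite mulr_ge0 ?fine_ge0// tprod_ge0//; exact: (density_ge0 hq).
Qed.

Lemma block_prob_gt0 x i : proj_first E x -> (fst @` Yp) i ->
  0 < Q (x, i) (block_event E).
Proof.
have [r1 mE Yp0 hE rect] := hA1; have [_ _ tail] := hA2.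
move=> Ex [[i0 j] Yij /= i0E]; rewrite {i0}i0E in Yij.
move: (tail x Ex) hE mE; rewrite /block_event.
case: r r1 E => // r' _ E' tE hE mE.
exact: (block_prob_gt0_succ mE hE Yij tE).
Qed.

(** By [conditionA2] the projection of [E] consists of the points over which [E]
    has a section of positive measure. *)
Lemma measurable_start : measurable (proj_first E `*` (fst @` Yp)).
Proof.
have [r1 mE _ _ _] := hA1; have [_ _ tail] := hA2.
apply: measurableX; last by [].
move: mE tail; case: r r1 E => // r' _ E' mE tail.
rewrite (_ : proj_first E' = [set x | 0 < mpow mu r' ((fun u : r'.-tuple X => pcons (x, u)) @^-1` E')]).
  rewrite -(setTI [set x | _]).
  apply: emeasurable_fun_o_infty => //.
  rewrite (_ : (fun x => _) = fun x => \int[mpow mu r']_u (\1_E' (pcons (x, u)))%:E).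
    apply: (@measurable_integral_mpow _ X R mu r' (fun p => (\1_E' (pcons p))%:E)) => [p|].
      by rewrite lee_fin indicE.
    apply/measurable_EFinP.
    exact: (measurableT_comp (measurable_indic mE) (@measurable_pcons _ _ _)).
  apply/funext => x; rewrite -[X in mpow mu r' X]setIT -integral_indic//.
  exact: measurable_pcons_pre.
apply/seteqP; split => x /=.
  move=> /tail; rewrite tail_sectionE power_measureE//.
  exact: measurable_pcons_pre.
have [[u Eu] _|/set0P/negP/negPn/eqP ->] := pselect (((fun u : r'.-tuple X => pcons (x, u)) @^-1` E') !=set0).
  by exists (pcons (x, u)).
by rewrite measure0 ltxx.
Qed.

Lemma start_gt0 : 0 < psi (proj_first E `*` (fst @` Yp)).
Proof.
have [_ + _] := hA2.
by rewrite /completed_measure_extension measurable_mu_extE//; exact: measurable_start.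
Qed.

(** From each state of the starting set in [conditionA2] a block of [E] follows
    with positive probability, and the good blocks exhaust [E]; so the sets of states in the
    statement cover the starting set. *)
Lemma good_block_recurrent : exists N : nat,
  0 < psi [set z | (N.+1%:R^-1)%:E <= Q z (block_event (good_blocks N))].
Proof.
pose T N := [set z | (N.+1%:R^-1)%:E <= Q z (block_event (good_blocks N))].
have mF N : measurable (block_event (good_blocks N)).
  by apply: measurable_block_event; exact: measurable_good_blocks.
have mT N : measurable (T N).
  rewrite -(setTI (T N)); apply: emeasurable_fun_c_infty => //.
  exact: (measurable_law hq QP).
apply: contrapT => /forallNP noN.
have T0 N : psi (T N) = 0.
  by apply/eqP; rewrite -measure_le0 leNgt; apply/negP; exact: noN.
move: start_gt0; apply/negP; rewrite -leNgt.
apply: (le_trans (measure_sigma_subadditive psi mT measurable_start _)); last first.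
  by rewrite eseries0// => N _ _; exact: T0.
move=> [x i] [/= Ex Yi]; apply: contrapT => nT.
have [_ mE _ _ _] := hA1.
have mEE := measurable_block_event mE.
have QN N : Q (x, i) (block_event (good_blocks N)) = 0.
  apply/eqP; rewrite -measure_le0; apply/lee_addgt0Pr => e e0; rewrite add0e.
  pose N' := maxn N (Num.truncn e^-1).
  apply: (@le_trans _ _ (Q (x, i) (block_event (good_blocks N')))).
    apply: le_measure; rewrite ?inE// => w; apply: good_blocks_mono.
    exact: leq_maxl.
  apply: (@le_trans _ _ (N'.+1%:R^-1)%:E).
    by rewrite leNgt; apply/negP => /ltW h; apply: nT; exists N'.
  rewrite lee_fin invf_ple ?posrE// ltW//.
  apply: (lt_le_trans (Num.Theory.truncnS_gt _)).
  by rewrite ler_nat ltnS leq_maxr.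
have := block_prob_gt0 Ex Yi; apply/negP; rewrite -leNgt.
apply: (le_trans (measure_sigma_subadditive (Q (x, i)) mF mEE _)).
  by move=> w /good_blocks_cover [N hN]; exists N.
by rewrite eseries0// => N _ _; exact: QN.
Qed.

End blocks.

(** * Merging of the conditional laws *)

Lemma cvg_geometric_counts (R : realType) (g : R) (c : nat -> nat) :
  (0 <= g < 1)%R -> (forall M, exists T, forall t, (T <= t)%N -> (M <= c t)%N) ->
  (2 * g ^+ c t)%:E @[t --> \oo] --> (0 : \bar R).
Proof.
move=> /andP[g0 g1] cinf; apply/fine_cvgP; split; first by apply: nearW => t.
rewrite /= -[X in _ --> X](mulr0 (2 : R)%R).
apply: cvgMr; apply/cvgrPdist_lt => e e0.
have /cvgrPdist_lt/(_ _ e0)[M _ hM] : (g ^+ n : R)%R @[n --> \oo] --> (0 : R)%R.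
  by apply: cvg_expr; rewrite ger0_norm.
have [T hT] := cinf M; exists T => // t /= Tt.
by apply: hM => /=; exact: hT.
Qed.

(** With at least [n / b - M] good blocks up to time [n], the bound is geometric
    with ratio the [b]-th root of [g]; any larger [alpha] will do. *)
Lemma geometric_of_frequency (R : realType) (g alpha : R) (b M n cnt : nat) :
  (0 < g)%R -> (0 < alpha < 1)%R -> (g <= alpha ^+ b)%R ->
  (n < b * (cnt + M))%N -> (g ^+ cnt <= g ^- M * alpha ^+ n)%R.
Proof.
move=> g0 /andP[a0 a1] gab nb.
rewrite mulrC ler_pdivlMr ?exprn_gt0// -exprD.
apply: (@le_trans _ _ ((alpha ^+ b) ^+ (cnt + M))%R).
  by rewrite lerXn2r// ?nnegrE ?exprn_ge0 ?ltW.
rewrite -exprM; apply: ler_wiXn2l; [exact: ltW|exact: ltW|exact: ltnW].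
Qed.

Section forgetting.
Context {d : measure_display} {X : measurableType d} {m : nat} {R : realType}.
Variable mu : {sigma_finite_measure set X -> \bar R}.
Local Notation Y := 'I_m.+1.
Local Notation Z := (X * Y)%type.
Variable q : Z -> Z -> R.
Hypothesis hq : transition_density mu q.
Variable Q : Z -> probability (seqspace Z) R.
Hypothesis QP : forall z, chain_law mu q z (Q z).
Context {dO : measure_display} {Omega : measurableType dO} (P : probability Omega R).
Variable V : nat -> Omega -> Z.
Hypothesis VP : markov_chain mu P q V.
Hypothesis V0 : has_density mu (fun C : set Z => P (V 0%N @^-1` C)).
Variable K : nat -> nat -> option nat -> Omega -> probability (seqspace Y) R.
Hypothesis hK : regular_version P V K.
Variables (r : nat) (E : set (r.-tuple X)) (Yp : set (Y * Y)).
Hypothesis hA1 : conditionA1 q E Yp.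
Variable psi : {sigma_finite_measure set Z -> \bar R}.
Hypothesis hH : harris_recurrent Q psi.

Section good_block_visits.
Variable N : nat.
Let F : set (seqspace Z) := block_event (good_blocks q E N).
Hypothesis psiF : 0 < psi [set z | (N.+1%:R^-1)%:E <= Q z F].

Let r1 : (1 < r)%N. Proof. by have [] := hA1. Qed.

(* Chosen so that Bernoulli's inequality gives [gN]. *)
Let g : R := (1 - (N.+1 * r)%:R^-1)%R.

Let gP : (0 < g < 1)%R.
Proof.
have Nr : (1 < N.+1 * r)%N by rewrite (leq_trans r1)// leq_pmull.
have Nr0 : (0 < (N.+1 * r)%:R :> R)%R by rewrite ltr0n; exact: ltnW Nr.
have Nr1 : (1 < (N.+1 * r)%:R :> R)%R by rewrite ltr1n.
by rewrite /g subr_gt0 gtrBl invr_gt0 Nr0 andbT invf_lt1.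
Qed.

Let g01 : (0 <= g <= 1)%R.
Proof. by have /andP[h1 h2] := gP; rewrite !ltW. Qed.

Let gN : (1 - N.+1%:R^-1 <= g ^+ r.-1)%R.
Proof.
have r0 : (0 < r)%N by exact: ltnW r1.
have a01 : (0 <= ((N.+1 * r)%:R^-1 : R) <= 1)%R.
  have /andP[h1 h2] := gP; rewrite invr_ge0 ler0n/=.
  by move: h1; rewrite /g subr_gt0 => /ltW.
apply: le_trans (bernoulli_ge r.-1 a01).
rewrite lerD2l lerN2 natrM invfM mulrCA -[leRHS]mulr1 ler_wpM2l ?invr_ge0//.
by rewrite ler_pdivrMr ?ltr0n// mul1r ler_nat leq_pred.
Qed.

Let G (w : Omega) (k : nat) : bool := (traj V k w : seqspace Z) \in F.

Let G_good w k : G w k -> forall i i' j j',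
  (trans q (fun n => (V n w).1) k (k + r.-1) i j' *
   trans q (fun n => (V n w).1) k (k + r.-1) i' j <=
  N.+1%:R * (trans q (fun n => (V n w).1) k (k + r.-1) i j *
             trans q (fun n => (V n w).1) k (k + r.-1) i' j'))%R.
Proof.
move=> /set_mem /(good_blocks_mono hq (leqnSn N)) [_ h] i i' j j'.
by have := h i i' j j'; rewrite !(block_trans hA1 (fun n => V n w)).
Qed.

Let Gs s := process_gen (fun k w => (V k w).1) (time_window s None).

Let measurable_G s j :
  measurable_fun [set: g_sigma_algebraType (Gs s)] (fun w => (G w (s + j)%N : nat)%:R : R).
Proof.
have mx : measurable_fun [set: g_sigma_algebraType (Gs s)]
    (fun w : Omega => xtuple r (traj V (s + j) w)).
  apply/measurable_fun_tnthP => i.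
  rewrite (_ : _ \o _ = fun w => (V (s + j + i)%N w).1); last first.
    apply/funext => w /=; rewrite /xtuple.
    by rewrite tnth_map (tnth_nth 0%N) /= nth_iota.
  move=> _ A mA; apply: sub_sigma_algebra; exists (s + j + i)%N; last by exists A.
  by rewrite /time_window /= -addnA leq_addr.
exact: (measurableT_comp (measurable_indic (measurable_good_blocks hq hA1 N)) mx).
Qed.

Let Gs_measurable s : Gs s `<=` measurable.
Proof.
apply: process_gen_measurable => k.
by apply: (measurableT_comp measurable_fst); have [] := VP.
Qed.

Let measurable_rate_G s t :
  measurable_fun [set: g_sigma_algebraType (Gs s)]
    (fun w => (g ^+ good_count r (G w) s t)%R).
Proof. exact: (@measurable_rate _ (g_sigma_algebraType (Gs s)) R g G r s t (@measurable_G s)). Qed.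

Let gap_le l s t : (l <= s)%N -> (s <= t)%N ->
  {ae P, forall w, smoothing_gap K l s t w <= (2 * g ^+ good_count r (G w) s t)%:E /\
                   smoothing_gap K s l t w <= (2 * g ^+ good_count r (G w) s t)%:E}.
Proof.
apply: (gap_le_rate hq QP VP V0 hK r1 (ltn0Sn N) g01 gN G_good) => s' t'.
exact: (measurable_fun_sub (@Gs_measurable s') (@measurable_rate_G s' t')).
Qed.

Let good_count_visits w s t :
  good_count r (G w) s t = visit_count F (t.+2 - r - s) (traj V s w).
Proof.
apply: eq_bigr => j _; congr (nat_of_bool (_ \in F)).
by apply/funext => i; rewrite /traj /shift addnA.
Qed.

Let mF : measurable F.
Proof. by apply: measurable_block_event; exact: (measurable_good_blocks hq hA1). Qed.

Let HR A : measurable A -> 0 < psi A -> forall z, Q z (visits A) = 1.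
Proof. by move=> mA psiA z; have [_ h] := hH; exact: h. Qed.

Let c0 : (0 < N.+1%:R^-1 :> R)%R. Proof. by rewrite invr_gt0. Qed.

Let blocks_recur : {ae P, forall w, forall s, ~ never F (traj V s w)}.
Proof.
apply: ae_foralln => s; exists ((traj V s : Omega -> seqspace Z) @^-1` never F); split.
- exact: (measurable_preim (measurable_traj (chain_markov hq VP) s) (measurable_never mF)).
- apply: (null_trajectories hq QP VP); first exact: measurable_never.
  exact: (never_null (measurable_kmeas hq) (chain_law_markov hq QP) (chain_law_init QP)
    HR mF c0 psiF).
- by move=> w /= /contrapT.
Qed.

(* If [F] occurs after every time, then iterating the waiting times [f] gives
   arbitrarily many occurrences. *)
Let count_infinite w s : (forall s, ~ never F (traj V s w)) ->
  forall M, exists T, forall t, (T <= t)%N -> (M <= good_count r (G w) s t)%N.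
Proof.
move=> hw.
have ex n : exists fn : nat, exists2 k, (k < fn)%N & G w (s + n + k)%N.
  have : exists k, F (shift k (traj V (s + n) w)).
    by apply: contrapT => /forallNP h; exact: (hw (s + n)%N h).
  move=> [k Fk]; exists k.+1, k => //; rewrite /G mem_set//.
  by move: Fk; congr F; apply/funext => i; rewrite /shift /traj addnA.
have [f hf] := choice ex.
have cnt M : exists n, (M <= \sum_(0 <= j < n) (G w (s + j)%N : nat))%N.
  elim: M => [|M [n hn]]; first by exists 0%N.
  have [k kf Gk] := hf n; exists (n + f n)%N.
  rewrite (@big_cat_nat _ _ _ n)//= ?leq_addr// -addn1 leq_add//.
  rewrite -{1}(add0n n) big_addn addKn big_mkord (bigD1 (Ordinal kf))//=.
  by rewrite (addnC k) addnA Gk.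
move=> M; have [n hn] := cnt M; exists (n + s + r)%N => t ht.
have nt : (n <= t.+2 - r - s)%N by lia.
apply: (leq_trans hn); rewrite /good_count [leqRHS](@big_cat_nat _ _ _ n)//=.
exact: leq_addr.
Qed.

Lemma smoothing_gap_cvg0 l s :
  {ae P, forall w, (fun t => smoothing_gap K l s t w) @ \oo --> 0}.
Proof.
(* The bound does not depend on which of [l] and [s] comes first, but it counts
   the good blocks from the later one on. *)
pose a := minn l s; pose b := maxn l s.
have : {ae P, forall w, forall t, (b <= t)%N ->
    smoothing_gap K l s t w <= (2 * g ^+ good_count r (G w) b t)%:E}.
  apply: ae_foralln => t; have [bt|] := leqP b t; last by move=> _; apply: aeW.
  have ab : (a <= b)%N by rewrite /a /b geq_min leq_max leqnn.
  have := gap_le ab bt; apply: filterS => w [h1 h2] _.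
  move: h1 h2; rewrite /a /b; have [ls|sl] := leqP l s => // h1 h2.
move=> h; apply: filterS2 h blocks_recur => w hgap hw.
have /andP[g0 g1] := gP.
apply: (@squeeze_cvge _ _ _ _ (fun=> 0) _ (fun t => (2 * g ^+ good_count r (G w) b t)%:E)).
- exists b => // t /= bt; rewrite (hgap t bt) andbT.
  apply: (le_trans (tv_dist_ge0 (K t l None w) (K t s None w))).
  by apply: ereal_sup_ubound; exists None.
- exact: cvg_cst.
- apply: cvg_geometric_counts; first by rewrite g1 ltW.
  exact: count_infinite.
Qed.

Lemma smoothing_gap_geometric : positive_chain mu q ->
  exists alpha : R, [/\ (0 < alpha)%R, (alpha < 1)%R &
     forall s : nat, exists C : Omega -> R,
       measurable_fun [set: g_sigma_algebraType (Gs s)] C /\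
       forall t l : nat, (l <= s)%N -> (s <= t)%N ->
         {ae P, forall w, smoothing_gap K l s t w <= (C w * alpha ^+ (t - s))%:E}].
Proof.
move=> [pi pi_inv]; have /andP[g0 g1] := gP.
have psiT : 0 < psi setT.
  apply: lt_le_trans psiF _; apply: le_measure; rewrite ?inE//.
  rewrite -(setTI [set _ | _]); apply: emeasurable_fun_c_infty => //.
  exact: (measurable_law hq QP).
have [b b0 Qb] := sparse_null (measurable_kmeas hq) (kmeas1 hq) (chain_law_markov hq QP)
  (chain_law_init QP) (pi := pi) pi_inv mF psiT HR c0 psiF.
(* By Bernoulli's inequality [g <= alpha ^+ b]. *)
pose alpha : R := (1 - (1 - g) / b%:R)%R.
have bR : (1 <= b%:R :> R)%R by rewrite ler1n.
have bR0 : (0 < b%:R :> R)%R by rewrite ltr0n.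
have gb01 : (0 <= (1 - g) / b%:R <= 1)%R.
  by rewrite divr_ge0 ?subr_ge0 ?(ltW g1)//= ler_pdivrMr// mul1r; lra.
have ab : (g <= alpha ^+ b)%R.
  apply: le_trans (bernoulli_ge b gb01).
  by rewrite mulrC divfK ?gt_eqF// subKr.
have a0 : (0 < alpha)%R.
  rewrite /alpha subr_gt0 ltr_pdivrMr// mul1r; lra.
have a1 : (alpha < 1)%R by rewrite /alpha gtrBl divr_gt0// subr_gt0.
exists alpha; split => // s.
(* The constant is the supremum over [n = t - s] of this quotient. *)
pose u n w : \bar R := (2 * g ^+ good_count r (G w) s (s + n) / alpha ^+ n)%:E.
have u0 n w : 0 <= u n w.
  by rewrite lee_fin divr_ge0 ?mulr_ge0 ?exprn_ge0 ?ltW.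
exists (fun w => fine (esups (u ^~ w) 0%N)); split.
  apply: measurableT_comp => //; apply: measurable_fun_esups => n.
  apply/measurable_EFinP; apply: measurable_funM => //; apply: measurable_funM => //.
move=> t l ls st.
have hsparse : {ae P, forall w, ~ sparse F b (traj V s w)}.
  exists ((traj V s : Omega -> seqspace Z) @^-1` sparse F b); split.
  - have mS := measurable_sparse R b mF.
    have mt := measurable_traj (chain_markov hq VP) s.
    exact: (measurable_preim mt mS).
  - by apply: (null_trajectories hq QP VP) => //; exact: measurable_sparse.
  - by move=> w /= /contrapT.
apply: filterS2 hsparse (gap_le ls st) => w nsp [gap_w _].
have [M hM] : exists M, forall n, (n < b * (visit_count F n (traj V s w) + M))%N.
  apply: contrapT => /forallNP h; apply: nsp => M.
  have /existsNP[n /negP] := h M; rewrite -leqNgt => hn.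
  by exists n.
(* The last [r - 1] starting points up to [t] leave no room for a block, whence
   the factor [alpha ^- r]. *)
have ubound n : (u n w <= (2 * (g ^- M * alpha ^- r))%:E).
  rewrite lee_fin ler_pdivrMr ?exprn_gt0// -mulrA ler_wpM2l//.
  rewrite good_count_visits.
  have := geometric_of_frequency g0 _ ab (hM ((s + n).+2 - r - s)%N).
  rewrite a0 a1 => /(_ isT) h; apply: (le_trans h).
  rewrite -mulrA ler_wpM2l ?invr_ge0 ?exprn_ge0 ?(ltW g0)//.
  rewrite mulrC ler_pdivlMr ?exprn_gt0// -exprD.
  apply: ler_wiXn2l; [exact: ltW|exact: ltW|].
  by rewrite addnC -leq_subLR subnAC -!addnS addKn leq_sub2r// -addn2 leq_addr.
have sup_fin : esups (u ^~ w) 0%N \is a fin_num.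
  rewrite ge0_fin_numE; last first.
    by apply: (le_trans (u0 0%N w)); apply: ereal_sup_ubound; exists 0%N.
  apply: (@le_lt_trans _ _ (2 * (g ^- M * alpha ^- r))%:E); last exact: ltry.
  by apply: ge_ereal_sup => _ [n _ <-]; exact: ubound.
apply: (le_trans gap_w).
rewrite [leRHS]EFinM fineK//.
apply: (@le_trans _ _ (u (t - s)%N w * (alpha ^+ (t - s))%:E)).
  by rewrite -EFinM lee_fin subnKC// divfK ?gt_eqF ?exprn_gt0.
apply: lee_wpmul2r; first by rewrite lee_fin exprn_ge0// ltW.
by apply: ereal_sup_ubound; exists (t - s)%N.
Qed.

End good_block_visits.
End forgetting.

Theorem corollary3p1 (R : realType)
  (X : completePseudoMetricType R) (hX : polish X) (m : nat)
  (mu : {sigma_finite_measure set (borel X) -> \bar R})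
  (q : borel X * 'I_m.+1 -> borel X * 'I_m.+1 -> R)
  (hq : transition_density mu q)
  (dO : measure_display) (Omega : measurableType dO) (P : probability Omega R)
  (Z : nat -> Omega -> borel X * 'I_m.+1)
  (hZ : markov_chain mu P q Z)
  (hZ1 : has_density mu (fun C : set (borel X * 'I_m.+1) => P (Z 0%N @^-1` C)))
  (Pz : borel X * 'I_m.+1 -> probability (seqspace (borel X * 'I_m.+1)%type) R)
  (hPz : forall z, chain_law mu q z (Pz z))
  (K : nat -> nat -> option nat -> Omega -> probability (seqspace 'I_m.+1) R)
  (hK : regular_version P Z K)
  (r : nat) (E : set (r.-tuple (borel X))) (Yp : set ('I_m.+1 * 'I_m.+1))
  (psi : {sigma_finite_measure set (borel X * 'I_m.+1)%type -> \bar R})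
  (hA1 : conditionA1 q E Yp)
  (hA2 : conditionA2 mu Pz psi E Yp)
  (hH : harris_recurrent Pz psi) :
  (forall l s : nat,
     \forall w \ae P, (fun t => smoothing_gap K l s t w) @ \oo --> 0) /\
  (positive_chain mu q ->
   exists alpha : R, [/\ (0 < alpha)%R, (alpha < 1)%R &
     forall s : nat, exists C : Omega -> R,
       measurable_fun [set: g_sigma_algebraType
         (process_gen (fun k w => (Z k w).1) (time_window s None))] C /\
       forall t l : nat, (l <= s)%N -> (s <= t)%N ->
         \forall w \ae P, smoothing_gap K l s t w <= (C w * alpha ^+ (t - s))%:E]).
Proof.
have [N psiF] := good_block_recurrent hq hA1 hPz hA2.
split=> [l s|pos].
  exact: (smoothing_gap_cvg0 hq hPz hZ hZ1 hK hA1 hH psiF l s).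
exact: (smoothing_gap_geometric hq hPz hZ hZ1 hK hA1 hH psiF pos).
Qed.
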